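(* There is a uniquely determined strongly bicovariant exterior algebra $\Omega(\mathbb C[g,g^{-1}]\blacktriangleright\!\!\!\triangleleft\mathbb C[p])$ on the Planck-scale Hopf algebra such that the coaction $\Delta_R:\mathbb C[r]\to\mathbb C[r]\otimes(\mathbb C[g,g^{-1}]\blacktriangleright\!\!\!\triangleleft\mathbb C[p])$, $\Delta_Rr=1\otimes p+r\otimes g$, is differentiable. This has relations $$[dg,g]=0,\quad[p,dp]=\lambda dp,\quad[g,dp]=\lambda g\,dg,\quad[p,dg]=\lambda(1-g)dg,$$ $$(dp)^2=(dg)^2=0,\quad dp\,dg=-dg\,dp.$$ Moreover, $\Omega(\mathbb C[g,g^{-1}]\blacktriangleright\!\!\!\triangleleft\mathbb C[p])=\Omega(\mathbb C[g,g^{-1}])\blacktriangleright\!\!\!\triangleleft\Omega(\mathbb C[p])$ and it has coproduct $$\Delta g=g\otimes g,\quad\Delta_*dg=dg\otimes g+g\otimes dg,\quad\Delta p=1\otimes p+p\otimes g,\quad\Delta_*dp=1\otimes dp+dp\otimes g+p\otimes dg.$$ Here uniquely determined is meant in the universal sense: the relations are those following from differentiability of $\Delta_R$ alone (other calculi with this property being quotients).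
   Context: $\lambda$ is a nonzero imaginary constant. The Planck-scale Hopf algebra $\mathbb C[g,g^{-1}]\blacktriangleright\!\!\!\triangleleft\mathbb C[p]$ is generated by $g,g^{-1},p$ with $[p,g]=\lambda(1-g)g$, $\Delta g=g\otimes g$, $\Delta p=1\otimes p+p\otimes g$. $\mathbb C[r]$ is another copy of $\mathbb C[p]$, with exterior algebra $[r,dr]=\lambda dr$, $(dr)^2=0$. An exterior algebra on an algebra $A$ is a DGA $\Omega(A)=\oplus_{n\ge0}\Omega^n(A)$ with $\Omega^0=A$, generated by $A$ and $\Omega^1=\mathrm{span}\{a\,db\}$, $d^2=0$, graded Leibniz rule. The super tensor product $\underline\otimes$ has product $(a\otimes b)(c\otimes e)=(-1)^{|b||c|}ac\otimes be$ and differential $d\otimes\mathrm{id}+(-1)^{|\ |}\mathrm{id}\otimes d$. For a Hopf algebra, $\Omega(A)$ is strongly bicovariant if it is a super-Hopf algebra (grade = form degree mod 2) with $\Delta_*$ preserving total degree, restricting to $\Delta$, and $\Delta_*d=(d\otimes\mathrm{id}+(-1)^{|\ |}\mathrm{id}\otimes d)\Delta_*$. A coaction $B\to B\otimes K$ (comodule algebra) is differentiable if it extends to a degree-preserving DGA map $\Omega(B)\to\Omega(B)\underline\otimes\Omega(K)$. In the super bicrossproduct, $\Omega(\mathbb C[g,g^{-1}])$ has $[dg,g]=0$, $(dg)^2=0$; $\Omega(\mathbb C[p])$ has $[p,dp]=\lambda dp$, $(dp)^2=0$ ($p$, $dp$ primitive); the action is $p\triangleright g=\lambda(1-g)g$,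 $dp\triangleright g=-\lambda g\,dg$, $p\triangleright dg=\lambda(1-g)dg$, $dp\triangleright dg=0$; the coaction is $\beta(p)=p\otimes g$, $\beta_*(dp)=dp\otimes g+p\otimes dg$. In general $\Omega(A)\blacktriangleright\!\!\!\triangleleft\Omega(H)$ is $\Omega(A)\otimes\Omega(H)$ with product $(\omega\otimes\eta)(\tau\otimes\xi)=(-1)^{|\eta_{(2)}||\tau|}\omega(\eta_{(1)}\triangleright\tau)\otimes\eta_{(2)}\xi$, coproduct $\Delta_*(\omega\otimes\eta)=(-1)^{|\omega_{(2)}||\eta_{(1)}{}^{(0)}|}\omega_{(1)}\otimes\eta_{(1)}{}^{(0)}\otimes\omega_{(2)}\eta_{(1)}{}^{(1)}\otimes\eta_{(2)}$, where $\beta_*(\eta)=\eta^{(0)}\otimes\eta^{(1)}$, and $d(\omega\otimes\eta)=d\omega\otimes\eta+(-1)^{|\omega|}\omega\otimes d\eta$. *)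

(* Defs.v *)
From HB Require Import structures.
From mathcomp Require Import all_boot all_order all_algebra.
From mathcomp Require Import boolp classical_sets reals.
From mathcomp Require Import complex.

Set Implicit Arguments.
Unset Strict Implicit.
Unset Printing Implicit Defensive.

Import Order.TTheory GRing.Theory Num.Theory.
Local Open Scope ring_scope.
Local Open Scope quotient_scope.

Section Tensor.
Variables (K : fieldType) (V W : lmodType K).

Definition bilin (U : lmodType K) (F : V -> W -> U) : Prop :=
  (forall w, linear (F^~ w)) /\ (forall v, linear (F v)).

(* A formal sum of pairs (v, w) stands for the sum of the v ⊗ w; two formal
   sums are identified when no bilinear map tells them apart, which is the
   quotient of the free module by the bilinearity relations. *)
Definition tens_rel (s t : seq (V * W)) : bool :=
  `[< forall (U : lmodType K) (F : V -> W -> U), bilin F ->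
      \sum_(x <- s) F x.1 x.2 = \sum_(x <- t) F x.1 x.2 >].

Lemma tens_rel_refl : reflexive tens_rel.
Proof. by move=> s; apply/asboolP. Qed.
Lemma tens_rel_sym : symmetric tens_rel.
Proof.
by move=> s t; apply/idP/idP => /asboolP h; apply/asboolP => U F bF;
  rewrite (h U F bF).
Qed.
Lemma tens_rel_trans : transitive tens_rel.
Proof.
move=> t s u /asboolP h1 /asboolP h2; apply/asboolP => U F bF.
by rewrite (h1 U F bF) (h2 U F bF).
Qed.

Canonical tens_equiv :=
  EquivRel tens_rel tens_rel_refl tens_rel_sym tens_rel_trans.

Definition tens : Type := {eq_quot tens_equiv}.
HB.instance Definition _ := Choice.on tens.

(* [tsum F t] is the sum of F v w over the pure tensors v ⊗ w that make up t;
   for bilinear F it does not depend on the chosen representative. *)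
Definition tsum (U : lmodType K) (F : V -> W -> U) (t : tens) : U :=
  \sum_(x <- repr (t : {eq_quot tens_equiv})) F x.1 x.2.

Definition tens_mk (s : seq (V * W)) : tens := \pi_{eq_quot tens_equiv} s.

Definition tpure (v : V) (w : W) : tens := tens_mk [:: (v, w)].

Lemma tsum_mk (U : lmodType K) (F : V -> W -> U) s : bilin F ->
  tsum F (tens_mk s) = \sum_(x <- s) F x.1 x.2.
Proof.
move=> bF; have /eqmodP/asboolP : repr (tens_mk s : {eq_quot tens_equiv}) = s
  %[mod {eq_quot tens_equiv}] by rewrite reprK.
by apply.
Qed.

Lemma tens_ext (t t' : tens) :
  (forall (U : lmodType K) (F : V -> W -> U), bilin F -> tsum F t = tsum F t') ->
  t = t'.
Proof.
move=> h; rewrite -[t](@reprK _ {eq_quot tens_equiv}).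
rewrite -[t'](@reprK _ {eq_quot tens_equiv}).
by apply/eqmodP/asboolP => U F bF; apply: h.
Qed.

Definition tens0 : tens := tens_mk [::].
Definition tens_add (t u : tens) : tens :=
  tens_mk (repr (t : {eq_quot tens_equiv}) ++ repr (u : {eq_quot tens_equiv})).
Definition tens_scale (c : K) (t : tens) : tens :=
  tens_mk [seq (c *: x.1, x.2) | x <- repr (t : {eq_quot tens_equiv})].
Definition tens_opp (t : tens) : tens := tens_scale (-1) t.

Lemma bilinZl (U : lmodType K) (F : V -> W -> U) : bilin F ->
  forall c v w, F (c *: v) w = c *: F v w.
Proof. by move=> [h _] c v w; rewrite (scalable_linear (h w)). Qed.
Lemma bilinZr (U : lmodType K) (F : V -> W -> U) : bilin F ->
  forall c v w, F v (c *: w) = c *: F v w.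
Proof. by move=> [_ h] c v w; rewrite (scalable_linear (h v)). Qed.
Lemma bilinDl (U : lmodType K) (F : V -> W -> U) : bilin F ->
  forall v v' w, F (v + v') w = F v w + F v' w.
Proof. by move=> [h _] v v' w; have := h w 1 v v'; rewrite !scale1r. Qed.
Lemma bilinDr (U : lmodType K) (F : V -> W -> U) : bilin F ->
  forall v w w', F v (w + w') = F v w + F v w'.
Proof. by move=> [_ h] v w w'; have := h v 1 w w'; rewrite !scale1r. Qed.

Lemma bilin0l (U : lmodType K) (F : V -> W -> U) : bilin F ->
  forall w, F 0 w = 0.
Proof. by move=> bF w; rewrite -(scale0r 0) bilinZl // scale0r. Qed.
Lemma bilin0r (U : lmodType K) (F : V -> W -> U) : bilin F ->
  forall v, F v 0 = 0.
Proof. by move=> bF w; rewrite -(scale0r 0) bilinZr // scale0r. Qed.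

Lemma tsum0_ (U : lmodType K) (F : V -> W -> U) : bilin F -> tsum F tens0 = 0.
Proof. by move=> bF; rewrite tsum_mk // big_nil. Qed.
Lemma tsumD_ (U : lmodType K) (F : V -> W -> U) t u : bilin F ->
  tsum F (tens_add t u) = tsum F t + tsum F u.
Proof. by move=> bF; rewrite tsum_mk // big_cat. Qed.
Lemma tsumZ_ (U : lmodType K) (F : V -> W -> U) c t : bilin F ->
  tsum F (tens_scale c t) = c *: tsum F t.
Proof.
move=> bF; rewrite tsum_mk // big_map scaler_sumr.
by apply: eq_bigr => x _; rewrite bilinZl.
Qed.

Lemma tens_addA : associative tens_add.
Proof. by move=> a b c; apply: tens_ext => U F bF; rewrite !tsumD_ // addrA. Qed.
Lemma tens_addC : commutative tens_add.
Proof. by move=> a b; apply: tens_ext => U F bF; rewrite !tsumD_ // addrC. Qed.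
Lemma tens_add0 : left_id tens0 tens_add.
Proof. by move=> a; apply: tens_ext => U F bF; rewrite tsumD_ // tsum0_ // add0r. Qed.
Lemma tens_addN : left_inverse tens0 tens_opp tens_add.
Proof.
move=> a; apply: tens_ext => U F bF.
by rewrite tsumD_ // tsum0_ // tsumZ_ // scaleN1r addNr.
Qed.
HB.instance Definition _ :=
  GRing.isZmodule.Build tens tens_addA tens_addC tens_add0 tens_addN.

Lemma tens_scaleA a b (t : tens) :
  tens_scale a (tens_scale b t) = tens_scale (a * b) t.
Proof. by apply: tens_ext => U F bF; rewrite !tsumZ_ // scalerA. Qed.
Lemma tens_scale1 : left_id 1 tens_scale.
Proof. by move=> t; apply: tens_ext => U F bF; rewrite tsumZ_ // scale1r. Qed.
Lemma tens_scaleDr : right_distributive tens_scale +%R.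
Proof.
move=> c t u; apply: tens_ext => U F bF.
by rewrite tsumZ_ // !tsumD_ // !tsumZ_ // scalerDr.
Qed.
Lemma tens_scaleDl (t : tens) : {morph tens_scale^~ t : a b / a + b}.
Proof.
move=> a b; apply: tens_ext => U F bF.
by rewrite tsumZ_ // tsumD_ // !tsumZ_ // scalerDl.
Qed.
HB.instance Definition _ := GRing.Zmodule_isLmodule.Build K tens
  tens_scaleA tens_scale1 tens_scaleDr tens_scaleDl.

Lemma tsum_pure (U : lmodType K) (F : V -> W -> U) v w : bilin F ->
  tsum F (tpure v w) = F v w.
Proof. by move=> bF; rewrite tsum_mk // big_seq1. Qed.

Lemma tsum_lin (U : lmodType K) (F : V -> W -> U) : bilin F -> linear (tsum F).
Proof. by move=> bF c t u; rewrite tsumD_ // tsumZ_. Qed.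

Lemma bilin_tpure : bilin tpure.
Proof.
split=> [w|v] c x y; apply: tens_ext => U F bF;
  rewrite (tsum_lin bF) !tsum_pure //; first by rewrite bilinDl // bilinZl.
by rewrite bilinDr // bilinZr.
Qed.

Lemma tens_mkE s : tens_mk s = \sum_(x <- s) tpure x.1 x.2.
Proof.
apply: tens_ext => U F bF; rewrite tsum_mk //.
elim: s => [|x s IH]; first by rewrite !big_nil; exact/esym/tsum0_.
by rewrite !big_cons tsumD_ // -IH tsum_pure.
Qed.

Lemma tensE (t : tens) : t = tsum tpure t.
Proof.
by rewrite /tsum -tens_mkE /tens_mk reprK.
Qed.

Lemma tens_ind (P : tens -> Prop) : P 0 ->
  (forall t u, P t -> P u -> P (t + u)) -> (forall v w, P (tpure v w)) ->
  forall t, P t.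
Proof. by move=> P0 PD Pp t; rewrite (tensE t); apply: big_ind. Qed.

End Tensor.

Notation "v ⊗ w" := (tpure v w) (at level 39, left associativity) : ring_scope.
Notation "'\tsum_' ( v , w <- t ) E" := (tsum (fun v w => E) t)
  (at level 41, E at level 41, v name, w name, t at level 60,
   format "'\tsum_' ( v ,  w  <-  t )  E") : ring_scope.

Section LinearForm.
Variables (K : fieldType) (V : lmodType K).

Let avoids (v : V) (M : set V) : Prop :=
  (forall c x y, M x -> M y -> M (c *: x + y)) /\ ~ M v.

Lemma exists_linear_form (v : V) : v != 0 ->
  exists f : V -> K^o, linear f /\ f v = 1.
Proof.
move=> v0.
have [|M [[Ml Mv] Mmax]] := @Zorn_bigcup V (avoids v).
  move=> F FP Ftot; split=> [c x y [X FX Xx] [Y FY Yy]|[X FX]]; last first.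
    by have [_] := FP X FX.
  have [XY|YX] := Ftot X Y FX FY.
    by exists Y => //; apply: (FP Y FY).1 => //; apply: XY.
  by exists X => //; apply: (FP X FX).1 => //; apply: YX.
have M0 : M 0.
  have [[x Mx]|Mn] := pselect (exists x, M x).
    by rewrite -(subrr x) addrC -scaleN1r; apply: Ml.
  exfalso; apply: (Mmax (fun x => x = 0) _ _); first split.
  - by move=> x Mx; case: Mn; exists x.
  - by move=> h; apply: Mn; exists 0; apply: h.
  split=> [c x y -> ->|/eqP]; first by rewrite scaler0 addr0.
  by rewrite (negPf v0).
have MZ c x : M x -> M (c *: x).
  by move=> Mx; rewrite -(addr0 (c *: x)); apply: Ml.
have MB x y : M x -> M y -> M (x - y).
  by move=> Mx My; rewrite addrC -scaleN1r; apply: Ml.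
have dec w : exists c, M (w - c *: v).
  have [Mw|nMw] := pselect (M w); first by exists 0; rewrite scale0r subr0.
  have [[c [m [Mm vE]]]|nv] := pselect (exists c m, M m /\ v = m + c *: w).
    have c0 : c != 0.
      by apply: contra_notN Mv => /eqP c0; rewrite vE c0 scale0r addr0.
    exists c^-1; rewrite vE scalerDr scalerA mulVf // scale1r opprD addrC.
    by rewrite subrK -scaleNr; apply: MZ.
  exfalso; apply: (Mmax (fun x => exists c m, M m /\ x = m + c *: w) _ _); first split.
  - by move=> x Mx; exists 0, x; rewrite scale0r addr0.
  - move=> h; apply: nMw; apply: h; exists 1, 0; split => //.
    by rewrite scale1r add0r.
  split=> [c x y [a [m [Mm ->]]] [b [n [Mn ->]]]|[c [m h]]]; last first.
    by apply: nv; exists c, m.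
  exists (c * a + b), (c *: m + n); split; first exact: Ml.
  by rewrite scalerDr scalerA scalerDl addrACA.
have uni w c c' : M (w - c *: v) -> M (w - c' *: v) -> c = c'.
  move=> h h'; have := MB _ _ h h'; rewrite opprB addrC addrA subrK.
  rewrite addrC -scaleNr -scalerDl => Mcv; apply/eqP; rewrite -subr_eq0.
  apply: contra_notT Mv => cc.
  by have := MZ (- c + c')^-1 _ Mcv; rewrite scalerA mulVf ?scale1r // addrC
    subr_eq0 eq_sym -subr_eq0.
pose f w : K^o := projT1 (cid (dec w)).
have fP w : M (w - f w *: v) by rewrite /f; case: cid.
exists f; split=> [c x y|]; last first.
  by apply: (uni _ _ _ (fP v)); rewrite scale1r subrr.
apply: (uni _ _ _ (fP _)); rewrite [c *: f x]/(c * f x) scalerDl opprD addrACA.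
by rewrite -scalerA -scalerBr; apply: Ml.
Qed.

Lemma tpure_neq0 (W : lmodType K) (v : V) (w : W) (g : W -> K^o) :
  v != 0 -> linear g -> g w = 1 -> v ⊗ w != 0.
Proof.
move=> /exists_linear_form [f [lf fv]] lg gw; apply/eqP.
have bF : bilin (fun v w => f v * g w : K^o).
  split=> [y|x] c a b /=.
    by rewrite lf mulrDl; congr (_ + _); rewrite -mulrA.
  by rewrite lg mulrDr; congr (_ + _); rewrite /GRing.scale /= mulrCA.
move=> /(congr1 (tsum (fun v w => f v * g w : K^o))).
rewrite tsum_pure // fv gw mulr1 -(subrr (v ⊗ w)) addrC -scaleN1r.
by rewrite (tsum_lin bF) scaleN1r addNr => /eqP; rewrite oner_eq0.
Qed.
End LinearForm.

(* Differential graded algebras with their grading internal to the carrier: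
   [hc n w] is the component of degree n of w. *)
Record dga (K : fieldType) := Dga {
  dga_alg :> algType K;
  hc : nat -> dga_alg -> dga_alg;
  dd : dga_alg -> dga_alg;
  hc_lin : forall n, linear (hc n);
  hc_hc : forall m n w, hc m (hc n w) = if m == n then hc n w else 0;
  hc_sum : forall w, exists N : nat, w = \sum_(i < N) hc i w;
  hc_one : hc 0 1 = 1;
  hc_mul : forall m n a b, hc m a = a -> hc n b = b ->
    hc (m + n) (a * b) = a * b;
  dd_lin : linear dd;
  hc_dd : forall n a, hc n a = a -> hc n.+1 (dd a) = dd a;
  dd_dd : forall a, dd (dd a) = 0;
  dd_mul : forall n a b, hc n a = a ->
    dd (a * b) = dd a * b + (-1) ^+ n *: (a * dd b)
}.

Arguments hc {K Om} n w : rename.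
Arguments dd {K Om} w : rename.

Section DgaTheory.
Variables (K : fieldType) (Om : dga K).
Implicit Types a b w : Om.

HB.instance Definition _ n :=
  GRing.isLinear.Build K Om Om *:%R (@hc K Om n) (@hc_lin K Om n).
HB.instance Definition _ :=
  GRing.isLinear.Build K Om Om *:%R (@dd K Om) (@dd_lin K Om).

Lemma hcK m n w : hc n w = w -> hc m w = if m == n then w else 0.
Proof. by move=> <-; rewrite hc_hc. Qed.

Definition hbound w : nat := projT1 (cid (hc_sum w)).

Lemma hboundP w : w = \sum_(i < hbound w) hc i w.
Proof. by rewrite /hbound; case: cid. Qed.

Lemma hc_big w n : (hbound w <= n)%N -> hc n w = 0.
Proof.
move=> le; rewrite {1}(hboundP w) linear_sum big1 // => i _.
by rewrite /= hc_hc gtn_eqF // (leq_trans (ltn_ord i)).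
Qed.

(* (-1)^|w| w *)
Definition par w : Om := \sum_(i < hbound w) (-1) ^+ i *: hc i w.
End DgaTheory.

Section Koszul.
Variables (K : fieldType) (Om Om' : dga K).

(* (-1)^(|b||c|) F b c, extended bilinearly from homogeneous b and c *)
Definition kos (U : lmodType K) (F : Om -> Om' -> U) (b : Om) (c : Om') : U :=
  \sum_(i < hbound b) \sum_(j < hbound c) (-1) ^+ (i * j) *: F (hc i b) (hc j c).

End Koszul.

Section KoszulTheory.
Variables (K : fieldType).

Lemma sum_widen (U : zmodType) (f : nat -> U) m n : (m <= n)%N ->
  (forall i, (m <= i)%N -> f i = 0) -> \sum_(i < m) f i = \sum_(i < n) f i.
Proof.
move=> le f0; rewrite -(big_mkord xpredT f) -(big_mkord xpredT f).
rewrite [RHS](@big_cat_nat _ _ _ m) //= [X in _ = _ + X]big_nat_cond.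
by rewrite [X in _ = _ + X]big1 ?addr0 // => i /andP[/andP[? _] _]; apply: f0.
Qed.

Lemma parE (Om : dga K) (w : Om) N : (hbound w <= N)%N ->
  par w = \sum_(i < N) (-1) ^+ i *: hc i w.
Proof.
move=> le; apply: (@sum_widen _ (fun i => (-1) ^+ i *: hc i w)) => // i wi.
by rewrite hc_big ?scaler0.
Qed.

Lemma par_lin (Om : dga K) : linear (@par K Om).
Proof.
move=> c x y; pose N := maxn (hbound (c *: x + y)) (maxn (hbound x) (hbound y)).
rewrite !(@parE _ _ N) /N ?leq_max ?leqnn ?orbT //.
rewrite scaler_sumr -big_split /=; apply: eq_bigr => i _.
by rewrite linearP scalerDr !scalerA mulrC.
Qed.

Lemma par_hom (Om : dga K) n (w : Om) : hc n w = w -> par w = (-1) ^+ n *: w.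
Proof.
move=> hw; rewrite (@parE _ _ (maxn (hbound w) n.+1)) ?leq_maxl //.
have nN : (n < maxn (hbound w) n.+1)%N by rewrite leq_max leqnn orbT.
rewrite (bigD1 (Ordinal nN)) //= hw big1 ?addr0 // => i ne.
by rewrite (hcK _ hw) ifN ?scaler0.
Qed.

Lemma bilin_kos_hc (Om Om' : dga K) (U : lmodType K) (F : Om -> Om' -> U) i j :
  bilin F -> bilin (fun b c => (-1) ^+ (i * j) *: F (hc i b) (hc j c)).
Proof.
move=> bF; split=> [c|b] k x y /=; rewrite linearP.
  rewrite (bilinDl bF) (bilinZl bF). by rewrite scalerDr !scalerA mulrC.
by rewrite (bilinDr bF) (bilinZr bF) scalerDr !scalerA mulrC.
Qed.

Lemma kosE (Om Om' : dga K) (U : lmodType K) (F : Om -> Om' -> U) b c M N :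
  bilin F -> (hbound b <= M)%N -> (hbound c <= N)%N ->
  kos F b c =
  \sum_(i < M) \sum_(j < N) (-1) ^+ (i * j) *: F (hc i b) (hc j c).
Proof.
move=> bF lM lN.
transitivity (\sum_(i < hbound b) \sum_(j < N)
    (-1) ^+ (i * j) *: F (hc i b) (hc j c)).
  apply: eq_bigr => i _.
  apply: (@sum_widen _ (fun j => (-1) ^+ (i * j) *: F (hc i b) (hc j c))) => // j le.
  by rewrite (hc_big le) (bilin0r bF) scaler0.
apply: (@sum_widen _ (fun i => \sum_(j < N) (-1) ^+ (i * j) *: F (hc i b) (hc j c))) => // i le.
by rewrite big1 // => j _; rewrite (hc_big le) (bilin0l bF) scaler0.
Qed.

Lemma bilin_kos (Om Om' : dga K) (U : lmodType K) (F : Om -> Om' -> U) :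
  bilin F -> bilin (kos F).
Proof.
move=> bF; split=> [c|b] k x y /=.
  pose N := maxn (hbound (k *: x + y)) (maxn (hbound x) (hbound y)).
  rewrite !(@kosE _ _ _ F _ c N (hbound c)) /N ?leq_max ?leqnn ?orbT //.
  rewrite scaler_sumr -big_split /=; apply: eq_bigr => i _.
  rewrite scaler_sumr -big_split /=; apply: eq_bigr => j _.
  exact: ((bilin_kos_hc i j bF).1 _ k x y).
pose N := maxn (hbound (k *: x + y)) (maxn (hbound x) (hbound y)).
rewrite !(@kosE _ _ _ F b _ (hbound b) N) /N ?leq_max ?leqnn ?orbT //.
rewrite scaler_sumr -big_split /=; apply: eq_bigr => i _.
rewrite scaler_sumr -big_split /=; apply: eq_bigr => j _.
exact: ((bilin_kos_hc i j bF).2 _ k x y).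
Qed.

Lemma kos_hom (Om Om' : dga K) (U : lmodType K) (F : Om -> Om' -> U) m n b c :
  bilin F -> hc m b = b -> hc n c = c -> kos F b c = (-1) ^+ (m * n) *: F b c.
Proof.
move=> bF hb hc'.
rewrite (@kosE _ _ _ F b c (maxn (hbound b) m.+1) (maxn (hbound c) n.+1))
  ?leq_maxl //.
have mN : (m < maxn (hbound b) m.+1)%N by rewrite leq_max leqnn orbT.
have nN : (n < maxn (hbound c) n.+1)%N by rewrite leq_max leqnn orbT.
rewrite (bigD1 (Ordinal mN)) //= (bigD1 (Ordinal nN)) //= hb hc'.
rewrite !big1 ?addr0 // => i ne.
  by apply: big1 => j _; rewrite (hcK _ hb) ifN ?(bilin0l bF) ?scaler0.
by rewrite (hcK _ hc') ifN ?(bilin0r bF) ?scaler0.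
Qed.

Lemma tens_indh (Om Om' : dga K) (P : tens Om Om' -> Prop) : P 0 ->
  (forall t u, P t -> P u -> P (t + u)) ->
  (forall m n v w, hc m v = v -> hc n w = w -> P (v ⊗ w)) -> forall t, P t.
Proof.
move=> P0 PD Ph; apply: tens_ind => // v w.
have bt := @bilin_tpure K Om Om'.
have sl (I : nat) (f : 'I_I -> Om) (x : Om') :
    (\sum_i f i) ⊗ x = \sum_i f i ⊗ x.
  by apply: (big_morph (fun y => y ⊗ x)) => [a b|]; rewrite ?(bilinDl bt) ?(bilin0l bt).
have sr (I : nat) (f : 'I_I -> Om') (x : Om) :
    x ⊗ (\sum_i f i) = \sum_i x ⊗ f i.
  by apply: (big_morph (fun y => x ⊗ y)) => [a b|]; rewrite ?(bilinDr bt) ?(bilin0r bt).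
rewrite (hboundP v) (hboundP w) sl; apply: big_ind => // i _.
rewrite sr; apply: big_ind => // j _.
by apply: (Ph i j); rewrite hc_hc eqxx.
Qed.

Lemma bilin_tsum (V W V' W' U : lmodType K) (G : V -> W -> V' -> W' -> U) t :
  (forall c e, bilin (fun a b => G a b c e)) ->
  bilin (fun a b => tsum (G a b) t).
Proof.
move=> bG; split=> [b|a] k x y; rewrite /tsum scaler_sumr -big_split /=;
  apply: eq_bigr => z _.
  exact: ((bG z.1 z.2).1 b k x y).
exact: ((bG z.1 z.2).2 a k x y).
Qed.

Lemma tsumD (V W U : lmodType K) (F : V -> W -> U) t u : bilin F ->
  tsum F (t + u) = tsum F t + tsum F u.
Proof. by move=> bF; have := tsum_lin bF 1 t u; rewrite !scale1r. Qed.
Lemma tsumZ (V W U : lmodType K) (F : V -> W -> U) c t : bilin F ->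
  tsum F (c *: t) = c *: tsum F t.
Proof. by move=> bF; rewrite (scalable_linear (tsum_lin bF)). Qed.
Lemma tsum0 (V W U : lmodType K) (F : V -> W -> U) : bilin F -> tsum F 0 = 0.
Proof. by move=> bF; rewrite -(scale0r 0) tsumZ // scale0r. Qed.
End KoszulTheory.

(* An algebra as a DGA concentrated in degree 0. *)
Section Trivial.
Variables (K : fieldType) (A : algType K).

Let thc (n : nat) (a : A) : A := if n == 0 then a else 0.
Let tdd (a : A) : A := 0.

Fact triv_hc_lin n : linear (thc n).
Proof. by move=> c x y; rewrite /thc; case: ifP => // _; rewrite scaler0 addr0. Qed.
Fact triv_hc_hc m n w : thc m (thc n w) = if m == n then thc n w else 0.
Proof. by case: m n => [|m] [|n] //=; rewrite /thc /= if_same. Qed.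
Fact triv_hc_sum w : exists N : nat, w = \sum_(i < N) thc i w.
Proof. by exists 1; rewrite big_ord1. Qed.
Fact triv_hc_one : thc 0 1 = 1. Proof. by []. Qed.
Fact triv_hc_mul m n a b : thc m a = a -> thc n b = b ->
  thc (m + n) (a * b) = a * b.
Proof.
by case: m n => [|m] [|n] //; rewrite /thc /=; [move=> _|..] => <-;
  rewrite ?mulr0 ?mul0r.
Qed.
Fact triv_dd_lin : linear tdd.
Proof. by move=> c x y; rewrite /tdd scaler0 addr0. Qed.
Fact triv_hc_dd n a : thc n a = a -> thc n.+1 (tdd a) = tdd a.
Proof. by []. Qed.
Fact triv_dd_dd a : tdd (tdd a) = 0. Proof. by []. Qed.
Fact triv_dd_mul n a b : thc n a = a ->
  tdd (a * b) = tdd a * b + (-1) ^+ n *: (a * tdd b).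
Proof. by rewrite /tdd mul0r mulr0 scaler0 addr0. Qed.

Definition triv : dga K := Dga triv_hc_lin triv_hc_hc triv_hc_sum triv_hc_one
  triv_hc_mul triv_dd_lin triv_hc_dd triv_dd_dd triv_dd_mul.
End Trivial.

Section SuperTensor.
Variables (K : fieldType) (Om Om' : dga K).

Definition stens_sort : Type := tens Om Om'.
HB.instance Definition _ := GRing.Lmodule.on stens_sort.

Let pt (a : Om) (b : Om') : stens_sort := a ⊗ b.

Definition stens_mul (x y : stens_sort) : stens_sort :=
  \tsum_(a, b <- x) \tsum_(c, e <- y)
    kos (fun b c => (a * c) ⊗ (b * e)) b c.

Definition stens_one : stens_sort := 1 ⊗ 1.

Definition stens_hc (n : nat) (x : stens_sort) : stens_sort :=
  \tsum_(a, b <- x) \sum_(i < n.+1) hc i a ⊗ hc (n - i) b.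

Definition stens_dd (x : stens_sort) : stens_sort :=
  \tsum_(a, b <- x) (dd a ⊗ b + par a ⊗ dd b).

Let bt := @bilin_tpure K Om Om'.

Fact stens_indh (P : stens_sort -> Prop) : P 0 ->
  (forall t u, P t -> P u -> P (t + u)) ->
  (forall m n v w, hc m v = v -> hc n w = w -> P (pt v w)) -> forall t, P t.
Proof. exact: tens_indh. Qed.

Fact bl_bc a e : bilin (fun (b : Om') (c : Om) => (a * c) ⊗ (b * e) : stens_sort).
Proof.
split=> [c|b] k x y.
  by rewrite mulrDl (bilinDr bt) -scalerAl (bilinZr bt).
by rewrite mulrDr (bilinDl bt) -scalerAr (bilinZl bt).
Qed.

Fact bl_ae b c : bilin (fun (a : Om) (e : Om') => (a * c) ⊗ (b * e) : stens_sort).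
Proof.
split=> [e|a] k x y.
  by rewrite mulrDl (bilinDl bt) -scalerAl (bilinZl bt).
by rewrite mulrDr (bilinDr bt) -scalerAr (bilinZr bt).
Qed.

Fact kos_addl (U : lmodType K) (F G H : Om' -> Om -> U) k b c :
  (forall b c, F b c = k *: G b c + H b c) ->
  kos F b c = k *: kos G b c + kos H b c.
Proof.
move=> e; rewrite /kos scaler_sumr -big_split; apply: eq_bigr => i _ /=.
rewrite scaler_sumr -big_split; apply: eq_bigr => j _ /=.
by rewrite e scalerDr !scalerA mulrC.
Qed.

Fact bl_ce a b : bilin (fun c e =>
  kos (fun b c => (a * c) ⊗ (b * e) : stens_sort) b c).
Proof.
split=> [e|c] k x y; first exact: (bilin_kos (bl_bc a e)).2.
by apply: kos_addl => b' c'; apply: (bl_ae b' c').2.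
Qed.

Fact bl_ab c e : bilin (fun a b =>
  kos (fun b c => (a * c) ⊗ (b * e) : stens_sort) b c).
Proof.
split=> [b|a] k x y; last exact: (bilin_kos (bl_bc a e)).1.
by apply: kos_addl => b' c'; apply: (bl_ae b' c').1.
Qed.

Fact bl_mul y : bilin (fun a b => \tsum_(c, e <- y)
    kos (fun b c => (a * c) ⊗ (b * e) : stens_sort) b c).
Proof. by apply: bilin_tsum => c e; apply: bl_ab. Qed.

Fact smulDl x y z : stens_mul (x + y) z = stens_mul x z + stens_mul y z.
Proof. exact: (tsumD _ _ (bl_mul z)). Qed.
Fact smulZl c x z : stens_mul (c *: x) z = c *: stens_mul x z.
Proof. exact: (tsumZ _ _ (bl_mul z)). Qed.
Fact smulDr z x y : stens_mul z (x + y) = stens_mul z x + stens_mul z y.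
Proof.
rewrite /stens_mul {1 2 4}/tsum -big_split; apply: eq_bigr => v _.
exact: (tsumD _ _ (bl_ce v.1 v.2)).
Qed.
Fact smulZr c z x : stens_mul z (c *: x) = c *: stens_mul z x.
Proof.
rewrite /stens_mul {1 3}/tsum scaler_sumr; apply: eq_bigr => v _.
exact: (tsumZ _ _ (bl_ce v.1 v.2)).
Qed.
Fact smul0l x : stens_mul 0 x = 0.
Proof. by have := smulZl 0 0 x; rewrite !scale0r. Qed.
Fact smul0r x : stens_mul x 0 = 0.
Proof. by have := smulZr 0 x 0; rewrite !scale0r. Qed.

Fact smul_hom m n a b c e : hc m b = b -> hc n c = c ->
  stens_mul (pt a b) (pt c e) = (-1) ^+ (m * n) *: pt (a * c) (b * e).
Proof.
move=> hb hc'; rewrite /stens_mul (tsum_pure _ _ (bl_mul _)).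
rewrite (tsum_pure _ _ (bl_ce _ _)); apply: (kos_hom (bl_bc a e)) => //.
Qed.

Fact smulA : associative stens_mul.
Proof.
move=> x y z; elim/stens_indh: x => [|x x' hx hx'|i1 i2 a b ha hb].
- by rewrite !smul0l.
- by rewrite !smulDl hx hx'.
elim/stens_indh: y => [|y y' hy hy'|j1 j2 c e hc1 he].
- by rewrite smul0l smul0r smul0l.
- by rewrite smulDr !smulDl smulDr hy hy'.
elim/stens_indh: z => [|z z' hz hz'|k1 k2 f h hf hh].
- by rewrite !smul0r.
- by rewrite !smulDr hz hz'.
rewrite -!/(pt _ _) (smul_hom _ _ he hf) (smul_hom _ _ hb hc1) smulZl smulZr.
rewrite (smul_hom _ _ hb (hc_mul hc1 hf)) (smul_hom _ _ (hc_mul hb he) hf).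
rewrite !mulrA !scalerA -!exprD; congr (_ ^+ _ *: _).
by rewrite mulnDl mulnDr addnC addnA.
Qed.

Fact smul1 : left_id stens_one stens_mul.
Proof.
elim/stens_indh => [|x x' hx hx'|i1 i2 a b ha hb]; first by rewrite smul0r.
  by rewrite smulDr hx hx'.
rewrite -/(pt a b) (smul_hom _ _ (hc_one Om') ha).
by rewrite mul0n scale1r !mul1r.
Qed.
Fact smul1r : right_id stens_one stens_mul.
Proof.
elim/stens_indh => [|x x' hx hx'|i1 i2 a b ha hb]; first by rewrite smul0l.
  by rewrite smulDl hx hx'.
rewrite -/(pt a b) (smul_hom _ _ hb (hc_one Om)).
by rewrite muln0 scale1r !mulr1.
Qed.
Fact sone_neq0 : stens_one != 0.
Proof.
have [g [lg g1]] := exists_linear_form (oner_neq0 Om').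
exact: (tpure_neq0 (oner_neq0 Om) lg g1).
Qed.

HB.instance Definition _ := GRing.Zmodule_isNzRing.Build stens_sort
  smulA smul1 smul1r (fun x y z => smulDl x y z) (fun z x y => smulDr z x y) sone_neq0.
HB.instance Definition _ := GRing.Lmodule_isLalgebra.Build K stens_sort
  (fun c x y => esym (smulZl c x y)).
HB.instance Definition _ := GRing.Lalgebra_isAlgebra.Build K stens_sort
  (fun c x y => esym (smulZr c x y)).

Fact bl_hc n : bilin (fun (a : Om) (b : Om') =>
  \sum_(i < n.+1) hc i a ⊗ hc (n - i) b).
Proof.
split=> [b|a] k x y; rewrite scaler_sumr -big_split; apply: eq_bigr => i _ /=.
  by rewrite linearP (bilinDl bt) (bilinZl bt).
by rewrite linearP (bilinDr bt) (bilinZr bt).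
Qed.

Fact bl_dd : bilin (fun (a : Om) (b : Om') => dd a ⊗ b + par a ⊗ dd b).
Proof.
split=> [b|a] k x y.
  by rewrite linearP par_lin !(bilinDl bt) !(bilinZl bt) scalerDr addrACA.
by rewrite linearP !(bilinDr bt) !(bilinZr bt) scalerDr addrACA.
Qed.

Fact stens_hc_lin n : linear (stens_hc n).
Proof. exact: tsum_lin (bl_hc n). Qed.
Fact stens_dd_lin : linear stens_dd.
Proof. exact: tsum_lin bl_dd. Qed.

HB.instance Definition _ n := GRing.isLinear.Build K stens_sort stens_sort
  *:%R (stens_hc n) (stens_hc_lin n).
HB.instance Definition _ := GRing.isLinear.Build K stens_sort stens_sort
  *:%R stens_dd stens_dd_lin.

Fact stens_hc_hom m n k a b : hc m a = a -> hc n b = b ->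
  stens_hc k (pt a b) = if k == (m + n)%N then pt a b else 0.
Proof.
move=> ha hb; rewrite /stens_hc (tsum_pure _ _ (bl_hc k)).
transitivity (\sum_(i < k.+1)
    if (i == m :> nat) && (k == (m + n)%N) then pt a b else 0).
  apply: eq_bigr => i _; rewrite (hcK _ ha) (hcK _ hb).
  case: eqP => [im|ne] /=; last by rewrite (bilin0l bt).
  have ik : (i <= k)%N by rewrite -ltnS.
  rewrite -im -[in LHS](eqn_add2l i) subnKC //.
  by case: ifP => // _; rewrite (bilin0r bt).
case: (k =P (m + n)%N) => [km|_]; last first.
  by rewrite big1 // => i _; rewrite andbF.
have mk : (m < k.+1)%N by rewrite ltnS km leq_addr.
rewrite (bigD1 (Ordinal mk)) //= eqxx big1 ?addr0 // => i ne.
by rewrite andbT ifN.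
Qed.

Fact stens_dd_hom m a b : hc m a = a ->
  stens_dd (pt a b) = pt (dd a) b + (-1) ^+ m *: pt a (dd b).
Proof.
move=> ha; rewrite /stens_dd (tsum_pure _ _ bl_dd) (par_hom ha).
by rewrite (bilinZl bt).
Qed.

Fact stens_hc_hc m n w :
  stens_hc m (stens_hc n w) = if m == n then stens_hc n w else 0.
Proof.
elim/stens_indh: w => [|x x' hx hx'|i j a b ha hb].
- by rewrite !linear0 if_same.
- by rewrite !linearD /= hx hx'; case: ifP; rewrite ?addr0.
rewrite -/(pt a b) (stens_hc_hom _ ha hb); case: (n =P _) => [->|_].
  by rewrite (stens_hc_hom _ ha hb).
by rewrite linear0 if_same.
Qed.

Fact stens_hc_sum w : exists N : nat, w = \sum_(i < N) stens_hc i w.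
Proof.
suff [N hN] : exists N : nat, forall M, (N <= M)%N ->
    w = \sum_(i < M) stens_hc i w by exists N; apply: hN.
elim/stens_indh: w => [|x x' [N hx] [N' hx']|i j a b ha hb].
- by exists 0 => M _; rewrite big1 // => i _; rewrite linear0.
- exists (maxn N N') => M; rewrite geq_max => /andP[/hx e /hx' e'].
  rewrite {1}e {1}e' -big_split; apply: eq_bigr => i _.
  by rewrite linearD.
exists (i + j).+1 => M lt.
rewrite (bigD1 (Ordinal lt)) //= -/(pt a b) (stens_hc_hom _ ha hb) eqxx.
rewrite big1 ?addr0 // => k ne; rewrite (stens_hc_hom _ ha hb) ifN //.
Qed.

Fact stens_hc_one : stens_hc 0 1 = 1.
Proof. by rewrite (stens_hc_hom 0 (hc_one Om) (hc_one Om')). Qed.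

Fact stens_hc_mul' m n x y :
  stens_hc (m + n) (stens_hc m x * stens_hc n y) = stens_hc m x * stens_hc n y.
Proof.
elim/stens_indh: x => [|x x' hx hx'|i j a b ha hb].
- by rewrite !(linear0, mul0r).
- by rewrite linearD mulrDl linearD /= hx hx'.
elim/stens_indh: y => [|x x' hx hx'|k l c e hc1 he].
- by rewrite !(linear0, mulr0).
- by rewrite linearD mulrDr linearD /= hx hx'.
rewrite -!/(pt _ _) (stens_hc_hom _ ha hb) (stens_hc_hom _ hc1 he).
case: eqP => [->|_]; last by rewrite !(linear0, mul0r).
case: eqP => [->|_]; last by rewrite !(linear0, mulr0).
rewrite [_ * _](smul_hom _ _ hb hc1) linearZ /=.
by rewrite (stens_hc_hom _ (hc_mul ha hc1) (hc_mul hb he)) addnACA eqxx.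
Qed.

Fact stens_hc_mul m n x y : stens_hc m x = x -> stens_hc n y = y ->
  stens_hc (m + n) (x * y) = x * y.
Proof. by move=> hx hy; have := stens_hc_mul' m n x y; rewrite hx hy. Qed.

Fact stens_hc_dd' n x : stens_hc n.+1 (stens_dd (stens_hc n x)) =
  stens_dd (stens_hc n x).
Proof.
elim/stens_indh: x => [|x x' hx hx'|i j a b ha hb].
- by rewrite !linear0.
- by rewrite !linearD /= hx hx'.
rewrite -!/(pt _ _) (stens_hc_hom _ ha hb).
case: eqP => [->|_]; last by rewrite !linear0.
rewrite (stens_dd_hom _ ha) linearD linearZ /=.
rewrite (stens_hc_hom _ (hc_dd ha) hb) (stens_hc_hom _ ha (hc_dd hb)).
by rewrite addSn addnS eqxx.
Qed.

Fact stens_hc_dd n x : stens_hc n x = x -> stens_hc n.+1 (stens_dd x) = stens_dd x.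
Proof. by move=> hx; have := stens_hc_dd' n x; rewrite hx. Qed.

Fact stens_dd_dd x : stens_dd (stens_dd x) = 0.
Proof.
elim/stens_indh: x => [|x x' hx hx'|i j a b ha hb].
- by rewrite !linear0.
- by rewrite !linearD /= hx hx' addr0.
rewrite -!/(pt _ _) (stens_dd_hom _ ha) linearD linearZ /=.
rewrite (stens_dd_hom _ (hc_dd ha)) (stens_dd_hom _ ha) !dd_dd.
rewrite /pt (bilin0l bt) (bilin0r bt) scaler0 add0r addr0 exprS mulN1r.
by rewrite scaleNr addNr.
Qed.

Fact sgn_eq m n : odd m = odd n -> (-1) ^+ m = (-1) ^+ n :> K.
Proof. by move=> e; rewrite -signr_odd e signr_odd. Qed.

Fact stens_dd_mul' n x y : stens_dd (stens_hc n x * y) =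
  stens_dd (stens_hc n x) * y + (-1) ^+ n *: (stens_hc n x * stens_dd y).
Proof.
elim/stens_indh: x => [|x x' hx hx'|i j a b ha hb].
- by rewrite !(linear0, mul0r, scaler0, addr0).
- by rewrite !(linearD, mulrDl) /= hx hx' addrACA.
elim/stens_indh: y => [|y y' hy hy'|k l c e hc1 he].
- by rewrite !(linear0, mulr0, scaler0, addr0).
- by rewrite !(linearD, mulrDr) /= hy hy' addrACA.
rewrite -!/(pt _ _) (stens_hc_hom _ ha hb).
case: eqP => [->|_]; last by rewrite !(linear0, mul0r, scaler0, addr0).
have sm m' n' a' b' c' e' (h1 : hc m' b' = b') (h2 : hc n' c' = c') :
  (pt a' b' : stens_sort) * pt c' e' = _ := smul_hom a' e' h1 h2.
rewrite (sm _ _ _ _ _ _ hb hc1) linearZ /= (stens_dd_hom _ (hc_mul ha hc1)).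
rewrite (stens_dd_hom _ ha) (stens_dd_hom _ hc1) mulrDl mulrDr.
rewrite -!scalerAl -!scalerAr.
rewrite (sm _ _ _ _ _ _ hb hc1) (sm _ _ _ _ _ _ (hc_dd hb) hc1).
rewrite (sm _ _ _ _ _ _ hb (hc_dd hc1)) (sm _ _ _ _ _ _ hb hc1).
rewrite (dd_mul _ ha) (dd_mul _ hb) /pt.
rewrite (bilinDl bt) (bilinDr bt) (bilinZl bt) (bilinZr bt).
rewrite !scalerDr !scalerA -!exprD -!addrA; congr (_ + _).
rewrite addrCA; congr (_ + (_ + _)).
- congr (_ *: _); apply: sgn_eq; rewrite !(oddD, oddM) /= ?oddM /=.
  by case: (odd i); case: (odd j); case: (odd k).
- congr (_ *: _); apply: sgn_eq; rewrite !(oddD, oddM) /= ?oddM /=.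
  by case: (odd i); case: (odd j); case: (odd k).
congr (_ *: _); apply: sgn_eq; rewrite !(oddD, oddM) /= ?oddM /=.
by case: (odd i); case: (odd j); case: (odd k).
Qed.

Fact stens_dd_mul n x y : stens_hc n x = x ->
  stens_dd (x * y) = stens_dd x * y + (-1) ^+ n *: (x * stens_dd y).
Proof. by move=> hx; have := stens_dd_mul' n x y; rewrite hx. Qed.

Definition stens : dga K := Dga stens_hc_lin stens_hc_hc stens_hc_sum
  stens_hc_one stens_hc_mul stens_dd_lin stens_hc_dd stens_dd_dd stens_dd_mul.
End SuperTensor.

(* The algebra presented by generators X and relations: terms are identified
   when they take the same value in every algebra at every family of elements
   satisfying the relations. *)
Inductive aterm (K X : Type) : Type :=
  | AVar of X | AScal of K
  | AAdd of aterm K X & aterm K X | AMul of aterm K X & aterm K X.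

HB.instance Definition _ K X := gen_eqMixin (aterm K X).
HB.instance Definition _ K X := gen_choiceMixin (aterm K X).

Fixpoint aeval (K : fieldType) (X : Type) (B : algType K) (x : X -> B)
    (t : aterm K X) : B :=
  match t with
  | AVar i => x i
  | AScal c => c%:A
  | AAdd t u => aeval x t + aeval x u
  | AMul t u => aeval x t * aeval x u
  end.

Definition arels (K : fieldType) (X : Type) : Type :=
  forall B : algType K, (X -> B) -> Prop.

Section PresentedAlgebra.
Variables (K : fieldType) (X : Type) (rels : arels K X).
(* a nonzero algebra satisfying the relations, so that 1 != 0 below *)
Hypothesis model : exists (B : algType K) (x : X -> B), rels x.

Definition arel (t u : aterm K X) : bool :=
  `[< forall (B : algType K) (x : X -> B), rels x -> aeval x t = aeval x u >].

Fact arel_refl : reflexive arel.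
Proof. by move=> s; apply/asboolP. Qed.
Fact arel_sym : symmetric arel.
Proof.
by move=> s t; apply/idP/idP => /asboolP h; apply/asboolP => B x hx;
  rewrite (h B x hx).
Qed.
Fact arel_trans : transitive arel.
Proof.
move=> t s u /asboolP h1 /asboolP h2; apply/asboolP => B x hx.
by rewrite (h1 B x hx) (h2 B x hx).
Qed.
Canonical arel_equiv := EquivRel arel arel_refl arel_sym arel_trans.

Let Q := {eq_quot arel_equiv}.
Definition palg_sort of (exists (B : algType K) (x : X -> B), rels x) : Type := Q.
Local Notation palgT := (palg_sort model).
HB.instance Definition _ := Choice.copy palgT Q.

Definition pmk (t : aterm K X) : palgT := \pi_Q t.
Definition prep (a : palgT) : aterm K X := repr (a : Q).

(* the value of an element at a family satisfying the relations *)
Definition plift (B : algType K) (x : X -> B) (a : palgT) : B := aeval x (prep a).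

Lemma plift_mk (B : algType K) (x : X -> B) t : rels x ->
  plift x (pmk t) = aeval x t.
Proof.
move=> hx; have /eqmodP/asboolP : repr (\pi_Q t) = t %[mod Q] by rewrite reprK.
by apply.
Qed.

Lemma palg_ext (a b : palgT) :
  (forall (B : algType K) (x : X -> B), rels x -> plift x a = plift x b) -> a = b.
Proof.
move=> h; rewrite -[a](@reprK _ Q) -[b](@reprK _ Q).
by apply/eqmodP/asboolP => B x hx; apply: h.
Qed.

Let padd (a b : palgT) := pmk (AAdd (prep a) (prep b)).
Let pmul (a b : palgT) := pmk (AMul (prep a) (prep b)).
Let pscale (c : K) (a : palgT) := pmk (AMul (AScal X c) (prep a)).
Let p0 : palgT := pmk (AScal X 0).
Let p1 : palgT := pmk (AScal X 1).
Let popp (a : palgT) := pscale (-1) a.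

Let liftD (B : algType K) (x : X -> B) a b : rels x ->
  plift x (padd a b) = plift x a + plift x b.
Proof. by move=> hx; rewrite plift_mk. Qed.
Let liftM (B : algType K) (x : X -> B) a b : rels x ->
  plift x (pmul a b) = plift x a * plift x b.
Proof. by move=> hx; rewrite plift_mk. Qed.
Let liftZ (B : algType K) (x : X -> B) c a : rels x ->
  plift x (pscale c a) = c *: plift x a.
Proof. by move=> hx; rewrite plift_mk //= mulr_algl. Qed.
Let lift0 (B : algType K) (x : X -> B) : rels x -> plift x p0 = 0.
Proof. by move=> hx; rewrite plift_mk //= scale0r. Qed.
Let lift1 (B : algType K) (x : X -> B) : rels x -> plift x p1 = 1.
Proof. by move=> hx; rewrite plift_mk //= scale1r. Qed.

Fact palg_addA : associative padd.
Proof. by move=> a b c; apply: palg_ext => B x hx; rewrite !liftD // addrA. Qed.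
Fact palg_addC : commutative padd.
Proof. by move=> a b; apply: palg_ext => B x hx; rewrite !liftD // addrC. Qed.
Fact palg_add0 : left_id p0 padd.
Proof. by move=> a; apply: palg_ext => B x hx; rewrite liftD // lift0 // add0r. Qed.
Fact palg_addN : left_inverse p0 popp padd.
Proof.
move=> a; apply: palg_ext => B x hx.
by rewrite liftD // lift0 // liftZ // scaleN1r addNr.
Qed.
HB.instance Definition _ :=
  GRing.isZmodule.Build palgT palg_addA palg_addC palg_add0 palg_addN.

Fact palg_mulA : associative pmul.
Proof. by move=> a b c; apply: palg_ext => B x hx; rewrite !liftM // mulrA. Qed.
Fact palg_mul1 : left_id p1 pmul.
Proof. by move=> a; apply: palg_ext => B x hx; rewrite liftM // lift1 // mul1r. Qed.
Fact palg_mul1r : right_id p1 pmul.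
Proof. by move=> a; apply: palg_ext => B x hx; rewrite liftM // lift1 // mulr1. Qed.
Fact palg_mulDl : left_distributive pmul +%R.
Proof.
move=> a b c; apply: palg_ext => B x hx.
by rewrite liftM // !liftD // !liftM // mulrDl.
Qed.
Fact palg_mulDr : right_distributive pmul +%R.
Proof.
move=> a b c; apply: palg_ext => B x hx.
by rewrite liftM // !liftD // !liftM // mulrDr.
Qed.
Fact palg_1neq0 : p1 != 0.
Proof.
apply/eqP => e; have [B [x hx]] := model.
by have := lift1 hx; rewrite e lift0 // => /eqP; rewrite eq_sym oner_eq0.
Qed.
HB.instance Definition _ := GRing.Zmodule_isNzRing.Build palgT
  palg_mulA palg_mul1 palg_mul1r palg_mulDl palg_mulDr palg_1neq0.

Fact palg_scaleA a b (t : palgT) : pscale a (pscale b t) = pscale (a * b) t.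
Proof. by apply: palg_ext => B x hx; rewrite !liftZ // scalerA. Qed.
Fact palg_scale1 : left_id 1 pscale.
Proof. by move=> t; apply: palg_ext => B x hx; rewrite liftZ // scale1r. Qed.
Fact palg_scaleDr : right_distributive pscale +%R.
Proof.
move=> c t u; apply: palg_ext => B x hx.
by rewrite liftZ // !liftD // !liftZ // scalerDr.
Qed.
Fact palg_scaleDl (t : palgT) : {morph pscale^~ t : a b / a + b}.
Proof.
by move=> a b; apply: palg_ext => B x hx; rewrite liftZ // liftD // !liftZ // scalerDl.
Qed.
HB.instance Definition _ := GRing.Zmodule_isLmodule.Build K palgT
  palg_scaleA palg_scale1 palg_scaleDr palg_scaleDl.
Fact palg_scaleAl c (a b : palgT) : c *: (a * b) = c *: a * b.
Proof.
apply: palg_ext => B x hx.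
by rewrite liftZ // liftM // [RHS]liftM // liftZ // scalerAl.
Qed.
HB.instance Definition _ := GRing.Lmodule_isLalgebra.Build K palgT palg_scaleAl.
Fact palg_scaleAr c (a b : palgT) : c *: (a * b) = a * (c *: b).
Proof.
apply: palg_ext => B x hx.
by rewrite liftZ // liftM // [RHS]liftM // liftZ // scalerAr.
Qed.
HB.instance Definition _ := GRing.Lalgebra_isAlgebra.Build K palgT palg_scaleAr.

Definition palg : algType K := palgT.

Definition pgen (i : X) : palg := pmk (AVar K i).

Lemma plift_gen (B : algType K) (x : X -> B) i : rels x -> plift x (pgen i) = x i.
Proof. by move=> hx; rewrite plift_mk. Qed.

Lemma plift_lin (B : algType K) (x : X -> B) : rels x -> linear (plift x).
Proof. by move=> hx c a b; rewrite liftD // liftZ. Qed.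
Lemma plift_mul (B : algType K) (x : X -> B) (a b : palg) : rels x ->
  plift x (a * b) = plift x a * plift x b.
Proof. exact: liftM. Qed.
Lemma plift_one (B : algType K) (x : X -> B) : rels x -> plift x (1 : palg) = 1.
Proof. exact: lift1. Qed.

Lemma pliftD (B : algType K) (x : X -> B) (a b : palg) : rels x ->
  plift x (a + b) = plift x a + plift x b.
Proof. exact: liftD. Qed.
Lemma pliftZ (B : algType K) (x : X -> B) c (a : palg) : rels x ->
  plift x (c *: a) = c *: plift x a.
Proof. exact: liftZ. Qed.
Lemma pliftB (B : algType K) (x : X -> B) (a b : palg) : rels x ->
  plift x (a - b) = plift x a - plift x b.
Proof. by move=> hx; rewrite pliftD // -scaleN1r pliftZ // scaleN1r. Qed.

Lemma palg_ind (P : palg -> Prop) : (forall i, P (pgen i)) ->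
  (forall c, P c%:A) -> (forall a b, P a -> P b -> P (a + b)) ->
  (forall a b, P a -> P b -> P (a * b)) -> forall a, P a.
Proof.
move=> Pg Ps PD PM a; have -> : a = pmk (prep a) by rewrite /pmk reprK.
elim: (prep a) => [i|c|t ht u hu|t ht u hu]; first exact: Pg.
- suff -> : pmk (AScal X c) = c%:A by apply: Ps.
  apply: palg_ext => B x hx; rewrite plift_mk //=.
  by rewrite -[c%:A in RHS]addr0 [RHS]plift_lin // plift_one // [plift x 0]lift0 // addr0.
- suff -> : pmk (AAdd t u) = pmk t + pmk u by apply: PD.
  by apply: palg_ext => B x hx; rewrite [RHS]liftD // !plift_mk.
- suff -> : pmk (AMul t u) = pmk t * pmk u by apply: PM.
  by apply: palg_ext => B x hx; rewrite [RHS]liftM // !plift_mk.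
Qed.
End PresentedAlgebra.

(* The same construction for DGAs generated in degree 0, with relations that
   may involve the differential; [DHc n] is the degree n component. *)
Inductive dterm (K X : Type) : Type :=
  | DVar of X | DScal of K
  | DAdd of dterm K X & dterm K X | DMul of dterm K X & dterm K X
  | DHc of nat & dterm K X | DDiff of dterm K X.

HB.instance Definition _ K X := gen_eqMixin (dterm K X).
HB.instance Definition _ K X := gen_choiceMixin (dterm K X).

Fixpoint deval (K : fieldType) (X : Type) (Om : dga K) (x : X -> Om)
    (t : dterm K X) : Om :=
  match t with
  | DVar i => x i
  | DScal c => c%:A
  | DAdd t u => deval x t + deval x u
  | DMul t u => deval x t * deval x u
  | DHc n t => hc n (deval x t)
  | DDiff t => dd (deval x t)
  end.

Definition drels (K : fieldType) (X : Type) : Type :=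
  forall Om : dga K, (X -> Om) -> Prop.

Section PresentedDga.
Variables (K : fieldType) (X : Type) (rels : drels K X).

Definition dsat (Om : dga K) (x : X -> Om) : Prop :=
  (forall i, hc 0 (x i) = x i) /\ rels x.

Hypothesis model : exists (Om : dga K) (x : X -> Om), dsat x.

Definition drel (t u : dterm K X) : bool :=
  `[< forall (Om : dga K) (x : X -> Om), dsat x -> deval x t = deval x u >].

Fact drel_refl : reflexive drel.
Proof. by move=> s; apply/asboolP. Qed.
Fact drel_sym : symmetric drel.
Proof.
by move=> s t; apply/idP/idP => /asboolP h; apply/asboolP => B x hx;
  rewrite (h B x hx).
Qed.
Fact drel_trans : transitive drel.
Proof.
move=> t s u /asboolP h1 /asboolP h2; apply/asboolP => B x hx.
by rewrite (h1 B x hx) (h2 B x hx).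
Qed.
Canonical drel_equiv := EquivRel drel drel_refl drel_sym drel_trans.

Let Q := {eq_quot drel_equiv}.
Definition pdga_sort of (exists (Om : dga K) (x : X -> Om), dsat x) : Type := Q.
Local Notation pdgaT := (pdga_sort model).
HB.instance Definition _ := Choice.copy pdgaT Q.

Definition dmk (t : dterm K X) : pdgaT := \pi_Q t.
Definition drep (a : pdgaT) : dterm K X := repr (a : Q).

Definition dlift (Om : dga K) (x : X -> Om) (a : pdgaT) : Om := deval x (drep a).

Lemma dlift_mk (Om : dga K) (x : X -> Om) t : dsat x ->
  dlift x (dmk t) = deval x t.
Proof.
move=> hx; have /eqmodP/asboolP : repr (\pi_Q t) = t %[mod Q] by rewrite reprK.
by apply.
Qed.

Lemma pdga_ext (a b : pdgaT) :
  (forall (Om : dga K) (x : X -> Om), dsat x -> dlift x a = dlift x b) -> a = b.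
Proof.
move=> h; rewrite -[a](@reprK _ Q) -[b](@reprK _ Q).
by apply/eqmodP/asboolP => B x hx; apply: h.
Qed.

Let padd (a b : pdgaT) := dmk (DAdd (drep a) (drep b)).
Let pmul (a b : pdgaT) := dmk (DMul (drep a) (drep b)).
Let pscale (c : K) (a : pdgaT) := dmk (DMul (DScal X c) (drep a)).
Let p0 : pdgaT := dmk (DScal X 0).
Let p1 : pdgaT := dmk (DScal X 1).
Let popp (a : pdgaT) := pscale (-1) a.
Let phc n (a : pdgaT) := dmk (DHc n (drep a)).
Let pdd (a : pdgaT) := dmk (DDiff (drep a)).

Let liftD (Om : dga K) (x : X -> Om) a b : dsat x ->
  dlift x (padd a b) = dlift x a + dlift x b.
Proof. by move=> hx; rewrite dlift_mk. Qed.
Let liftM (Om : dga K) (x : X -> Om) a b : dsat x ->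
  dlift x (pmul a b) = dlift x a * dlift x b.
Proof. by move=> hx; rewrite dlift_mk. Qed.
Let liftZ (Om : dga K) (x : X -> Om) c a : dsat x ->
  dlift x (pscale c a) = c *: dlift x a.
Proof. by move=> hx; rewrite dlift_mk //= mulr_algl. Qed.
Let lift0 (Om : dga K) (x : X -> Om) : dsat x -> dlift x p0 = 0.
Proof. by move=> hx; rewrite dlift_mk //= scale0r. Qed.
Let lift1 (Om : dga K) (x : X -> Om) : dsat x -> dlift x p1 = 1.
Proof. by move=> hx; rewrite dlift_mk //= scale1r. Qed.
Let liftH (Om : dga K) (x : X -> Om) n a : dsat x ->
  dlift x (phc n a) = hc n (dlift x a).
Proof. by move=> hx; rewrite dlift_mk. Qed.
Let liftd (Om : dga K) (x : X -> Om) a : dsat x ->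
  dlift x (pdd a) = dd (dlift x a).
Proof. by move=> hx; rewrite dlift_mk. Qed.

Fact pdga_addA : associative padd.
Proof. by move=> a b c; apply: pdga_ext => B x hx; rewrite !liftD // addrA. Qed.
Fact pdga_addC : commutative padd.
Proof. by move=> a b; apply: pdga_ext => B x hx; rewrite !liftD // addrC. Qed.
Fact pdga_add0 : left_id p0 padd.
Proof. by move=> a; apply: pdga_ext => B x hx; rewrite liftD // lift0 // add0r. Qed.
Fact pdga_addN : left_inverse p0 popp padd.
Proof.
move=> a; apply: pdga_ext => B x hx.
by rewrite liftD // lift0 // liftZ // scaleN1r addNr.
Qed.
HB.instance Definition _ :=
  GRing.isZmodule.Build pdgaT pdga_addA pdga_addC pdga_add0 pdga_addN.

Fact pdga_mulA : associative pmul.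
Proof. by move=> a b c; apply: pdga_ext => B x hx; rewrite !liftM // mulrA. Qed.
Fact pdga_mul1 : left_id p1 pmul.
Proof. by move=> a; apply: pdga_ext => B x hx; rewrite liftM // lift1 // mul1r. Qed.
Fact pdga_mul1r : right_id p1 pmul.
Proof. by move=> a; apply: pdga_ext => B x hx; rewrite liftM // lift1 // mulr1. Qed.
Fact pdga_mulDl : left_distributive pmul +%R.
Proof.
move=> a b c; apply: pdga_ext => B x hx.
by rewrite liftM // !liftD // !liftM // mulrDl.
Qed.
Fact pdga_mulDr : right_distributive pmul +%R.
Proof.
move=> a b c; apply: pdga_ext => B x hx.
by rewrite liftM // !liftD // !liftM // mulrDr.
Qed.
Fact pdga_1neq0 : p1 != 0.
Proof.
apply/eqP => e; have [B [x hx]] := model.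
by have := lift1 hx; rewrite e lift0 // => /eqP; rewrite eq_sym oner_eq0.
Qed.
HB.instance Definition _ := GRing.Zmodule_isNzRing.Build pdgaT
  pdga_mulA pdga_mul1 pdga_mul1r pdga_mulDl pdga_mulDr pdga_1neq0.

Fact pdga_scaleA a b (t : pdgaT) : pscale a (pscale b t) = pscale (a * b) t.
Proof. by apply: pdga_ext => B x hx; rewrite !liftZ // scalerA. Qed.
Fact pdga_scale1 : left_id 1 pscale.
Proof. by move=> t; apply: pdga_ext => B x hx; rewrite liftZ // scale1r. Qed.
Fact pdga_scaleDr : right_distributive pscale +%R.
Proof.
move=> c t u; apply: pdga_ext => B x hx.
by rewrite liftZ // !liftD // !liftZ // scalerDr.
Qed.
Fact pdga_scaleDl (t : pdgaT) : {morph pscale^~ t : a b / a + b}.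
Proof.
by move=> a b; apply: pdga_ext => B x hx; rewrite liftZ // liftD // !liftZ // scalerDl.
Qed.
HB.instance Definition _ := GRing.Zmodule_isLmodule.Build K pdgaT
  pdga_scaleA pdga_scale1 pdga_scaleDr pdga_scaleDl.
Fact pdga_scaleAl c (a b : pdgaT) : c *: (a * b) = c *: a * b.
Proof.
apply: pdga_ext => B x hx.
by rewrite liftZ // liftM // [RHS]liftM // liftZ // scalerAl.
Qed.
HB.instance Definition _ := GRing.Lmodule_isLalgebra.Build K pdgaT pdga_scaleAl.
Fact pdga_scaleAr c (a b : pdgaT) : c *: (a * b) = a * (c *: b).
Proof.
apply: pdga_ext => B x hx.
by rewrite liftZ // liftM // [RHS]liftM // liftZ // scalerAr.
Qed.
HB.instance Definition _ := GRing.Lalgebra_isAlgebra.Build K pdgaT pdga_scaleAr.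

Let lift_lin (Om : dga K) (x : X -> Om) : dsat x -> linear (dlift x).
Proof. by move=> hx c a b; rewrite liftD // liftZ. Qed.

Let lift_sum (Om : dga K) (x : X -> Om) n (f : nat -> pdgaT) : dsat x ->
  dlift x (\sum_(i < n) f i) = \sum_(i < n) dlift x (f i).
Proof.
move=> hx; elim: n => [|n IH]; first by rewrite !big_ord0 [LHS]lift0.
by rewrite !big_ord_recr /= [LHS]liftD // IH.
Qed.

Fact pdga_hc_lin n : linear (phc n).
Proof.
move=> c a b; apply: pdga_ext => B x hx.
by rewrite liftH // !lift_lin // !liftH // linearP.
Qed.
Fact pdga_hc_hc m n w : phc m (phc n w) = if m == n then phc n w else 0.
Proof.
apply: pdga_ext => B x hx; rewrite !liftH // hc_hc.
by case: ifP => _; rewrite ?liftH // [RHS]lift0.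
Qed.
Fact pdga_hc_sum w : exists N : nat, w = \sum_(i < N) phc i w.
Proof.
suff [N hN] : exists N : nat, forall (Om : dga K) (x : X -> Om) n, dsat x ->
    (N <= n)%N -> hc n (dlift x w) = 0.
  exists N; apply: pdga_ext => B x hx; rewrite (lift_sum _ (phc^~ w)) //.
  rewrite {1}(hboundP (dlift x w)).
  transitivity (\sum_(i < maxn (hbound (dlift x w)) N) hc i (dlift x w)).
    apply: (@sum_widen _ (fun i => hc i (dlift x w))); first exact: leq_maxl.
    by move=> i; apply: hc_big.
  symmetry; transitivity (\sum_(i < N) hc i (dlift x w)).
    by apply: eq_bigr => i _; rewrite liftH.
  apply: (@sum_widen _ (fun i => hc i (dlift x w))); first exact: leq_maxr.
  by move=> i; apply: hN.
rewrite /dlift; elim: (drep w) => [i|c|t [N ht] u [M hu]|t [N ht] u [M hu]|n t [N ht]|t [N ht]].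
- exists 1 => Om x n [hx _] n0; rewrite /= -(hx i) hc_hc gtn_eqF //.
- exists 1 => Om x n _ n0.
  by rewrite /= linearZ /= -(hc_one Om) hc_hc gtn_eqF ?scaler0.
- exists (maxn N M) => Om x n hx; rewrite geq_max => /andP[hN hM].
  by rewrite /= linearD /= ht // hu // addr0.
- exists (N + M)%N => Om x n hx le /=.
  rewrite (hboundP (deval x t)) (hboundP (deval x u)) mulr_suml linear_sum big1 // => i _.
  rewrite mulr_sumr linear_sum big1 // => j _.
  have [iN|Ni] := ltnP i N; last by rewrite ht // mul0r linear0.
  have [jM|Mj] := ltnP j M; last by rewrite hu // mulr0 linear0.
  have hi : hc i (hc i (deval x t)) = hc i (deval x t) by rewrite hc_hc eqxx.
  have hj : hc j (hc j (deval x u)) = hc j (deval x u) by rewrite hc_hc eqxx.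
  rewrite /= (hcK _ (hc_mul hi hj)) gtn_eqF //.
  apply: leq_trans le; rewrite -addSn leq_add // ltnW //.
- exists N => Om x m hx le; rewrite /= hc_hc; case: eqP => // <-.
  exact: ht.
- exists N.+1 => Om x n hx le /=.
  rewrite (hboundP (deval x t)) !linear_sum big1 // => i _ /=.
  have [iN|Ni] := ltnP i N; last by rewrite ht // !linear0.
  have hi : hc i (hc i (deval x t)) = hc i (deval x t) by rewrite hc_hc eqxx.
  by rewrite (hcK _ (hc_dd hi)) gtn_eqF // (leq_trans _ le).
Qed.
Fact pdga_hc_one : phc 0 1 = 1.
Proof. by apply: pdga_ext => B x hx; rewrite liftH // [dlift x 1]lift1 // hc_one. Qed.
Fact pdga_hc_mul m n a b : phc m a = a -> phc n b = b ->
  phc (m + n) (a * b) = a * b.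
Proof.
move=> ha hb; apply: pdga_ext => B x hx; rewrite liftH // [dlift x (a * b)]liftM //.
by rewrite hc_mul // -liftH // ?ha ?hb.
Qed.
Fact pdga_dd_lin : linear pdd.
Proof.
move=> c a b; apply: pdga_ext => B x hx.
by rewrite liftd // !lift_lin // !liftd // linearP.
Qed.
Fact pdga_hc_dd n a : phc n a = a -> phc n.+1 (pdd a) = pdd a.
Proof.
move=> ha; apply: pdga_ext => B x hx; rewrite liftH // liftd // hc_dd //.
by rewrite -liftH // ha.
Qed.
Fact pdga_dd_dd a : pdd (pdd a) = 0.
Proof.
by apply: pdga_ext => B x hx; rewrite !liftd // dd_dd [RHS]lift0.
Qed.
Fact pdga_dd_mul n a b : phc n a = a ->
  pdd (a * b) = pdd a * b + (-1) ^+ n *: (a * pdd b).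
Proof.
move=> ha; apply: pdga_ext => B x hx; rewrite liftd // [dlift x (a * b)]liftM //.
rewrite addrC lift_lin // ![dlift x (_ * _)]liftM // !liftd // addrC.
by apply: dd_mul; rewrite -liftH // ha.
Qed.

Definition pdga : dga K := Dga pdga_hc_lin pdga_hc_hc pdga_hc_sum
  pdga_hc_one pdga_hc_mul pdga_dd_lin pdga_hc_dd pdga_dd_dd pdga_dd_mul.

Definition dgen (i : X) : pdga := dmk (DVar K i).
Definition dga_lift (Om : dga K) (x : X -> Om) (a : pdga) : Om := dlift x a.

Lemma dga_lift_gen (Om : dga K) (x : X -> Om) i : dsat x ->
  dga_lift x (dgen i) = x i.
Proof. by move=> hx; rewrite /dga_lift dlift_mk. Qed.
Lemma dga_lift_lin (Om : dga K) (x : X -> Om) : dsat x -> linear (dga_lift x).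
Proof. exact: lift_lin. Qed.
Lemma dga_lift_mul (Om : dga K) (x : X -> Om) (a b : pdga) : dsat x ->
  dga_lift x (a * b) = dga_lift x a * dga_lift x b.
Proof. exact: liftM. Qed.
Lemma dga_lift_one (Om : dga K) (x : X -> Om) : dsat x -> dga_lift x 1 = 1.
Proof. exact: lift1. Qed.
Lemma dga_lift_hc (Om : dga K) (x : X -> Om) n (a : pdga) : dsat x ->
  dga_lift x (hc n a) = hc n (dga_lift x a).
Proof. exact: liftH. Qed.
Lemma dga_lift_dd (Om : dga K) (x : X -> Om) (a : pdga) : dsat x ->
  dga_lift x (dd a) = dd (dga_lift x a).
Proof. exact: liftd. Qed.
Lemma dga_ext (a b : pdga) :
  (forall (Om : dga K) (x : X -> Om), dsat x -> dga_lift x a = dga_lift x b) ->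
  a = b.
Proof. exact: pdga_ext. Qed.

Lemma dga_liftD (Om : dga K) (x : X -> Om) (a b : pdga) : dsat x ->
  dga_lift x (a + b) = dga_lift x a + dga_lift x b.
Proof. exact: liftD. Qed.
Lemma dga_liftZ (Om : dga K) (x : X -> Om) c (a : pdga) : dsat x ->
  dga_lift x (c *: a) = c *: dga_lift x a.
Proof. exact: liftZ. Qed.
Lemma dga_liftB (Om : dga K) (x : X -> Om) (a b : pdga) : dsat x ->
  dga_lift x (a - b) = dga_lift x a - dga_lift x b.
Proof. by move=> hx; rewrite dga_liftD // -scaleN1r dga_liftZ // scaleN1r. Qed.
Lemma dga_lift0 (Om : dga K) (x : X -> Om) : dsat x -> dga_lift x 0 = 0.
Proof. by move=> hx; rewrite -(subrr 1) dga_liftB // subrr. Qed.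

Lemma dgen_deg i : hc 0 (dgen i) = dgen i.
Proof.
apply: dga_ext => Om x hx; rewrite dga_lift_hc // dga_lift_gen //.
by case: hx => ->.
Qed.

Lemma pdga_ind (P : pdga -> Prop) : (forall i, P (dgen i)) ->
  (forall c, P c%:A) -> (forall a b, P a -> P b -> P (a + b)) ->
  (forall a b, P a -> P b -> P (a * b)) -> (forall n a, P a -> P (hc n a)) ->
  (forall a, P a -> P (dd a)) -> forall a, P a.
Proof.
move=> Pg Ps PD PM Ph Pd a; have -> : a = dmk (drep a) by rewrite /dmk reprK.
elim: (drep a) => [i|c|t ht u hu|t ht u hu|n t ht|t ht]; first exact: Pg.
- suff -> : dmk (DScal X c) = c%:A :> pdga by apply: Ps.
  apply: pdga_ext => B x hx; rewrite dlift_mk //=.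
  by rewrite -[c%:A in RHS]addr0 [RHS]lift_lin // [dlift x 1]lift1 // [dlift x 0]lift0 // addr0.
- suff -> : dmk (DAdd t u) = (dmk t : pdga) + dmk u by apply: PD.
  by apply: pdga_ext => B x hx; rewrite [RHS]liftD // !dlift_mk.
- suff -> : dmk (DMul t u) = (dmk t : pdga) * dmk u by apply: PM.
  by apply: pdga_ext => B x hx; rewrite [RHS]liftM // !dlift_mk.
- suff -> : dmk (DHc n t) = hc n (dmk t : pdga) by apply: Ph.
  by apply: pdga_ext => B x hx; rewrite [RHS]liftH // !dlift_mk.
- suff -> : dmk (DDiff t) = dd (dmk t : pdga) by apply: Pd.
  by apply: pdga_ext => B x hx; rewrite [RHS]liftd // !dlift_mk.
Qed.
End PresentedDga.

Section Notions.
Variable K : fieldType.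

Definition lie (B : algType K) (a b : B) : B := a * b - b * a.

Definition alg_hom (A B : algType K) (f : A -> B) : Prop :=
  linear f /\ monoid_morphism f.

Definition dga_hom (Om Om' : dga K) (f : Om -> Om') : Prop :=
  [/\ alg_hom f, forall n w, f (hc n w) = hc n (f w)
    & forall w, f (dd w) = dd (f w)].

Definition tmap (V W V' W' : lmodType K) (f : V -> V') (g : W -> W')
    (t : tens V W) : tens V' W' := \tsum_(v, w <- t) f v ⊗ g w.

(* [x] generates [B], and [rels] are defining relations among the [x i]. *)
Definition presented (X : Type) (rels : arels K X) (B : algType K)
    (x : X -> B) : Prop :=
  rels B x /\ forall (B' : algType K) (y : X -> B'), rels B' y ->
    exists f : B -> B', [/\ alg_hom f, forall j, f (x j) = y j
      & forall f' : B -> B', alg_hom f' -> (forall j, f' (x j) = y j) -> f' =1 f].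

(* [i] identifies A with the degree 0 part of Om. *)
Definition exterior_algebra (A : algType K) (Om : dga K) (i : A -> Om) : Prop :=
  [/\ alg_hom i, injective i,
      forall w : Om, hc 0 w = w <-> exists a, w = i a,
      forall w : Om, hc 1 w = w ->
        exists s : seq (A * A), w = \sum_(ab <- s) i ab.1 * dd (i ab.2)
    & forall P : Om -> Prop,
        (forall w, hc 0 w = w \/ hc 1 w = w -> P w) ->
        (forall v w, P v -> P w -> P (v + w)) ->
        (forall v w, P v -> P w -> P (v * w)) -> forall w, P w].

(* The grading of the super-Hopf algebra is the form degree mod 2, so a map is
   even when it commutes with w |-> (-1)^|w| w. *)
Definition super_hopf (Om : dga K) (D : Om -> tens Om Om) (eps : Om -> K^o)
    (S : Om -> Om) : Prop :=
  [/\ @alg_hom Om (stens Om Om) D /\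
        (forall w, D (par w) = par (D w : stens Om Om)),
      alg_hom eps /\ (forall w, eps (par w) = eps w),
      linear S /\ (forall w, S (par w) = par (S w)),
      forall w, \tsum_(a, b <- D w) \tsum_(a1, a2 <- D a) (a1 ⊗ (a2 ⊗ b)) =
                \tsum_(a, b <- D w) (a ⊗ D b)
    & forall w,
        [/\ \tsum_(a, b <- D w) (eps a *: b) = w,
            \tsum_(a, b <- D w) (eps b *: a) = w,
            \tsum_(a, b <- D w) (S a * b) = (eps w)%:A
          & \tsum_(a, b <- D w) (a * S b) = (eps w)%:A]].

Definition strongly_bicovariant (A : algType K) (DA : A -> tens A A)
    (Om : dga K) (i : A -> Om) (D : Om -> tens Om Om) : Prop :=
  [/\ exists eps S, super_hopf D eps S,
      forall n w, D (hc n w) = hc n (D w : stens Om Om),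
      forall a, D (i a) = tmap i i (DA a)
    & forall w, D (dd w) = dd (D w : stens Om Om)].

Definition differentiable (B A : algType K) (delta : B -> tens B A)
    (OmB OmA : dga K) (iB : B -> OmB) (iA : A -> OmA) : Prop :=
  exists2 Phi : OmB -> stens OmB OmA,
    dga_hom Phi & forall b, Phi (iB b) = tmap iB iA (delta b).

Section Bicross.
Variables (A H : dga K).
Variables (DA : A -> tens A A) (epsA : A -> K^o).
Variables (DH : H -> tens H H) (epsH : H -> K^o).
Variables (act : H -> A -> A) (beta : H -> tens H A).

Definition super_module_algebra : Prop :=
  [/\ bilin act /\ (forall m n h a, hc m h = h -> hc n a = a ->
        hc (m + n) (act h a) = act h a),
      forall a, act 1 a = a,
      forall h k a, act (h * k) a = act h (act k a),
      forall h, act h 1 = (epsH h)%:A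
    & forall h a b, act h (a * b) =
        \tsum_(h1, h2 <- DH h) kos (fun h2 a => act h1 a * act h2 b) h2 a].

Definition super_comodule_coalgebra : Prop :=
  [/\ linear beta /\ (forall n h, beta (hc n h) = hc n (beta h : stens H A)),
      forall h, \tsum_(k, a <- beta h) \tsum_(k0, k1 <- beta k) (k0 ⊗ (k1 ⊗ a)) =
                \tsum_(k, a <- beta h) (k ⊗ DA a),
      forall h, \tsum_(k, a <- beta h) (epsA a *: k) = h,
      forall h, \tsum_(k, a <- beta h) \tsum_(k1, k2 <- DH k) (k1 ⊗ (k2 ⊗ a)) =
        \tsum_(h1, h2 <- DH h) \tsum_(k, a <- beta h1) \tsum_(l, b <- beta h2)
          kos (fun a l => k ⊗ (l ⊗ (a * b))) a l
    & forall h, \tsum_(k, a <- beta h) (epsH k *: a) = (epsH h)%:A].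

(* (w ⊗ e) (t ⊗ x) = (-1)^(|e2||t|) w (e1 |> t) ⊗ e2 x *)
Definition bicross_mul (u v : tens A H) : tens A H :=
  \tsum_(w, e <- u) \tsum_(t, x <- v) \tsum_(e1, e2 <- DH e)
    kos (fun e2 t => (w * act e1 t) ⊗ (e2 * x)) e2 t.

(* (-1)^(|w2||e1^(0)|) w1 ⊗ e1^(0) ⊗ w2 e1^(1) ⊗ e2, with beta e = e^(0) ⊗ e^(1) *)
Definition bicross_coprod (u : tens A H) : tens (tens A H) (tens A H) :=
  \tsum_(w, e <- u) \tsum_(w1, w2 <- DA w) \tsum_(e1, e2 <- DH e)
    \tsum_(k, a <- beta e1)
      kos (fun w2 k => (w1 ⊗ k) ⊗ ((w2 * a) ⊗ e2)) w2 k.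

(* [phi] is an isomorphism from the super bicrossproduct, whose grading and
   differential are those of the super tensor product. *)
Definition bicross_iso (Om : dga K) (D : Om -> tens Om Om)
    (phi : tens A H -> Om) : Prop :=
  [/\ linear phi /\ bijective phi,
      phi (1 ⊗ 1) = 1 /\ (forall u v, phi (bicross_mul u v) = phi u * phi v),
      forall u, D (phi u) = tmap phi phi (bicross_coprod u),
      forall n (u : stens A H), phi (hc n u) = hc n (phi u)
    & forall u : stens A H, phi (dd u) = dd (phi u)].
End Bicross.
End Notions.

Section Planck.
Variables (K : fieldType) (lam : K).

Inductive planck_gen : Set := Pg | Pginv | Pp.

Definition planck_rels : arels K planck_gen := fun B x =>
  [/\ x Pg * x Pginv = 1, x Pginv * x Pg = 1
    & lie (x Pp) (x Pg) = lam *: ((1 - x Pg) * x Pg)].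

Fact planck_model :
  exists (B : algType K) (x : planck_gen -> B), planck_rels x.
Proof.
exists K^o, (fun j => if j is Pp then 0 else 1).
by split; rewrite /lie ?mulr1 ?mul1r ?subrr ?mul0r ?scaler0.
Qed.

Definition planck : algType K := palg planck_model.
Definition pl_g : planck := pgen planck_model Pg.
Definition pl_ginv : planck := pgen planck_model Pginv.
Definition pl_p : planck := pgen planck_model Pp.

Definition planck_coprod : planck -> tens planck planck :=
  @plift K _ planck_rels planck_model (stens (triv planck) (triv planck))
    (fun j => match j with
      | Pg => pl_g ⊗ pl_g
      | Pginv => pl_ginv ⊗ pl_ginv
      | Pp => 1 ⊗ pl_p + pl_p ⊗ pl_g
      end).

(* Delta_R r = 1 ⊗ p + r ⊗ g *)
Definition planck_coaction : {poly K} -> tens {poly K} planck :=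
  @horner_alg K (stens (triv {poly K}) (triv planck))
    ((1 : {poly K}) ⊗ pl_p + 'X ⊗ pl_g).

(* [Omega_line] serves as the exterior algebra both of C[r] and of C[p]. *)
Definition line_rels : drels K unit := fun Om x =>
  let r := x tt in lie r (dd r) = lam *: dd r /\ dd r * dd r = 0.

Fact line_model : exists (Om : dga K) (x : unit -> Om), dsat line_rels x.
Proof.
exists (triv K^o), (fun _ => 0); split=> //.
by rewrite /line_rels /= /lie !linear0 !mulr0 subrr.
Qed.

Definition Omega_line : dga K := pdga line_model.
Definition li_r : Omega_line := dgen line_model tt.
Definition line_incl : {poly K} -> Omega_line := horner_alg li_r.
Definition line_coprod : Omega_line -> tens Omega_line Omega_line :=
  @dga_lift K _ line_rels line_model (stens Omega_line Omega_line)
    (fun _ => li_r ⊗ 1 + 1 ⊗ li_r).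
Definition line_counit : Omega_line -> K^o :=
  @dga_lift K _ line_rels line_model (triv K^o) (fun _ => 0).

(* [true] is g and [false] is its inverse. *)
Definition torus_rels : drels K bool := fun Om x =>
  let g := x true in let ginv := x false in
  [/\ g * ginv = 1, ginv * g = 1, lie (dd g) g = 0 & dd g * dd g = 0].

Fact torus_model : exists (Om : dga K) (x : bool -> Om), dsat torus_rels x.
Proof.
exists (triv K^o), (fun _ => 1); split=> //.
by rewrite /torus_rels /= /lie; split; rewrite ?mulr1 ?mul0r ?mulr0 ?subrr.
Qed.

Definition Omega_torus : dga K := pdga torus_model.
Definition to_g : Omega_torus := dgen torus_model true.
Definition to_ginv : Omega_torus := dgen torus_model false.
Definition torus_coprod : Omega_torus -> tens Omega_torus Omega_torus :=
  @dga_lift K _ torus_rels torus_model (stens Omega_torus Omega_torus)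
    (fun j => if j then to_g ⊗ to_g else to_ginv ⊗ to_ginv).
Definition torus_counit : Omega_torus -> K^o :=
  @dga_lift K _ torus_rels torus_model (triv K^o) (fun _ => 1).

Definition planck_action (act : Omega_line -> Omega_torus -> Omega_torus) : Prop :=
  [/\ super_module_algebra line_coprod line_counit act,
      act li_r to_g = lam *: ((1 - to_g) * to_g),
      act (dd li_r) to_g = - (lam *: (to_g * dd to_g)),
      act li_r (dd to_g) = lam *: ((1 - to_g) * dd to_g)
    & act (dd li_r) (dd to_g) = 0].

(* The values on products are fixed by the bicrossproduct being a super-Hopf
   algebra, see [bicross_iso]. *)
Definition planck_beta (beta : Omega_line -> tens Omega_line Omega_torus) : Prop :=
  [/\ super_comodule_coalgebra torus_coprod torus_counit line_coprod line_counit
        beta,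
      beta li_r = li_r ⊗ to_g
    & beta (dd li_r) = dd li_r ⊗ to_g + li_r ⊗ dd to_g].

Inductive omega_gen : Set := Og | Oginv | Op | Odg | Odp.

Definition omega_rels : arels K omega_gen := fun B x =>
  let: (g, ginv, p, dg, dp) := (x Og, x Oginv, x Op, x Odg, x Odp) in
  [/\ [/\ g * ginv = 1, ginv * g = 1 & lie p g = lam *: ((1 - g) * g)],
      [/\ lie dg g = 0, lie p dp = lam *: dp, lie g dp = lam *: (g * dg)
        & lie p dg = lam *: ((1 - g) * dg)]
    & [/\ dp * dp = 0, dg * dg = 0 & dp * dg = - (dg * dp)]].

End Planck.

Arguments hc : simpl never.
Arguments dd : simpl never.
Arguments dga_alg : simpl never.

Section Soundness.
Variables (K : fieldType) (lam : K).

Lemma stens_mulE (Om Om' : dga K) m n (a c : Om) (b e : Om') :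
  hc m b = b -> hc n c = c ->
  (a ⊗ b : stens Om Om') * (c ⊗ e) = (-1) ^+ (m * n) *: ((a * c) ⊗ (b * e)).
Proof. exact: smul_hom. Qed.

Lemma stens_ddE (Om Om' : dga K) m (a : Om) (b : Om') : hc m a = a ->
  dd (a ⊗ b : stens Om Om') = dd a ⊗ b + (-1) ^+ m *: (a ⊗ dd b).
Proof. exact: stens_dd_hom. Qed.

Lemma stens_hcE (Om Om' : dga K) k m n (a : Om) (b : Om') : hc m a = a -> hc n b = b ->
  hc k (a ⊗ b : stens Om Om') = if k == (m + n)%N then a ⊗ b else 0.
Proof. exact: stens_hc_hom. Qed.

Lemma triv_stens_mulE (A B : algType K) (a c : A) (b e : B) :
  (a ⊗ b : stens (triv A) (triv B)) * (c ⊗ e) = (a * c) ⊗ (b * e).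
Proof. by rewrite (@stens_mulE (triv A) (triv B) 0 0) // scale1r. Qed.

Lemma planck_gen_rels : planck_rels lam (pgen (planck_model lam)).
Proof.
split; apply: palg_ext => B x hx; have [h1 h2 h3] := hx;
  rewrite ?(pliftB, pliftZ, plift_mul, plift_gen, plift_one) //.
Qed.

Lemma planck_coprod_rels :
  @planck_rels K lam (stens (triv (planck lam)) (triv (planck lam)))
    (fun j => match j with
      | Pg => pl_g lam ⊗ pl_g lam
      | Pginv => pl_ginv lam ⊗ pl_ginv lam
      | Pp => 1 ⊗ pl_p lam + pl_p lam ⊗ pl_g lam
      end).
Proof.
have [h1 h2 h3] := planck_gen_rels.
have bt := @bilin_tpure K (planck lam) (planck lam).
split; rewrite ?triv_stens_mulE ?h1 ?h2 //.
rewrite -/(pl_g lam) -/(pl_p lam) /lie mulrBl mul1r mulrDl mulrDr.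
rewrite !triv_stens_mulE mul1r mulr1.
have hpg : pl_p lam * pl_g lam =
    pl_g lam * pl_p lam + lam *: (pl_g lam - pl_g lam * pl_g lam).
  by move: h3; rewrite mulrBl mul1r => <-; rewrite /lie addrC subrK.
rewrite hpg !(bilinDl bt, bilinDr bt, bilinZl bt, bilinZr bt).
rewrite !scaleN1r addrACA. rewrite [LHS]addrAC subrr add0r -scalerDr addrA subrK.
by [].
Qed.

Lemma line_gen_rels : line_rels lam (dgen (line_model lam)).
Proof.
by split; apply: dga_ext => Om x hx; have [h0 [h1 h2]] := hx;
  rewrite ?(dga_liftB, dga_liftZ, dga_lift_mul, dga_lift_dd, dga_lift_gen,
     dga_lift0) //.
Qed.

Lemma torus_gen_rels : torus_rels (dgen (torus_model K)).
Proof.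
by split; apply: dga_ext => Om x hx; have [h0 [h1 h2 h3 h4]] := hx;
  rewrite ?(dga_liftB, dga_liftZ, dga_lift_mul, dga_lift_dd, dga_lift_gen,
     dga_lift0, dga_lift_one) //.
Qed.

Lemma dd_one (Om : dga K) : dd (1 : Om) = 0.
Proof.
have := dd_mul (1 : Om) (hc_one Om); rewrite mulr1 expr0 scale1r mul1r mulr1.
by move=> e; apply: (@addrI _ (dd 1)); rewrite addr0.
Qed.

Lemma line_stens (Om : dga K) (r : Om) : hc 0 r = r ->
  line_rels lam (fun _ : unit => r) ->
  @dsat K _ (line_rels lam) (stens Om Om) (fun _ => r ⊗ 1 + 1 ⊗ r).
Proof.
move=> hr [e1 e2]; have h1 := hc_one Om; have hd : hc 1 (dd r) = dd r := hc_dd hr.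
have bt := @bilin_tpure K Om Om.
split=> [_|].
  by rewrite linearD /= !(stens_hcE _ hr h1) !(stens_hcE _ h1 hr).
rewrite /line_rels linearD /= !(stens_ddE _ hr) !(stens_ddE _ h1) dd_one.
rewrite !(bilin0l bt) !(bilin0r bt) expr0 !scale1r addr0 add0r.
rewrite /lie !(mulrDl, mulrDr).
pose me := (stens_mulE _ _ h1 h1, stens_mulE _ _ h1 hr, stens_mulE _ _ h1 hd,
  stens_mulE _ _ hr h1, stens_mulE _ _ hr hr, stens_mulE _ _ hr hd,
  stens_mulE _ _ hd h1, stens_mulE _ _ hd hr, stens_mulE _ _ hd hd).
rewrite !me !(mul1r, mulr1) e2 (bilin0l bt) (bilin0r bt).
rewrite !(mul0n, muln0, muln1, expr0, expr1, scale1r, scaleN1r, addr0, add0r).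
split; last exact: subrr.
have e3 : r * dd r = dd r * r + lam *: dd r by rewrite -e1 addrC subrK.
rewrite e3 !(bilinDl bt, bilinDr bt, bilinZl bt, bilinZr bt) scalerDr.
by apply/eqP; rewrite subr_eq [X in X == _](AC (3*(1*2)) ((2*6)*((1*4)*(3*5)))).
Qed.

Lemma torus_stens (Om : dga K) (x : bool -> Om) : (forall j, hc 0 (x j) = x j) ->
  torus_rels x ->
  @dsat K _ (@torus_rels K) (stens Om Om) (fun j => x j ⊗ x j).
Proof.
move=> hx; set g := x true; set g' := x false; move=> [e1 e2 e3 e4].
have hg : hc 0 g = g := hx _; have hg' : hc 0 g' = g' := hx _.
have hd : hc 1 (dd g) = dd g := hc_dd hg.
have bt := @bilin_tpure K Om Om.
split=> [j|]; first by rewrite (stens_hcE _ (hx j) (hx j)).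
rewrite /torus_rels -/g -/g' (stens_ddE _ hg) expr0 scale1r.
pose me := (stens_mulE _ _ hg hg', stens_mulE _ _ hg' hg, stens_mulE _ _ hg hg,
  stens_mulE _ _ hd hg, stens_mulE _ _ hg hd, stens_mulE _ _ hd hd).
have e5 : dd g * g = g * dd g by apply/eqP; rewrite -subr_eq0; apply/eqP.
rewrite /lie !(mulrDl, mulrDr) !me e1 e2 e4 !e5 (bilin0l bt) (bilin0r bt).
rewrite !(mul0n, muln0, muln1, expr0, expr1, scale1r, scaleN1r, addr0, add0r).
by split=> //; rewrite subrr.
Qed.

Lemma line_coprod_dsat :
  @dsat K _ (line_rels lam) (stens (Omega_line lam) (Omega_line lam))
    (fun _ => li_r lam ⊗ 1 + 1 ⊗ li_r lam).
Proof. exact: line_stens (dgen_deg _ _) line_gen_rels. Qed.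

Lemma torus_coprod_dsat :
  @dsat K _ (@torus_rels K) (stens (Omega_torus K) (Omega_torus K))
    (fun j => if j then to_g K ⊗ to_g K else to_ginv K ⊗ to_ginv K).
Proof.
have [h0 [h1 h2 h3 h4]] := torus_stens (@dgen_deg _ _ _ _) torus_gen_rels.
split; first by case; [apply: (h0 true)|apply: (h0 false)].
by split.
Qed.
End Soundness.

(* Main.v *)
Require Import Defs.
From HB Require Import structures.
From mathcomp Require Import all_boot all_order all_algebra.
From mathcomp Require Import boolp.
From mathcomp Require Import ring.
From mathcomp Require Import reals complex.

(* The calculus is the algebra with generators g, g^-1, p, dg, dp and the stated
   relations.  Its grading is the coefficient map of the algebra map that
   multiplies each one-form by an indeterminate, and its differential is the
   off-diagonal entry of a representation by twisted triangular operators, so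
   that both exist because they respect the relations.

   Universality: composing a differentiable coaction with evaluation of the line
   at r = a shows that p + a g satisfies the relation [r, dr] = lam dr for every
   scalar a; comparing a = 0, 1, -1 and differentiating [p, g] gives all the
   relations.

   Bicrossproduct: the calculus acts on Omega(C[g, g^-1]), with p acting by
   lam (1 - g) E and dp by - lam dg E for the Euler derivation E, and acting on 1
   gives a projection piT onto Omega(C[g, g^-1]); sending g to 1 gives a
   projection piL onto Omega(C[p]).  The map t tensor h |-> t h is inverted by
   (piT tensor piL) D, and beta = (id tensor piT) D restricted to Omega(C[p]).
   All the bicrossproduct identities then follow from coassociativity of D. *)

Set Implicit Arguments.
Unset Strict Implicit.
Unset Printing Implicit Defensive.

Import GRing.Theory.
Local Open Scope ring_scope.

(** * Linear endomorphisms and algebra maps *)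

(** No basis of the calculus is computed: injectivity comes from explicit retractions, onto the
    Planck algebra by killing the one-forms and onto the two factors by [piT] and [piL]. In
    particular t tensor h |-> t h is bijective without a PBW argument. Up to sign, D (t h) is the
    sum of t_1 h^(0) tensor t_2 h^(1); [piT] replaces a right factor from the line by its counit,
    [piL] replaces a factor from the torus by its counit, and t tensor h remains.

    The presentation is one of plain algebras, so each construction is a check of ten relations, and
    its target may be an algebra of operators without differential. This is how d, the antipode and
    the representation on the torus arise.

    In [p + a g, d(p + a g)] = lam d(p + a g) the coefficient of a^2 gives [g, dg] = 0 and that of a
    gives [p, dg] + [g, dp] = lam dg. The derivative of [p, g] supplies [p, dg] - [g, dp], so
    halving yields both commutators; the quadratic relations are derivatives of the linear ones. *)

(* Linear identities in a module are reduced to the field, where [ring] works. *)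
Lemma linear_form_ext (K : fieldType) (V : lmodType K) (u v : V) :
  (forall f : V -> K, {morph f : x y / x + y} -> {morph f : x / - x} ->
     (forall c x, f (c *: x) = c * f x) -> f 0 = 0 -> f u = f v) -> u = v.
Proof.
move=> h; apply/eqP; rewrite -subr_eq0; apply/eqP; apply: contrapT => /eqP.
move=> /exists_linear_form [f [lf f1]].
have f0 : f 0 = 0 by have := lf (-1) 0 0; rewrite scaler0 addr0 scaleN1r addNr.
have fZ c x : f (c *: x) = c * f x by rewrite -[c *: x]addr0 lf f0 addr0.
have fD : {morph f : x y / x + y} by move=> x y; rewrite -[x in LHS]scale1r lf scale1r.
have fN : {morph f : x / - x} by move=> x; rewrite -scaleN1r fZ mulN1r.
have := h f fD fN fZ f0; move: f1; rewrite fD fN => f1 e.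
by move: f1; rewrite e addrN => /eqP; rewrite eq_sym oner_eq0.
Qed.

Ltac linear_ring :=
  let f := fresh in let fD := fresh in let fN := fresh in let fZ := fresh in
  let f0 := fresh in
  apply: linear_form_ext => f fD fN fZ f0; rewrite ?(fD, fN, fZ, f0); ring.

Section LinearEnd.
Variables (K : fieldType) (B : algType K).

(** Linear operators are packaged as an algebra so that a presentation can be mapped into them: the
    differential, the antipode and the action on torus forms are all obtained by checking defining
    relations on operators. The carrier is an algebra so that its unit shows the identity operator
    to be nonzero. *)
Record lend := Lend { lend_fun :> B -> B; lend_lin : linear lend_fun }.

HB.instance Definition _ := gen_eqMixin lend.
HB.instance Definition _ := gen_choiceMixin lend.

Lemma lendP (f g : lend) : f =1 g -> f = g.
Proof.
case: f g => [f hf] [g hg] /= /funext e; subst g; congr Lend.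
exact: Prop_irrelevance.
Qed.

Fact lend_add_lin (f g : lend) : linear (fun x => f x + g x).
Proof. by move=> c x y; rewrite !lend_lin scalerDr addrACA. Qed.
Fact lend_scale_lin (c : K) (f : lend) : linear (fun x => c *: f x).
Proof. by move=> k x y; rewrite lend_lin scalerDr !scalerA mulrC. Qed.
Fact lend_zero_lin : linear (fun _ : B => 0 : B).
Proof. by move=> c x y; rewrite scaler0 addr0. Qed.
Fact lend_id_lin : linear (fun x : B => x).
Proof. by []. Qed.
Fact lend_comp_lin (f g : lend) : linear (fun x => f (g x)).
Proof. by move=> c x y; rewrite !lend_lin. Qed.

Let ladd f g := Lend (lend_add_lin f g).
Let lscale c f := Lend (lend_scale_lin c f).
Let lopp f := lscale (-1) f.
Let lmul f g := Lend (lend_comp_lin f g).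

Fact lend_addA : associative ladd.
Proof. by move=> f g h; apply: lendP => x /=; rewrite addrA. Qed.
Fact lend_addC : commutative ladd.
Proof. by move=> f g; apply: lendP => x /=; rewrite addrC. Qed.
Fact lend_add0 : left_id (Lend lend_zero_lin) ladd.
Proof. by move=> f; apply: lendP => x /=; rewrite add0r. Qed.
Fact lend_addN : left_inverse (Lend lend_zero_lin) lopp ladd.
Proof. by move=> f; apply: lendP => x /=; rewrite scaleN1r addNr. Qed.
HB.instance Definition _ :=
  GRing.isZmodule.Build lend lend_addA lend_addC lend_add0 lend_addN.

Fact lend_mulA : associative lmul.
Proof. by move=> f g h; apply: lendP. Qed.
Fact lend_mul1 : left_id (Lend lend_id_lin) lmul.
Proof. by move=> f; apply: lendP. Qed.
Fact lend_mul1r : right_id (Lend lend_id_lin) lmul.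
Proof. by move=> f; apply: lendP. Qed.
Fact lend_mulDl : left_distributive lmul +%R.
Proof. by move=> f g h; apply: lendP. Qed.
Fact lend_mulDr : right_distributive lmul +%R.
Proof.
by move=> f g h; apply: lendP => x /=; have := lend_lin f 1 (g x) (h x);
  rewrite !scale1r.
Qed.
Fact lend_1neq0 : Lend lend_id_lin != 0.
Proof.
apply/eqP => /(congr1 (fun f : lend => f 1)) /= e.
by have := oner_neq0 B; rewrite e eqxx.
Qed.
HB.instance Definition _ := GRing.Zmodule_isNzRing.Build lend
  lend_mulA lend_mul1 lend_mul1r lend_mulDl lend_mulDr lend_1neq0.

Fact lend_scaleA a b f : lscale a (lscale b f) = lscale (a * b) f.
Proof. by apply: lendP => x /=; rewrite scalerA. Qed.
Fact lend_scale1 : left_id 1 lscale.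
Proof. by move=> f; apply: lendP => x /=; rewrite scale1r. Qed.
Fact lend_scaleDr : right_distributive lscale +%R.
Proof. by move=> c f g; apply: lendP => x /=; rewrite scalerDr. Qed.
Fact lend_scaleDl f : {morph lscale^~ f : a b / a + b}.
Proof. by move=> a b; apply: lendP => x /=; rewrite scalerDl. Qed.
HB.instance Definition _ := GRing.Zmodule_isLmodule.Build K lend
  lend_scaleA lend_scale1 lend_scaleDr lend_scaleDl.
Fact lend_scaleAl c (f g : lend) : c *: (f * g) = c *: f * g.
Proof. exact: lendP. Qed.
HB.instance Definition _ := GRing.Lmodule_isLalgebra.Build K lend lend_scaleAl.
Fact lend_scaleAr c (f g : lend) : c *: (f * g) = f * (c *: g).
Proof.
apply: lendP => x; have := lend_lin f c (g x) 0.
have f0 : f 0 = 0 by have := lend_lin f (-1) 0 0; rewrite scaler0 addr0 scaleN1r addNr.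
by rewrite f0 !addr0.
Qed.
HB.instance Definition _ := GRing.Lalgebra_isAlgebra.Build K lend lend_scaleAr.

Lemma lendD (f g : lend) x : (f + g) x = f x + g x. Proof. by []. Qed.
Lemma lendM (f g : lend) x : (f * g) x = f (g x). Proof. by []. Qed.
Lemma lendZ c (f : lend) x : (c *: f) x = c *: f x. Proof. by []. Qed.
Lemma lendN (f : lend) x : (- f) x = - f x.
Proof. by rewrite -scaleN1r lendZ scaleN1r. Qed.
Lemma lend1 x : (1 : lend) x = x. Proof. by []. Qed.
Lemma lend0 x : (0 : lend) x = 0. Proof. by []. Qed.
End LinearEnd.

Section AlgHom.
Variables (K : fieldType).
Implicit Types A B : algType K.

Lemma alg_homP A B (f : A -> B) : alg_hom f ->
  [/\ (forall x y, f (x + y) = f x + f y), (forall c x, f (c *: x) = c *: f x),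
      (forall x y, f (x * y) = f x * f y), f 1 = 1 & f 0 = 0].
Proof.
move=> [lf [f1 fM]]; split=> //.
- by move=> x y; rewrite -[x in LHS]scale1r lf scale1r.
- exact: scalable_linear.
- by have := lf (-1) 0 0; rewrite scaler0 addr0 scaleN1r addNr.
Qed.

Lemma alg_homB A B (f : A -> B) x y : alg_hom f -> f (x - y) = f x - f y.
Proof. by case/alg_homP => fD fZ _ _ _; rewrite fD -scaleN1r fZ scaleN1r. Qed.
Lemma alg_homN A B (f : A -> B) x : alg_hom f -> f (- x) = - f x.
Proof. by case/alg_homP => _ fZ _ _ _; rewrite -scaleN1r fZ scaleN1r. Qed.

Lemma alg_hom_lie A B (f : A -> B) x y : alg_hom f -> f (lie x y) = lie (f x) (f y).
Proof. by move=> hf; have [_ _ fM _ _] := alg_homP hf; rewrite alg_homB // !fM. Qed.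

Lemma alg_hom_id A : alg_hom (fun x : A => x).
Proof. by split. Qed.

Lemma alg_hom_comp A B (C : algType K) (f : A -> B) (g : B -> C) :
  alg_hom f -> alg_hom g -> alg_hom (fun x => g (f x)).
Proof.
move=> [lf [f1 fM]] [lg [g1 gM]]; split; first by move=> c x y; rewrite lf lg.
by split=> [|x y]; rewrite ?f1 ?fM.
Qed.

End AlgHom.

(** * Tensor calculus and super tensor products *)

Section TensorCalculus.
Variables (K : fieldType).
Implicit Types U V W : lmodType K.

Lemma linD V W (f : V -> W) x y : linear f -> f (x + y) = f x + f y.
Proof. by move=> lf; rewrite -[x in LHS]scale1r lf scale1r. Qed.
Lemma lin0 V W (f : V -> W) : linear f -> f 0 = 0.
Proof. by move=> lf; have := lf (-1) 0 0; rewrite scaler0 addr0 scaleN1r addNr. Qed.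
Lemma linZ V W (f : V -> W) c x : linear f -> f (c *: x) = c *: f x.
Proof. by move=> lf; rewrite -[c *: x]addr0 lf (lin0 lf) addr0. Qed.
Lemma lin_sum V W (f : V -> W) I (r : seq I) (P : pred I) F : linear f ->
  f (\sum_(i <- r | P i) F i) = \sum_(i <- r | P i) f (F i).
Proof.
by move=> lf; apply: (big_morph f) => [x y|]; [apply: linD|apply: lin0].
Qed.

Lemma eq_tsum V W U (F G : V -> W -> U) t :
  (forall v w, F v w = G v w) -> tsum F t = tsum G t.
Proof. by move=> e; apply: eq_bigr => x _; apply: e. Qed.

Lemma lin_tsum V W U U' (f : U -> U') (F : V -> W -> U) t : linear f ->
  f (tsum F t) = tsum (fun v w => f (F v w)) t.
Proof. exact: lin_sum. Qed.

Lemma tsum_tsum V W V' W' U (F : V -> W -> U) (G : V' -> W' -> tens V W) t :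
  bilin F -> tsum F (tsum G t) = tsum (fun v w => tsum F (G v w)) t.
Proof. by move=> bF; apply: lin_tsum; apply: tsum_lin. Qed.

Lemma tsum_tmap V W V' W' U (F : V -> W -> U) (f : V' -> V) (g : W' -> W) t :
  bilin F -> tsum F (tmap f g t) = tsum (fun v w => F (f v) (g w)) t.
Proof.
by move=> bF; rewrite tsum_tsum //; apply: eq_tsum => v w; rewrite tsum_pure.
Qed.

Lemma bilin_comp V W V' W' U (F : V -> W -> U) (f : V' -> V) (g : W' -> W) :
  bilin F -> linear f -> linear g -> bilin (fun v w => F (f v) (g w)).
Proof.
by move=> [Fl Fr] lf lg; split=> [w|v] c x y /=; rewrite ?lf ?lg ?Fl ?Fr.
Qed.

Lemma bilin_mul (B : algType K) : bilin (fun a b : B => a * b).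
Proof.
split=> [w|v] c x y /=; first by rewrite mulrDl scalerAl.
by rewrite mulrDr scalerAr.
Qed.

Lemma bilin_scale V : bilin (fun (a : K^o) (b : V) => a *: b).
Proof.
split=> [w|v] c x y /=; first by rewrite scalerDl scalerA.
by rewrite scalerDr !scalerA mulrC.
Qed.

Lemma tmap_pure V W V' W' (f : V' -> V) (g : W' -> W) v w :
  linear f -> linear g -> tmap f g (v ⊗ w) = f v ⊗ g w.
Proof.
move=> lf lg; rewrite /tmap tsum_pure //.
by apply: bilin_comp => //; apply: bilin_tpure.
Qed.

Lemma tmap_lin V W V' W' (f : V' -> V) (g : W' -> W) :
  linear f -> linear g -> linear (tmap f g).
Proof.
move=> lf lg; apply: tsum_lin; apply: bilin_comp => //; exact: bilin_tpure.
Qed.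

Lemma tmap_tmap V W V' W' V'' W'' (f : V' -> V) (g : W' -> W) (f' : V'' -> V')
  (g' : W'' -> W') t : linear f -> linear g ->
  tmap f g (tmap f' g' t) = tmap (fun x => f (f' x)) (fun x => g (g' x)) t.
Proof.
move=> lf lg; rewrite {1}/tmap tsum_tmap //.
by apply: bilin_comp => //; apply: bilin_tpure.
Qed.

Lemma eq_tmap V W V' W' (f f' : V' -> V) (g g' : W' -> W) t :
  f =1 f' -> g =1 g' -> tmap f g t = tmap f' g' t.
Proof. by move=> ef eg; apply: eq_tsum => v w; rewrite ef eg. Qed.

Lemma tmap_id V W (t : tens V W) : tmap id id t = t.
Proof. by rewrite [RHS]tensE. Qed.

End TensorCalculus.

(** * Degree components, parity and homomorphisms of DGAs *)

Section DgaCalculus.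
Variables (K : fieldType).
Implicit Types Om : dga K.

Lemma hc_idem Om n (w : Om) : hc n (hc n w) = hc n w.
Proof. by rewrite hc_hc eqxx. Qed.

Lemma hc_indh Om (P : Om -> Prop) : P 0 -> (forall x y, P x -> P y -> P (x + y)) ->
  (forall n w, hc n w = w -> P w) -> forall w, P w.
Proof.
move=> P0 PD Ph w; rewrite (hboundP w); apply: big_ind => // i _.
by apply: (Ph i); rewrite hc_idem.
Qed.

Lemma lin_hc Om Om' (f : Om -> Om') : linear f ->
  (forall n w, hc n w = w -> hc n (f w) = f w) -> forall n w, f (hc n w) = hc n (f w).
Proof.
move=> lf fh n; apply: hc_indh => [|x y hx hy|m w hw].
- by rewrite (lin0 (hc_lin _)) (lin0 lf) (lin0 (hc_lin _)).
- by rewrite (linD _ _ (hc_lin _)) (linD _ _ lf) hx hy (linD _ _ lf)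
    (linD _ _ (hc_lin _)).
rewrite (hcK _ hw) (hcK _ (fh _ _ hw)); case: ifP => // _; exact: lin0.
Qed.

Lemma hc_ddC Om n (w : Om) : hc n.+1 (dd w) = dd (hc n w).
Proof.
elim/hc_indh: w => [|x y hx hy|m w hw]; first by rewrite !linear0.
  by rewrite !linearD /= hx hy.
by rewrite (hcK _ (hc_dd hw)) (hcK _ hw) eqSS; case: ifP; rewrite ?linear0.
Qed.

Lemma hc_dd0 Om (w : Om) : hc 0 (dd w) = 0.
Proof.
elim/hc_indh: w => [|x y hx hy|m w hw]; first by rewrite !linear0.
  by rewrite !linearD /= hx hy addr0.
by rewrite (hcK _ (hc_dd hw)).
Qed.

Lemma hc_mulE Om n (a b : Om) :
  hc n (a * b) = \sum_(i < n.+1) hc i a * hc (n - i) b.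
Proof.
elim/hc_indh: a => [|x y hx hy|p a ha].
- by rewrite mul0r linear0 big1 // => i _; rewrite linear0 mul0r.
- rewrite mulrDl linearD /= hx hy -big_split; apply: eq_bigr => i _.
  by rewrite linearD mulrDl.
elim/hc_indh: b => [|x y hx hy|q b hb].
- by rewrite mulr0 linear0 big1 // => i _; rewrite linear0 mulr0.
- rewrite mulrDr linearD /= hx hy -big_split; apply: eq_bigr => i _.
  by rewrite linearD mulrDr.
rewrite (hcK _ (hc_mul ha hb)).
transitivity (\sum_(i < n.+1)
    if (i == p :> nat) && (n == (p + q)%N) then a * b else 0); last first.
  apply: eq_bigr => i _; rewrite (hcK _ ha) (hcK _ hb).
  case: eqP => [ip|ne] /=; last by rewrite mul0r.
  have ik : (i <= n)%N by rewrite -ltnS.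
  rewrite -[(n - i)%N == q](eqn_add2l i) subnKC // ip.
  by case: ifP => // _; rewrite mulr0.
case: (n =P (p + q)%N) => [km|_]; last by rewrite big1 // => i _; rewrite andbF.
have mk : (p < n.+1)%N by rewrite ltnS km leq_addr.
rewrite (bigD1 (Ordinal mk)) //= eqxx big1 ?addr0 // => i ne.
by rewrite andbT ifN.
Qed.

(** A homogeneous left factor shifts components by its degree. With [hc_mull_small], this lets an
    induction on left factors follow single components. *)
Lemma hc_mull Om d n (x w : Om) : hc d x = x -> hc (d + n) (x * w) = x * hc n w.
Proof.
move=> hx; elim/hc_indh: w => [|u v hu hv|m w hw].
- by rewrite !(linear0, mulr0).
- by rewrite mulrDr !linearD /= hu hv mulrDr.
rewrite (hcK _ (hc_mul hx hw)) (hcK _ hw) eqn_add2l.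
by case: ifP; rewrite ?mulr0.
Qed.

Lemma hc_mull_small Om d n (x w : Om) : hc d x = x -> (n < d)%N -> hc n (x * w) = 0.
Proof.
move=> hx nd; elim/hc_indh: w => [|u v hu hv|m w hw].
- by rewrite !(linear0, mulr0).
- by rewrite mulrDr !linearD /= hu hv addr0.
by rewrite (hcK _ (hc_mul hx hw)) ltn_eqF // (leq_trans nd) // leq_addr.
Qed.

Lemma parD Om (x y : Om) : par (x + y) = par x + par y.
Proof. exact: linD (@par_lin _ _). Qed.
Lemma parZ Om c (x : Om) : par (c *: x) = c *: par x.
Proof. exact: scalable_linear (@par_lin _ _) c x. Qed.
Lemma par0 Om : par (0 : Om) = 0.
Proof. exact: lin0 (@par_lin _ _). Qed.

Lemma par_mul Om (x y : Om) : par (x * y) = par x * par y.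
Proof.
elim/hc_indh: x => [|u v hu hv|m x hx]; first by rewrite !(mul0r, par0).
  by rewrite mulrDl !parD hu hv mulrDl.
elim/hc_indh: y => [|u v hu hv|n y hy]; first by rewrite !(mulr0, par0).
  by rewrite mulrDr !parD hu hv mulrDr.
rewrite (par_hom (hc_mul hx hy)) (par_hom hx) (par_hom hy).
by rewrite -scalerAl -scalerAr scalerA exprD.
Qed.

Lemma par_par Om (w : Om) : par (par w) = w.
Proof.
elim/hc_indh: w => [|u v hu hv|m x hx]; first by rewrite !par0.
  by rewrite !parD hu hv.
by rewrite !(par_hom hx) parZ (par_hom hx) scalerA -exprD addnn -mul2n exprM
  sqrrN expr1n expr1n scale1r.
Qed.

Lemma par_1 Om : par (1 : Om) = 1.
Proof. by rewrite (par_hom (hc_one Om)) scale1r. Qed.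

Lemma par_lin_hc Om Om' (f : Om -> Om') : linear f ->
  (forall n w, f (hc n w) = hc n (f w)) -> forall w, f (par w) = par (f w).
Proof.
move=> lf fh; apply: hc_indh => [|u v hu hv|m x hx].
- by rewrite par0 (lin0 lf) par0.
- by rewrite parD !(linD _ _ lf) hu hv parD.
have hfx : hc m (f x) = f x by rewrite -fh hx.
by rewrite (par_hom hx) (par_hom hfx) (scalable_linear lf).
Qed.

Lemma dga_hom_comp Om1 Om2 Om3 (f : Om1 -> Om2) (g : Om2 -> Om3) :
  dga_hom f -> dga_hom g -> dga_hom (fun x => g (f x)).
Proof.
move=> [af fh fd] [ag gh gd]; split=> [|n w|w]; first exact: alg_hom_comp.
  by rewrite fh gh.
by rewrite fd gd.
Qed.

Lemma dga_hom_id Om : dga_hom (fun x : Om => x).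
Proof. by split=> //; apply: alg_hom_id. Qed.

Lemma dga_hom_deg Om1 Om2 (f : Om1 -> Om2) n w : dga_hom f ->
  hc n w = w -> hc n (f w) = f w.
Proof. by case=> _ fh _ hw; rewrite -fh hw. Qed.

Lemma dga_hom_lin Om1 Om2 (f : Om1 -> Om2) : dga_hom f -> linear f.
Proof. by case=> [[]]. Qed.

Lemma dga_hom_par Om1 Om2 (f : Om1 -> Om2) w : dga_hom f -> f (par w) = par (f w).
Proof. by move=> hf; have [[lf _] fh _] := hf; apply: par_lin_hc. Qed.

Lemma dga_homP Om1 Om2 (f : Om1 -> Om2) : alg_hom f ->
  (forall n w, hc n w = w -> hc n (f w) = f w) ->
  (forall w, f (dd w) = dd (f w)) -> dga_hom f.
Proof. by move=> af fh fd; split=> //; apply: lin_hc => //; case: af. Qed.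
End DgaCalculus.

(** * The universal property of the super tensor product *)

Section TensorLift.
Variables (K : fieldType).
Implicit Types Om A B C : dga K.

(** The map out of a super tensor product induced by maps on its two factors. [tmap], the counit
    contractions and the associator are instances, which is how they are seen to be DGA maps. *)
Definition stens_lift Om1 Om2 (B : algType K) (f : Om1 -> B) (g : Om2 -> B)
  (t : stens Om1 Om2) : B := tsum (fun a b => f a * g b) t.

Lemma bilin_fg Om1 Om2 (B : algType K) (f : Om1 -> B) (g : Om2 -> B) :
  linear f -> linear g -> bilin (fun a b => f a * g b).
Proof. by move=> lf lg; apply: bilin_comp => //; apply: bilin_mul. Qed.

Lemma stens_lift_pure Om1 Om2 (B : algType K) (f : Om1 -> B) (g : Om2 -> B) a b :
  linear f -> linear g -> stens_lift f g (a ⊗ b) = f a * g b.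
Proof. by move=> lf lg; rewrite /stens_lift tsum_pure //; apply: bilin_fg. Qed.

Definition supercommute Om1 Om2 (B : algType K) (f : Om1 -> B) (g : Om2 -> B) :=
  forall m n a b, hc m a = a -> hc n b = b ->
    g b * f a = (-1) ^+ (n * m) *: (f a * g b).

Lemma stens_lift_hom Om1 Om2 (B : algType K) (f : Om1 -> B) (g : Om2 -> B) :
  alg_hom f -> alg_hom g -> supercommute f g -> alg_hom (stens_lift f g).
Proof.
move=> hf hg sc; have [lf _] := hf; have [lg _] := hg.
have [_ _ fM f1 _] := alg_homP hf; have [_ _ gM g1 _] := alg_homP hg.
have lF : linear (stens_lift f g) by apply: tsum_lin; apply: bilin_fg.
split=> //; split; first by rewrite [LHS]stens_lift_pure // f1 g1 mulr1.
move=> x y.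
elim/tens_indh: x => [|x x' hx hx'|m n a b ha hb].
- by rewrite (mul0r (y : stens Om1 Om2)) (lin0 lF) mul0r.
- by rewrite (mulrDl (x : stens Om1 Om2)) !(linD _ _ lF) mulrDl hx hx'.
elim/tens_indh: y => [|y y' hy hy'|m' n' c e hc' he].
- by rewrite (mulr0 (a ⊗ b : stens Om1 Om2)) (lin0 lF) mulr0.
- by rewrite (mulrDr (a ⊗ b : stens Om1 Om2)) !(linD _ _ lF) mulrDr hy hy'.
rewrite [X in stens_lift f g X](stens_mulE a e hb hc') (linZ _ _ lF).
rewrite !stens_lift_pure // fM gM -[RHS]mulrA [g b * (f c * _)]mulrA.
by rewrite (sc _ _ _ _ hc' hb) -scalerAl -scalerAr !mulrA.
Qed.

(** Separate from [stens_lift_hom] because [bicross_map] is a lift whose factors do not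
    supercommute: it is no algebra map on the super tensor product, but must still preserve degree
    and differential. *)
Lemma stens_lift_hc Om1 Om2 Om (f : Om1 -> Om) (g : Om2 -> Om) n w :
  dga_hom f -> dga_hom g -> stens_lift f g (hc n w) = hc n (stens_lift f g w).
Proof.
move=> hf hg; have lf := dga_hom_lin hf; have lg := dga_hom_lin hg.
have lF : linear (stens_lift f g) by apply: tsum_lin; apply: bilin_fg.
elim/tens_indh: w => [|x y hx hy|i j a b ha hb].
- by rewrite !(linear0, lin0 lF).
- by rewrite linearD /= !(linD _ _ lF) hx hy linearD.
rewrite (stens_hcE _ ha hb) stens_lift_pure //.
rewrite (hcK _ (hc_mul (dga_hom_deg hf ha) (dga_hom_deg hg hb))).
by case: ifP => // _; rewrite ?stens_lift_pure // (lin0 lF).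
Qed.

Lemma stens_lift_dd Om1 Om2 Om (f : Om1 -> Om) (g : Om2 -> Om) w :
  dga_hom f -> dga_hom g -> stens_lift f g (dd w) = dd (stens_lift f g w).
Proof.
move=> hf hg; have lf := dga_hom_lin hf; have lg := dga_hom_lin hg.
have [_ _ fd] := hf; have [_ _ gd] := hg.
have lF : linear (stens_lift f g) by apply: tsum_lin; apply: bilin_fg.
elim/tens_indh: w => [|x y hx hy|i j a b ha hb].
- by rewrite !(linear0, lin0 lF).
- by rewrite linearD /= !(linD _ _ lF) hx hy linearD.
rewrite (stens_ddE _ ha) (linD _ _ lF) (linZ _ _ lF) !stens_lift_pure //.
by rewrite (dd_mul _ (dga_hom_deg hf ha)) fd gd.
Qed.

Lemma stens_lift_dga_hom Om1 Om2 Om (f : Om1 -> Om) (g : Om2 -> Om) :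
  dga_hom f -> dga_hom g -> supercommute f g -> dga_hom (stens_lift f g).
Proof.
move=> hf hg sc; have [af _ _] := hf; have [ag _ _] := hg.
split=> [|n w|w]; [exact: stens_lift_hom|exact: stens_lift_hc|exact: stens_lift_dd].
Qed.

Lemma stens_inl_hom A B : dga_hom (fun a : A => a ⊗ 1 : stens A B).
Proof.
have bt := @bilin_tpure K A B.
have h1 := hc_one B.
have la : linear (fun a : A => a ⊗ (1 : B)) by case: bt.
apply: dga_homP.
- split=> //; split=> // x y.
  elim/hc_indh: y => [|u v hu hv|n y hy].
  + by rewrite mulr0 !(lin0 la) mulr0.
  + by rewrite mulrDr !(linD _ _ la) hu hv mulrDr.
  by rewrite [RHS](stens_mulE _ _ h1 hy) mul0n scale1r mulr1.
- by move=> n w hw; rewrite (stens_hcE _ hw h1) addn0 eqxx.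
move=> w; elim/hc_indh: w => [|u v hu hv|n y hy].
- by rewrite !(linear0, lin0 la).
- by rewrite linearD /= !(linD _ _ la) hu hv linearD.
by rewrite (stens_ddE _ hy) dd_one (bilin0r bt) scaler0 addr0.
Qed.

Lemma stens_inr_hom A B : dga_hom (fun b : B => 1 ⊗ b : stens A B).
Proof.
have bt := @bilin_tpure K A B.
have h1 := hc_one A.
have la : linear (fun b : B => (1 : A) ⊗ b) by case: bt.
apply: dga_homP.
- split=> //; split=> // x y.
  elim/hc_indh: x => [|u v hu hv|n x hx].
  + by rewrite mul0r !(lin0 la) mul0r.
  + by rewrite mulrDl !(linD _ _ la) hu hv mulrDl.
  by rewrite [RHS](stens_mulE _ _ hx h1) muln0 scale1r mulr1.
- by move=> n w hw; rewrite (stens_hcE _ h1 hw) eqxx.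
move=> w; rewrite (stens_ddE _ h1) dd_one (bilin0l bt) add0r expr0 scale1r //.
Qed.

Lemma stens_inlr A B (a : A) (b : B) :
  (a ⊗ 1 : stens A B) * (1 ⊗ b) = a ⊗ b.
Proof.
by rewrite (stens_mulE _ _ (hc_one B) (hc_one A)) mul0n scale1r mulr1 mul1r.
Qed.

Lemma stens_inrl A B m n (a : A) (b : B) : hc m a = a -> hc n b = b ->
  (1 ⊗ b : stens A B) * (a ⊗ 1) = (-1) ^+ (n * m) *: (a ⊗ b).
Proof. by move=> ha hb; rewrite (stens_mulE _ _ hb ha) mulr1 mul1r. Qed.

Lemma tmap_stens_lift A B A' B' (f : A -> A') (g : B -> B') (t : stens A B) :
  tmap f g t = stens_lift (fun a => f a ⊗ 1 : stens A' B') (fun b => 1 ⊗ g b) t.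
Proof. by apply: eq_tsum => a b; rewrite stens_inlr. Qed.

Lemma tmap_alg_hom A B A' B' (f : A -> A') (g : B -> B') : alg_hom f -> alg_hom g ->
  (forall n a, hc n a = a -> hc n (f a) = f a) ->
  (forall n b, hc n b = b -> hc n (g b) = g b) ->
  alg_hom (tmap f g : stens A B -> stens A' B').
Proof.
move=> hf hg df dg; have -> : tmap f g =
    stens_lift (fun a => f a ⊗ 1 : stens A' B') (fun b => 1 ⊗ g b).
  by apply/funext => t; apply: tmap_stens_lift.
have [hl _ _] := stens_inl_hom A' B'; have [hr _ _] := stens_inr_hom A' B'.
apply: stens_lift_hom.
- exact: alg_hom_comp hf hl.
- exact: alg_hom_comp hg hr.
move=> m n a b ha hb.
by rewrite (stens_inrl (df _ _ ha) (dg _ _ hb)) stens_inlr.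
Qed.

Lemma tmap_hom A B A' B' (f : A -> A') (g : B -> B') : dga_hom f -> dga_hom g ->
  dga_hom (tmap f g : stens A B -> stens A' B').
Proof.
move=> hf hg; have -> : tmap f g =
    stens_lift (fun a => f a ⊗ 1 : stens A' B') (fun b => 1 ⊗ g b).
  by apply/funext => t; apply: tmap_stens_lift.
apply: stens_lift_dga_hom.
- exact: dga_hom_comp hf (stens_inl_hom _ _).
- exact: dga_hom_comp hg (stens_inr_hom _ _).
move=> m n a b ha hb.
by rewrite (stens_inrl (dga_hom_deg hf ha) (dga_hom_deg hg hb)) stens_inlr.
Qed.

Lemma scalar_hom A (B : algType K) (eps : A -> K^o) : @dga_hom K A (triv K^o) eps ->
  @alg_hom K A B (fun a => (eps a)%:A).
Proof.
move=> he; have [[le [e1 eM]] _ _] := he; split; last split.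
- by move=> c x y; rewrite le scalerDl scalerA.
- by rewrite [eps 1]e1 scale1r.
by move=> x y; rewrite [eps _]eM -scalerAl mul1r scalerA.
Qed.

Lemma counit_pos A (eps : A -> K^o) n a : @dga_hom K A (triv K^o) eps ->
  hc n.+1 a = a -> eps a = 0.
Proof. by move=> [_ eh _] ha; rewrite -ha eh. Qed.

Lemma scalar_dga_hom A B (eps : A -> K^o) : @dga_hom K A (triv K^o) eps ->
  @dga_hom K A B (fun a => (eps a)%:A).
Proof.
move=> he; have [_ eh ed] := he; apply: dga_homP; first exact: scalar_hom.
- case=> [|n] w hw; first by rewrite linearZ /= hc_one.
  by rewrite (counit_pos he hw) scale0r linear0.
by move=> w; rewrite [eps _]ed linearZ /= dd_one scaler0 scale0r.
Qed.

Lemma counitl_hom A B (eps : A -> K^o) : @dga_hom K A (triv K^o) eps ->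
  @dga_hom K (stens A B) B (tsum (fun a b => eps a *: b)).
Proof.
move=> he; have -> : tsum (fun a b => eps a *: b) =
   stens_lift (fun a => (eps a)%:A : B) id.
  by apply/funext => t; apply: eq_tsum => a b; rewrite mulr_algl.
apply: stens_lift_dga_hom; [exact: scalar_dga_hom|exact: dga_hom_id|].
(* The counit kills positive degrees, so scalars appear only where the Koszul sign is 1. *)
case=> [|m] n a b ha hb; first by rewrite muln0 scale1r mulr_algr mulr_algl.
by rewrite (counit_pos he ha) scale0r mul0r mulr0 scaler0.
Qed.

Lemma counitr_hom A B (eps : B -> K^o) : @dga_hom K B (triv K^o) eps ->
  @dga_hom K (stens A B) A (tsum (fun a b => eps b *: a)).
Proof.
move=> he; have -> : tsum (fun a b => eps b *: a) =
   stens_lift id (fun a => (eps a)%:A : A).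
  by apply/funext => t; apply: eq_tsum => a b; rewrite mulr_algr.
apply: stens_lift_dga_hom; [exact: dga_hom_id|exact: scalar_dga_hom|].
move=> m [|n] a b ha hb; first by rewrite mul0n scale1r mulr_algr mulr_algl.
by rewrite (counit_pos he hb) scale0r mul0r mulr0 scaler0.
Qed.

(** Rebracketing is built as a lift so as to be a DGA map. Coassociativity then becomes an equality
    of two DGA maps, decided on generators, and [tassoc_tmap] translates it back to iterated
    sums. *)
Definition tassoc A B C : stens (stens A B) C -> stens A (stens B C) :=
  @stens_lift (stens A B) C (stens A (stens B C))
    (@tmap K A B A (stens B C) id (fun b => b ⊗ 1))
    (fun c => 1 ⊗ (1 ⊗ c : stens B C)).

Lemma tassoc_hom A B C : dga_hom (@tassoc A B C).
Proof.
have hl := tmap_hom (dga_hom_id A) (stens_inl_hom B C).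
have hr := dga_hom_comp (stens_inr_hom B C) (stens_inr_hom A (stens B C)).
apply: stens_lift_dga_hom => // m n t c ht hc'; rewrite -ht.
elim/tens_indh: t {ht} => [|x y hx hy|i j a b ha hb].
- by rewrite linear0 (lin0 (dga_hom_lin hl)) mul0r mulr0 scaler0.
- by rewrite linearD /= (linD _ _ (dga_hom_lin hl)) mulrDl mulrDr scalerDr hx hy.
rewrite (stens_hcE _ ha hb); case: eqP => [->|_]; last first.
  by rewrite (lin0 (dga_hom_lin hl)) mul0r mulr0 scaler0.
rewrite tmap_pure //; last exact: dga_hom_lin (stens_inl_hom B C).
have h1c : hc n (1 ⊗ c : stens B C) = 1 ⊗ c.
  by rewrite (stens_hcE _ (hc_one B) hc') eqxx.
have hb1 : hc j (b ⊗ 1 : stens B C) = b ⊗ 1.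
  by rewrite (stens_hcE _ hb (hc_one C)) addn0 eqxx.
rewrite (stens_mulE _ _ h1c ha) (stens_mulE _ _ hb1 (hc_one A)) muln0 scale1r.
rewrite (stens_inrl hb hc') stens_inlr mul1r mulr1.
by rewrite (bilinZr (@bilin_tpure _ _ _)) scalerA -exprD mulnDr.
Qed.

Lemma tassoc_pure A B C (a : A) (b : B) (c : C) :
  tassoc ((a ⊗ b : stens A B) ⊗ c) = a ⊗ (b ⊗ c).
Proof.
have lb := dga_hom_lin (stens_inl_hom B C).
have hl := tmap_hom (dga_hom_id A) (stens_inl_hom B C).
have hr := dga_hom_comp (stens_inr_hom B C) (stens_inr_hom A (stens B C)).
rewrite /tassoc stens_lift_pure; [|exact: dga_hom_lin hl|exact: dga_hom_lin hr].
rewrite tmap_pure //.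
have bt := @bilin_tpure K B C; have bt' := @bilin_tpure K A (stens B C).
elim/hc_indh: b => [|u v hu hv|j b hb].
- by rewrite !(bilin0l bt) !(bilin0r bt') mul0r.
- by rewrite !(bilinDl bt) !(bilinDr bt') mulrDl hu hv.
have hbb : hc j (b ⊗ 1 : stens B C) = b ⊗ 1.
  by rewrite (stens_hcE _ hb (hc_one C)) addn0 eqxx.
by rewrite (stens_mulE _ _ hbb (hc_one A)) muln0 scale1r stens_inlr mulr1.
Qed.

Lemma tassoc_tmap A B C Om (f : Om -> stens A B) (t : stens Om C) :
  tassoc (tmap f id t : stens (stens A B) C) =
  tsum (fun x c => tsum (fun a b => a ⊗ (b ⊗ c)) (f x)) t.
Proof.
rewrite (lin_tsum _ _ (dga_hom_lin (@tassoc_hom A B C))); apply: eq_tsum => x c.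
rewrite [f x in LHS]tensE.
rewrite (lin_tsum (f := fun y : stens A B => tassoc (y ⊗ c))).
  by apply: eq_tsum => a b; apply: tassoc_pure.
move=> k y z; rewrite ((bilin_tpure _ _).1 c k y z).
exact: (dga_hom_lin (@tassoc_hom A B C)).
Qed.
End TensorLift.

(** * Relations of the calculus *)

Section PresentedDgaMaps.
Variables (K : fieldType) (X : Type) (rels : drels K X).
Variable model : exists (Om : dga K) (x : X -> Om), dsat rels x.
Local Notation P := (pdga model).
Local Notation gen := (dgen model).

Lemma dga_lift_hom (Om : dga K) (x : X -> Om) : dsat rels x ->
  @dga_hom K P Om (dga_lift x).
Proof.
move=> hx; split; last by move=> w; apply: dga_lift_dd.
  split; first exact: dga_lift_lin.
  by split=> [|a b]; [apply: dga_lift_one|apply: dga_lift_mul].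
by move=> n w; apply: dga_lift_hc.
Qed.

Lemma pdga_hom_ext (Om : dga K) (f f' : P -> Om) : dga_hom f -> dga_hom f' ->
  (forall j, f (gen j) = f' (gen j)) -> f =1 f'.
Proof.
move=> [/alg_homP[fD fZ fM f1 f0] fh fd] [/alg_homP[gD gZ gM g1 g0] gh gd] e.
apply: pdga_ind => //.
- by move=> c; rewrite fZ gZ f1 g1.
- by move=> a b ha hb; rewrite fD gD ha hb.
- by move=> a b ha hb; rewrite fM gM ha hb.
- by move=> n a ha; rewrite fh gh ha.
- by move=> a ha; rewrite fd gd ha.
Qed.

(** Removes the component and differential steps from [pdga_ind]: the generators and their
    differentials already generate the presented DGA as an algebra. *)
Lemma pdga_alg_ind (Q : P -> Prop) : (forall j, Q (gen j)) ->
  (forall j, Q (dd (gen j))) -> (forall c, Q c%:A) ->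
  (forall a b, Q a -> Q b -> Q (a + b)) ->
  (forall a b, Q a -> Q b -> Q (a * b)) -> forall a, Q a.
Proof.
move=> Qg Qd Qs QD QM.
have Q0 : Q 0 by rewrite -(scale0r (1 : P)); apply: Qs.
have QZ c a : Q a -> Q (c *: a) by move=> Qa; rewrite -mulr_algl; apply: QM.
have Qsum n (F : 'I_n -> P) : (forall i, Q (F i)) -> Q (\sum_i F i).
  by move=> QF; apply: big_ind.
(* Every component and its differential are treated at once: products then follow from Leibniz,
   components from idempotency, and differentials from d d = 0. *)
suff H a : forall n, Q (hc n a) /\ Q (dd (hc n a)).
  by move=> a; rewrite (hboundP a); apply: Qsum => i; case: (H a i).
elim/pdga_ind: a => [j|c|a b ha hb|a b ha hb|m a ha|a ha] n.
- rewrite (hcK _ (dgen_deg _ _)); case: ifP => _; first by split.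
  by rewrite linear0.
- rewrite linearZ /= (hcK _ (hc_one _)); case: ifP => _.
    by rewrite linearZ /= dd_one scaler0; split.
  by rewrite scaler0 linear0.
- rewrite !linearD /=; have [? ?] := ha n; have [? ?] := hb n.
  by split; apply: QD.
- rewrite hc_mulE linear_sum; split; apply: Qsum => i /=.
    by apply: QM; [apply: (ha i).1|apply: (hb _).1].
  rewrite (dd_mul _ (hc_idem i a)); apply: QD; last apply: QZ; apply: QM.
  - exact: (ha i).2.
  - exact: (hb _).1.
  - exact: (ha i).1.
  exact: (hb _).2.
- by rewrite hc_hc; case: ifP => // _; rewrite linear0.
case: n => [|n]; first by rewrite hc_dd0 linear0.
by rewrite hc_ddC dd_dd; split=> //; apply: (ha n).2.
Qed.
End PresentedDgaMaps.

Lemma addself_inj (K : fieldType) (V : lmodType K) (u v : V) :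
  (2%:R : K) != 0 -> u + u = v + v -> u = v.
Proof. by move=> h e; apply: (scalerI h); rewrite !scaler_nat !mulr2n. Qed.

(** Differentiating [p, dp] = lam dp leaves 2 (dp)^2 = 0. *)
Lemma line_square (K : fieldType) (lam : K) (Om : dga K) (p : Om) :
  (2%:R : K) != 0 -> hc 0 p = p -> lie p (dd p) = lam *: dd p -> dd p * dd p = 0.
Proof.
move=> char2 hp rel_pp; apply: (addself_inj char2).
have := congr1 dd rel_pp; rewrite /lie linearB linearZ /=.
rewrite (dd_mul _ (hc_dd hp)) (dd_mul _ hp) dd_dd mul0r mulr0 !scaler0 addr0 add0r.
by rewrite expr1 scaleN1r opprK => h; rewrite addr0.
Qed.

Section PlanckForms.
Variables (K : fieldType) (lam : K).
Hypothesis char2 : (2%:R : K) != 0.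

Definition planck_gens (T : Type) (g ginv p : T) (j : planck_gen) : T :=
  match j with Pg => g | Pginv => ginv | Pp => p end.

Definition form_gens (Om : dga K) (g ginv p : Om) (j : omega_gen) : Om :=
  match j with
  | Og => g | Oginv => ginv | Op => p | Odg => dd g | Odp => dd p
  end.

Section Relations.
Variables (Om : dga K) (g ginv p : Om).
Hypotheses (hg : hc 0 g = g) (hp : hc 0 p = p).
Hypothesis rel0 : planck_rels lam (planck_gens g ginv p).
Hypothesis rel_gg : lie (dd g) g = 0.
Hypothesis rel_pp : lie p (dd p) = lam *: dd p.

(** This is the differential of [p, g] = lam (1 - g) g, with dg moved past g by [rel_gg]. *)
Lemma lie_dd_sub : lie p (dd g) - lie g (dd p) =
  lam *: dd g - (lam *: (g * dd g) + lam *: (g * dd g)).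
Proof.
have [_ _ r3] := rel0; rewrite /= in r3.
have cg : dd g * g = g * dd g by apply/eqP; rewrite -subr_eq0; apply/eqP.
have := congr1 dd r3.
rewrite /lie linearB linearZ /= mulrBl mul1r linearB /= !(dd_mul _ hg) !(dd_mul _ hp).
rewrite !expr0 !scale1r cg scalerBr scalerDr => <-.
by rewrite !opprB !opprD !addrA [LHS](AC 4 (3*1*2*4)).
Qed.

(** The coaction supplies only the sum of the two commutators. With their difference from
    [lie_dd_sub], halving determines each; differentiating [dg, g] = 0 and [g, dp] = lam g dg then
    gives the relations in degree 2. *)
Lemma omega_rels_of_sum : lie p (dd g) + lie g (dd p) = lam *: dd g ->
  omega_rels lam (form_gens g ginv p).
Proof.
move=> rel_pg; have [r1 r2 r3] := rel0; rewrite /= in r1 r2 r3.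
have cg : dd g * g = g * dd g by apply/eqP; rewrite -subr_eq0; apply/eqP.
have e1 : lie p (dd g) = lam *: ((1 - g) * dd g).
  apply: (addself_inj char2); rewrite mulrBl mul1r scalerBr.
  transitivity ((lie p (dd g) + lie g (dd p)) + (lie p (dd g) - lie g (dd p))).
    by rewrite [RHS]addrACA subrr addr0.
  rewrite rel_pg lie_dd_sub.
  by linear_ring.
have e2 : lie g (dd p) = lam *: (g * dd g).
  apply: (addrI (lie p (dd g))); rewrite rel_pg e1 -scalerDr mulrBl mul1r.
  by rewrite subrK.
have dg2 : dd g * dd g = 0.
  apply: (addself_inj char2); have := congr1 dd rel_gg; rewrite /lie linearB linear0 /=.
  rewrite (dd_mul _ (hc_dd hg)) (dd_mul _ hg) dd_dd mul0r mulr0 scaler0 addr0 add0r.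
  rewrite expr1 scaleN1r => h; apply/eqP.
  by rewrite addr0 -oppr_eq0 opprD h.
have dp2 := line_square char2 hp rel_pp.
split; split=> //=.
have := congr1 dd e2; rewrite /lie linearB linearZ /=.
rewrite (dd_mul _ (hc_dd hp)) !(dd_mul _ hg) !dd_dd mul0r mulr0 !scaler0 addr0 add0r.
rewrite expr1 scaleN1r opprK dg2 addr0 scaler0 => /eqP.
by rewrite addrC addr_eq0 => /eqP.
Qed.

(** Variant for the images of the generators under the coproduct and the antipode, where [p, dg] is
    easier to compute than the sum. *)
Lemma omega_rels_of_pdg : lie p (dd g) = lam *: ((1 - g) * dd g) ->
  omega_rels lam (form_gens g ginv p).
Proof.
move=> rel_pg; apply: omega_rels_of_sum.
have -> : lie g (dd p) = lie p (dd g) - (lie p (dd g) - lie g (dd p)).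
  by rewrite opprB addrC subrK.
rewrite lie_dd_sub rel_pg mulrBl mul1r.
by linear_ring.
Qed.
End Relations.

(** Interface between the construction and its uses. The presentation is as an algebra, not as a
    DGA, so that it also yields maps into algebras without differential; [calc_lift] recovers DGA
    maps from it. *)
Record planck_calculus (Om : dga K) (g ginv p : Om) : Prop := PlanckCalculus {
  pc_g : hc 0 g = g; pc_ginv : hc 0 ginv = ginv; pc_p : hc 0 p = p;
  pc_pres : presented (omega_rels lam) (form_gens g ginv p);
  pc_ind : forall P : Om -> Prop, (forall j, P (form_gens g ginv p j)) ->
    (forall c, P c%:A) -> (forall a b, P a -> P b -> P (a + b)) ->
    (forall a b, P a -> P b -> P (a * b)) -> forall a, P a }.
End PlanckForms.

Lemma triv_hom (K : fieldType) (A B : algType K) (f : A -> B) : alg_hom f ->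
  @dga_hom K (triv A) (triv B) f.
Proof.
move=> hf; have [_ _ _ _ f0] := alg_homP hf.
by split=> // -[|n] w //; rewrite f0.
Qed.

Section PresentedAlgMaps.
Variables (K : fieldType) (X : Type) (rels : arels K X).
Variable model : exists (B : algType K) (x : X -> B), rels x.

Lemma plift_hom (B : algType K) (x : X -> B) : rels x ->
  @alg_hom K (palg model) B (plift x).
Proof.
move=> hx; split; first exact: plift_lin.
by split=> [|a b]; [apply: plift_one|apply: plift_mul].
Qed.

Lemma palg_hom_ext (B : algType K) (f f' : palg model -> B) :
  alg_hom f -> alg_hom f' -> (forall j, f (pgen model j) = f' (pgen model j)) ->
  f =1 f'.
Proof.
move=> /alg_homP[fD fZ fM f1 f0] /alg_homP[gD gZ gM g1 g0] e.
apply: palg_ind => //.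
- by move=> c; rewrite fZ gZ f1 g1.
- by move=> a b ha hb; rewrite fD gD ha hb.
by move=> a b ha hb; rewrite fM gM ha hb.
Qed.
End PresentedAlgMaps.

Section OmegaRels.
Variables (K : fieldType) (lam : K).

Lemma omega_rels_hom (A B : algType K) (f : A -> B) x : alg_hom f ->
  omega_rels lam x -> omega_rels lam (fun j => f (x j)).
Proof.
move=> hf [[a1 a2 a3] [b1 b2 b3 b4] [c1 c2 c3]].
have [fD fZ fM f1 f0] := alg_homP hf.
split; split; rewrite -?(alg_hom_lie _ _ hf) -?fM ?a1 ?a2 ?a3 ?b1 ?b2 ?b3 ?b4 ?c1 ?c2 ?c3
  ?fZ ?fM ?(alg_homB _ _ hf) ?(alg_homN _ hf) ?f1 ?fM //.
Qed.

Definition form_deg (j : omega_gen) : nat :=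
  match j with Odg | Odp => 1 | _ => 0 end.

(* Rescaling the one-forms by a central [t] preserves the relations; [t = 0]
   kills the forms, [t = -1] is the parity, and an indeterminate [t] records
   the degree. *)
Lemma omega_rels_scale (A : algType K) (t : A) x : (forall a, t * a = a * t) ->
  omega_rels lam x -> omega_rels lam (fun j => t ^+ form_deg j * x j).
Proof.
move=> ct [[a1 a2 a3] [b1 b2 b3 b4] [c1 c2 c3]].
have tl u v : lie u (t * v) = t * lie u v.
  by rewrite /lie !mulrBr !mulrA -ct.
have tr u v : lie (t * u) v = t * lie u v.
  by rewrite /lie !mulrBr !mulrA -[v * t]ct.
have tt u v : t * u * (t * v) = t * t * (u * v).
  by rewrite !mulrA -[t * u * t]mulrA -[u * t]ct !mulrA.
split; split; rewrite /= ?expr0 ?expr1 ?mul1r ?tl ?tr ?tt ?a1 ?a2 ?a3 ?b1 ?b2 ?b3 ?b4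
  ?c1 ?c2 ?c3 ?mulr0 ?mulrN //.
- by rewrite -scalerAr.
- by rewrite -scalerAr !mulrA ct.
by rewrite -scalerAr !mulrA ct.
Qed.

Fact omega_model : exists (B : algType K) (x : omega_gen -> B), omega_rels lam x.
Proof.
exists K^o, (fun j => match j with Og | Oginv => 1 | _ => 0 end).
by split; split; rewrite /lie ?mulr1 ?mul1r ?subrr ?mul0r ?mulr0 ?subrr ?scaler0
  ?subr0 ?oppr0.
Qed.

Local Notation P := (palg omega_model).
Local Notation x := (pgen omega_model).

Lemma omega_gen_rels : omega_rels lam x.
Proof.
by split; split; apply: palg_ext => B y hy; have [[? ? ?] [? ? ? ?] [? ? ?]] := hy;
  rewrite /lie ?(pliftB, pliftZ, plift_mul, plift_gen, plift_one) //
   -?scaleN1r -?[0 in RHS](scale0r (1 : P)) ?pliftZ ?plift_mul ?plift_gen //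
   ?scaleN1r ?scale0r.
Qed.
End OmegaRels.

(** * Grading and differential of the presented algebra *)

(* The operators (a, b) |-> (u a, v a + s(u) b); their products obey the
   Leibniz rule v u' + s(u) v' twisted by s. *)
Section TwistedDual.
Variables (K : fieldType) (A : algType K) (s : A -> A).
Hypothesis hs : alg_hom s.

Fact twist_lin (u v : A) :
  linear (fun ab : (A * A)%type => (u * ab.1, v * ab.1 + s u * ab.2)).
Proof.
move=> c [a b] [a' b'] /=; apply/pair_equal_spec; split=> /=.
  by rewrite mulrDr scalerAr.
by rewrite !mulrDr scalerDr !scalerAr addrACA.
Qed.

Definition twist (u v : A) : lend (A * A)%type := Lend (twist_lin u v).

Lemma twistD u v u' v' : twist u v + twist u' v' = twist (u + u') (v + v').
Proof.
have [sD _ _ _ _] := alg_homP hs.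
apply: lendP => -[a b]; rewrite lendD /= sD; apply/pair_equal_spec => /=.
by rewrite !mulrDl addrACA.
Qed.
Lemma twistM u v u' v' : twist u v * twist u' v' = twist (u * u') (v * u' + s u * v').
Proof.
have [_ _ sM _ _] := alg_homP hs.
apply: lendP => -[a b]; rewrite lendM /= sM; apply/pair_equal_spec => /=.
by rewrite mulrDr mulrDl !mulrA addrA.
Qed.
Lemma twistZ c u v : c *: twist u v = twist (c *: u) (c *: v).
Proof.
have [_ sZ _ _ _] := alg_homP hs.
apply: lendP => -[a b]; rewrite lendZ /= sZ; apply/pair_equal_spec => /=.
by rewrite scalerDr !scalerAl.
Qed.
Lemma twist1 : twist 1 0 = 1.
Proof.
have [_ _ _ s1 _] := alg_homP hs.
apply: lendP => -[a b]; rewrite lend1 /= s1; apply/pair_equal_spec => /=.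
by rewrite !mul1r mul0r add0r.
Qed.
Lemma twistN u v : - twist u v = twist (- u) (- v).
Proof. by rewrite -scaleN1r twistZ !scaleN1r. Qed.
Lemma twist0 : twist 0 0 = 0.
Proof. by have := twistZ 0 0 0; rewrite scaler0 scale0r. Qed.
End TwistedDual.

Section Construction.
Variables (K : fieldType) (lam : K).

Let P := palg (omega_model lam).
Let x := pgen (omega_model lam).
Let g := x Og.
Let ginv := x Oginv.
Let p := x Op.
Let dg := x Odg.
Let dp := x Odp.

Let hx : omega_rels lam x := omega_gen_rels lam.

(** The polynomial algebra P[X]. Both factors sit in degree 0, so no signs appear and X is
    central. *)
Let G := stens (triv P) (triv {poly K}).
Let XG : G := 1 ⊗ 'X.

Fact XG_central (a : G) : XG * a = a * XG.
Proof.
elim/tens_ind: a => [|a b ha hb|v w]; first by rewrite mul0r mulr0.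
  by rewrite mulrDl mulrDr ha hb.
by rewrite !triv_stens_mulE mul1r mulr1 mulrC.
Qed.

Let gamx j : G := XG ^+ form_deg j * ((x j : triv P) ⊗ (1 : triv {poly K})).
Fact gamx_rels : omega_rels lam gamx.
Proof.
have [h _ _] := stens_inl_hom (triv P) (triv {poly K}).
exact: omega_rels_scale XG_central (omega_rels_hom h hx).
Qed.

(* The element w of degree n goes to w ⊗ X^n. *)
Definition grade : P -> G := plift gamx.
Let grade_hom : alg_hom grade := plift_hom (omega_model lam) gamx_rels.

Definition homog n (w : P) : Prop := grade w = (w : triv P) ⊗ ('X^n : triv {poly K}).

Let sgn : P := -1.
Let sgn_central (a : P) : sgn * a = a * sgn.
Proof. by rewrite mulN1r mulrN1. Qed.
Definition sigma : P -> P := plift (fun j => sgn ^+ form_deg j * x j).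
Let sigma_hom : alg_hom sigma :=
  plift_hom (omega_model lam) (omega_rels_scale sgn_central hx).

Let sigE j : sigma (x j) = sgn ^+ form_deg j * x j.
Proof. by rewrite /sigma plift_gen //; apply: omega_rels_scale. Qed.

(** The intended values of d on generators; the one at [ginv] is forced by d(g g^-1) = 0. *)
Let delta (j : omega_gen) : P :=
  match j with Og => dg | Oginv => - (ginv * dg * ginv) | Op => dp | _ => 0 end.

Let hT := (twistD sigma_hom, twistM sigma_hom, twistZ sigma_hom, twistN sigma_hom).

(** The off-diagonal entry of each relation is that relation differentiated, so the point is that
    the relations are closed under formal differentiation. *)
Fact twist_rels : omega_rels lam (fun j => twist sigma (x j) (delta j)).
Proof.
have [[a1 a2 a3] [b1 b2 b3 b4] [c1 c2 c3]] := hx.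
have sg : sigma g = g by rewrite sigE mul1r.
have sgi : sigma ginv = ginv by rewrite sigE mul1r.
have sp : sigma p = p by rewrite sigE mul1r.
have sdg : sigma dg = - dg by rewrite sigE expr1 mulN1r.
have sdp : sigma dp = - dp by rewrite sigE expr1 mulN1r.
have s1g : sigma (1 - g) = 1 - g.
  by have [_ _ _ s1 _] := alg_homP sigma_hom; rewrite (alg_homB _ _ sigma_hom) s1 sg.
have cg : dg * g = g * dg by apply/eqP; rewrite -subr_eq0; apply/eqP.
rewrite -/g -/ginv -/p -/dg -/dp in a1 a2 a3 b1 b2 b3 b4 c1 c2 c3.
split; split; rewrite /= -/g -/ginv -/p -/dg -/dp /lie;
  rewrite -?(twist1 sigma_hom) -?(twist0 sigma_hom) !hT ?s1g ?sg ?sgi ?sp ?sdg ?sdp;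
  apply: (@f_equal2 _ _ _ (twist sigma)) => //; rewrite ?mul0r ?mulr0 ?addr0 ?add0r ?sub0r.
- by rewrite mulrN !mulrA a1 mul1r subrr.
- by rewrite mulNr -!mulrA a2 mulr1 addNr.
(* The differentiated relation [p, g] = lam (1 - g) g constrains the difference of [p, dg] and
   [g, dp]; the two prescribed values are compatible with it. *)
- have e1 : p * dg = dg * p + lam *: ((1 - g) * dg) by rewrite -b4 addrC subrK.
  have e2 : dp * g = g * dp - lam *: (g * dg).
    by rewrite -b3 opprB addrC subrK.
  rewrite e1 e2 mulNr cg mulrBl mul1r.
  by linear_ring.
- by rewrite !mulNr c2 oppr0 addr0.
- by rewrite mulNr c1 oppr0 subr0 scaler0.
- by rewrite c2 scaler0 mulNr opprK c3 addrN.
- by rewrite !mulNr opprK c2 oppr0 scaler0 c3 addNr.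
- by [].
- by [].
by rewrite oppr0.
Qed.

Let R : P -> lend (P * P)%type := plift (fun j => twist sigma (x j) (delta j)).
Let R_hom : alg_hom R := plift_hom (omega_model lam) twist_rels.

Definition pdiff (w : P) : P := (R w (1, 0)).2.

(** The image of [R] consists of twisted triangular operators with diagonal entries w and [sigma w].
    Multiplicativity of [R], read in the off-diagonal entry, is therefore the twisted Leibniz
    rule. *)
Lemma R_twist w : R w = twist sigma w (pdiff w).
Proof.
suff [v hv] : exists v, R w = twist sigma w v.
  by rewrite /pdiff hv /= mulr1 mulr0 addr0.
have [RD RZ RM R1 R0] := alg_homP R_hom.
elim/palg_ind: w => [j|c|a b [u hu] [v hv]|a b [u hu] [v hv]].
- by exists (delta j); rewrite /R plift_gen //; apply: twist_rels.
- by exists 0; rewrite RZ R1 -(twist1 sigma_hom) hT scaler0.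
- by exists (u + v); rewrite RD hu hv hT.
by exists (u * b + sigma a * v); rewrite RM hu hv hT.
Qed.

Lemma pdiff_mul a b : pdiff (a * b) = pdiff a * b + sigma a * pdiff b.
Proof.
have [_ _ RM _ _] := alg_homP R_hom.
by rewrite {1}/pdiff RM !R_twist hT /= !mulr1 mulr0 addr0.
Qed.

Lemma pdiff_lin : linear pdiff.
Proof.
have [RD RZ RM R1 R0] := alg_homP R_hom.
by move=> c a b; rewrite {1}/pdiff RD RZ lendD lendZ.
Qed.

Lemma pdiff_gen j : pdiff (x j) = delta j.
Proof.
rewrite /pdiff /R plift_gen; last exact: twist_rels.
by rewrite /= mulr1 mulr0 addr0.
Qed.

Lemma pdiff1 : pdiff 1 = 0.
Proof.
have [RD RZ RM R1 R0] := alg_homP R_hom.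
by rewrite /pdiff R1.
Qed.

Let bt := @bilin_tpure K (triv P) (triv {poly K}).

Lemma homogD n a b : homog n a -> homog n b -> homog n (a + b).
Proof.
have [gD _ _ _ _] := alg_homP grade_hom.
by rewrite /homog gD => -> ->; rewrite (bilinDl bt).
Qed.
Lemma homogZ n c a : homog n a -> homog n (c *: a).
Proof.
have [_ gZ _ _ _] := alg_homP grade_hom.
by rewrite /homog gZ => ->; rewrite (bilinZl bt).
Qed.
Lemma homog0 n : homog n 0.
Proof.
have [_ _ _ _ g0] := alg_homP grade_hom.
by rewrite /homog g0 (bilin0l bt).
Qed.
Lemma homog1 : homog 0 1.
Proof. by have [_ _ _ g1 _] := alg_homP grade_hom; rewrite /homog g1. Qed.
Lemma homogM m n a b : homog m a -> homog n b -> homog (m + n) (a * b).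
Proof.
have [_ _ gM _ _] := alg_homP grade_hom.
by rewrite /homog gM => -> ->; rewrite triv_stens_mulE exprD.
Qed.
Lemma homog_gen j : homog (form_deg j) (x j).
Proof.
rewrite /homog /grade plift_gen; last exact: gamx_rels.
rewrite /gamx; case: j => /=; rewrite ?expr0 ?expr1 ?mul1r //.
- by rewrite triv_stens_mulE mulr1 mul1r.
- by rewrite triv_stens_mulE mulr1 mul1r.
Qed.

Lemma homog_delta j : homog (form_deg j).+1 (delta j).
Proof.
case: j => /=; rewrite ?/delta; [|rewrite -scaleN1r; apply: homogZ| | |];
  try exact: homog0.
- exact: (homog_gen Odg).
- by apply: (@homogM 1 0); [apply: (@homogM 0 1)|]; apply: homog_gen.
exact: (homog_gen Odp).
Qed.

(** [sigma] is [grade] evaluated at X = -1. This turns the twisted Leibniz rule into the graded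
    one. *)
Lemma homog_sigma n a : homog n a -> sigma a = (-1) ^+ n *: a.
Proof.
pose ev (q : {poly K}) : K^o := q.[-1].
have hev : @dga_hom K (triv {poly K}) (triv K^o) ev.
  apply: triv_hom; split; first by move=> c q r; rewrite /ev hornerD hornerZ.
  by split=> [|q r]; rewrite /ev ?hornerC ?hornerM.
have [h _ _] := counitr_hom (triv P) hev.
have e : sigma =1 fun w => tsum (fun a q => ev q *: a) (grade w).
  apply: palg_hom_ext sigma_hom (alg_hom_comp grade_hom h) _ => j.
  have [_ _ _ _ _] := alg_homP h.
  rewrite homog_gen tsum_pure; last first.
    have bs := @bilin_scale K P.
    by split=> [w|v] c u u'; [apply: bs.2|rewrite /ev hornerD hornerZ; apply: bs.1].
  rewrite sigE /ev hornerXn; case: j => /=;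
    by rewrite ?expr0 ?expr1 ?mul1r ?scale1r ?mulN1r ?scaleN1r.
move=> ha; rewrite e ha tsum_pure ?/ev ?hornerXn //.
have bs := @bilin_scale K P.
by split=> [w|v] c u u'; [apply: bs.2|rewrite /ev hornerD hornerZ; apply: bs.1].
Qed.

(** Decomposes an element into homogeneous pieces whose differentials are homogeneous of the next
    degree. Carrying the second condition through the induction is what shows that [pdiff] raises
    the degree by one. *)
Lemma homog_ind (Q : P -> Prop) : (forall a b, Q a -> Q b -> Q (a + b)) ->
  (forall n a, homog n a -> homog n.+1 (pdiff a) -> Q a) -> forall a, Q a.
Proof.
move=> QD Qh a; move: Q QD Qh.
elim/palg_ind: a => [j|c|a b ha hb|a b ha hb] Q QD Qh.
- by apply: (Qh (form_deg j)); [apply: homog_gen|rewrite pdiff_gen; apply: homog_delta].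
- apply: (Qh 0); first exact: homogZ homog1.
  by rewrite (linZ _ _ pdiff_lin) pdiff1 scaler0; apply: homog0.
- by apply: (QD); [apply: (ha)|apply: (hb)].
apply: (ha (fun a => Q (a * b))) => [u v|m u hu hdu]; first by rewrite mulrDl; apply: QD.
apply: (hb (fun b => Q (u * b))) => [v w|n v hv hdv]; first by rewrite mulrDr; apply: QD.
apply: (Qh (m + n)%N); first exact: homogM.
rewrite pdiff_mul (homog_sigma hu) -scalerAl; apply: homogD; first exact: (@homogM m.+1).
by apply: homogZ; rewrite -addnS; apply: homogM.
Qed.

Definition phc n (w : P) : P := tsum (fun a (q : {poly K}) => q`_n *: a) (grade w).

Let bl_coef n : @bilin K (triv P) (triv {poly K}) P (fun a (q : {poly K}) => q`_n *: a).
Proof.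
have bs := @bilin_scale K P.
split=> [w|v] c u u'; first exact: bs.2.
by rewrite coefD coefZ; apply: bs.1.
Qed.

Lemma phc_lin n : linear (phc n).
Proof.
have [lg _] := grade_hom.
by move=> c a b; rewrite /phc lg (tsum_lin (bl_coef n)).
Qed.

Lemma phc_homog m n w : homog n w -> phc m w = if m == n then w else 0.
Proof.
move=> hw; rewrite /phc hw tsum_pure; last exact: bl_coef.
by rewrite coefXn; case: ifP; rewrite ?scale1r ?scale0r.
Qed.

Lemma homog_phc n w : homog n (phc n w).
Proof.
elim/homog_ind: w => [a b ha hb|m a ha _].
  by rewrite (linD _ _ (phc_lin n)); apply: homogD.
by rewrite (phc_homog _ ha); case: eqP => [->|_] //; apply: homog0.
Qed.

Lemma homog_of_phc n w : phc n w = w -> homog n w.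
Proof. by move=> <-; apply: homog_phc. Qed.

Lemma homog_pdiff n w : homog n.+1 (pdiff (phc n w)).
Proof.
elim/homog_ind: w => [a b ha hb|m a ha hda].
  by rewrite (linD _ _ (phc_lin n)) (linD _ _ pdiff_lin); apply: homogD.
rewrite (phc_homog _ ha); case: eqP => [->|_] //.
by rewrite (lin0 pdiff_lin); apply: homog0.
Qed.

Fact of_hc_hc m n w : phc m (phc n w) = if m == n then phc n w else 0.
Proof. exact: phc_homog (homog_phc n w). Qed.
Fact of_hc_sum w : exists N : nat, w = \sum_(i < N) phc i w.
Proof.
suff [N hN] : exists N : nat, forall M, (N <= M)%N -> w = \sum_(i < M) phc i w.
  by exists N; apply: hN.
elim/homog_ind: w => [a b [N hN] [M hM]|n a ha _].
  exists (maxn N M) => k; rewrite geq_max => /andP[/hN e /hM e'].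
  rewrite {1}e {1}e' -big_split; apply: eq_bigr => i _ /=.
  by rewrite (linD _ _ (phc_lin i)).
exists n.+1 => M lt; rewrite (bigD1 (Ordinal lt)) //= (phc_homog _ ha) eqxx.
by rewrite big1 ?addr0 // => i ne; rewrite (phc_homog _ ha) ifN.
Qed.
Fact of_hc_one : phc 0 1 = 1. Proof. by rewrite (phc_homog _ homog1). Qed.
Fact of_hc_mul m n a b : phc m a = a -> phc n b = b -> phc (m + n) (a * b) = a * b.
Proof.
move=> /homog_of_phc ha /homog_of_phc hb.
by rewrite (phc_homog _ (homogM ha hb)) eqxx.
Qed.
Fact of_hc_dd n a : phc n a = a -> phc n.+1 (pdiff a) = pdiff a.
Proof. by move=> <-; rewrite (phc_homog _ (homog_pdiff _ _)) eqxx. Qed.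
Fact of_dd_mul n a b : phc n a = a ->
  pdiff (a * b) = pdiff a * b + (-1) ^+ n *: (a * pdiff b).
Proof. by move=> /homog_of_phc ha; rewrite pdiff_mul (homog_sigma ha) scalerAl. Qed.
Fact of_dd_dd a : pdiff (pdiff a) = 0.
Proof.
(* In d d (a b) the mixed terms are sigma(da) db + d(sigma a) db, which cancel exactly when [sigma]
   anticommutes with d; so both facts are proved together. *)
suff [] : pdiff (pdiff a) = 0 /\ sigma (pdiff a) = - pdiff (sigma a) by [].
have [sD sZ sM s1 _] := alg_homP sigma_hom.
elim/palg_ind: a => [j|c|a b [ha ha'] [hb hb']|a b [ha ha'] [hb hb']].
- split.
    rewrite pdiff_gen; case: j; rewrite /delta ?(lin0 pdiff_lin) // ?pdiff_gen //.
    rewrite -scaleN1r (linZ _ _ pdiff_lin) !pdiff_mul sM !pdiff_gen /delta.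
    rewrite !sigE /= expr0 !mul1r expr1 mulN1r mulr0 addr0.
    by rewrite !(mulrN, mulNr) opprK !mulrA addNr scaler0.
  rewrite pdiff_gen (homog_sigma (homog_delta j)) (homog_sigma (homog_gen j)).
  by rewrite (linZ _ _ pdiff_lin) pdiff_gen exprS mulN1r scaleNr.
- have e : pdiff c%:A = 0 by rewrite (linZ _ _ pdiff_lin) pdiff1 scaler0.
  by rewrite sZ s1 e (lin0 pdiff_lin) (lin0 sigma_hom.1) oppr0.
- by rewrite sD !(linD _ _ pdiff_lin) ha hb addr0 sD ha' hb' opprD.
rewrite sM !pdiff_mul (linD _ _ pdiff_lin) !pdiff_mul ha hb ha'; split.
  by rewrite mul0r mulr0 addr0 add0r mulNr addNr.
by rewrite sD !sM ha' hb' mulNr mulrN opprD.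
Qed.

Definition planck_forms : dga K := Dga phc_lin of_hc_hc of_hc_sum of_hc_one
  of_hc_mul pdiff_lin of_hc_dd of_dd_dd of_dd_mul.

Lemma planck_forms_calculus :
  exists (Om : dga K) (g ginv p : Om), planck_calculus lam g ginv p.
Proof.
exists planck_forms, g, ginv, p.
have e : @form_gens K planck_forms g ginv p = x.
  by apply/funext => -[] //=; [apply: (pdiff_gen Og)|apply: (pdiff_gen Op)].
split.
- exact: (phc_homog 0 (homog_gen Og)).
- exact: (phc_homog 0 (homog_gen Oginv)).
- exact: (phc_homog 0 (homog_gen Op)).
- rewrite e; split; first exact: hx.
  move=> B y hy; exists (plift y); split.
  + exact: plift_hom.
  + by move=> j; apply: plift_gen.
  move=> f hf fy; apply: palg_hom_ext => //; first exact: plift_hom.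
  by move=> j; rewrite fy plift_gen.
rewrite e => Q Qg Qs QD QM; exact: palg_ind.
Qed.
End Construction.

(** * Maps out of the torus, the line and the calculus *)

Section DgaFacts.
Variables (K : fieldType) (Om : dga K).

Lemma dd_inv (a b : Om) : hc 0 a = a -> hc 0 b = b -> a * b = 1 -> b * a = 1 ->
  dd b = - (b * dd a * b).
Proof.
move=> ha hb ab ba; have := congr1 (fun w => b * dd w) ab.
rewrite dd_one mulr0 (dd_mul _ ha) expr0 scale1r mulrDr !mulrA ba mul1r.
by move/eqP; rewrite addrC addr_eq0 => /eqP.
Qed.

(** Induction on words that peels off one generator on the left, obtained by letting elements act on
    an arbitrary right factor. It matches operators and coproducts, whose effect on x_j w is known
    from that on w. *)
Lemma left_ind (J : Type) (x : J -> Om) :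
  (forall Q : Om -> Prop, (forall j, Q (x j)) -> (forall c, Q c%:A) ->
    (forall a b, Q a -> Q b -> Q (a + b)) ->
    (forall a b, Q a -> Q b -> Q (a * b)) -> forall a, Q a) ->
  forall Q : Om -> Prop, Q 1 -> (forall a b, Q a -> Q b -> Q (a + b)) ->
    (forall c a, Q a -> Q (c *: a)) -> (forall j a, Q a -> Q (x j * a)) ->
    forall a, Q a.
Proof.
move=> ind Q Q1 QD QZ Qx a; rewrite -(mulr1 a).
move: a (1 : Om) Q1; apply: (ind (fun a => forall b, Q b -> Q (a * b))).
- by move=> j b; apply: Qx.
- by move=> c b Qb; rewrite mulr_algl; apply: QZ.
- by move=> a b ha hb u Qu; rewrite mulrDl; apply: QD; [apply: ha|apply: hb].
by move=> a b ha hb u Qu; rewrite -mulrA; apply/ha/hb.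
Qed.
End DgaFacts.

Section Torus.
Variable K : fieldType.
Local Notation T := (Omega_torus K).
Local Notation tg := (to_g K).
Local Notation tgi := (to_ginv K).

Definition torus_gens (Om : dga K) (g ginv : Om) (j : bool) : Om :=
  if j then g else ginv.

Lemma to_g_deg : hc 0 tg = tg. Proof. exact: dgen_deg. Qed.
Lemma to_ginv_deg : hc 0 tgi = tgi. Proof. exact: dgen_deg. Qed.
Lemma to_relations : [/\ tg * tgi = 1, tgi * tg = 1, lie (dd tg) tg = 0 & dd tg * dd tg = 0].
Proof. exact: torus_gen_rels. Qed.

Lemma torus_lift (Om : dga K) (g ginv : Om) : hc 0 g = g -> hc 0 ginv = ginv ->
  torus_rels (torus_gens g ginv) ->
  exists f : T -> Om, [/\ dga_hom f, f tg = g & f tgi = ginv].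
Proof.
move=> hg hgi hr.
have hs : dsat (@torus_rels K) (torus_gens g ginv) by split=> // -[].
exists (dga_lift (torus_gens g ginv)).
split; first exact: dga_lift_hom.
  exact: (dga_lift_gen (torus_model K) true hs).
exact: (dga_lift_gen (torus_model K) false hs).
Qed.

Lemma torus_hom_ext (Om : dga K) (f f' : T -> Om) : dga_hom f -> dga_hom f' ->
  f tg = f' tg -> f tgi = f' tgi -> f =1 f'.
Proof. by move=> hf hf' e e'; apply: pdga_hom_ext => // -[]. Qed.

Lemma torus_ind (Q : T -> Prop) : Q tg -> Q tgi -> Q (dd tg) ->
  (forall c, Q c%:A) -> (forall a b, Q a -> Q b -> Q (a + b)) ->
  (forall a b, Q a -> Q b -> Q (a * b)) -> forall a, Q a.
Proof.
move=> Qg Qi Qd Qs QD QM; apply: pdga_alg_ind => //; first by case.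
case=> //; have [e1 e2 _ _] := to_relations.
rewrite (dd_inv to_g_deg to_ginv_deg e1 e2) -mulN1r -scaleN1r.
by apply: (QM) => //; apply: (QM) => //; apply: (QM).
Qed.

Lemma torus_hom_alg_ext (B : algType K) (f f' : T -> B) : alg_hom f -> alg_hom f' ->
  f tg = f' tg -> f tgi = f' tgi -> f (dd tg) = f' (dd tg) -> f =1 f'.
Proof.
move=> /alg_homP[fD fZ fM f1 f0] /alg_homP[gD gZ gM g1 g0] e1 e2 e3.
apply: torus_ind => //.
- by move=> c; rewrite fZ gZ f1 g1.
- by move=> a b ha hb; rewrite fD gD ha hb.
by move=> a b ha hb; rewrite fM gM ha hb.
Qed.
End Torus.

Section Line.
Variables (K : fieldType) (lam : K).
Local Notation L := (Omega_line lam).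
Local Notation r := (li_r lam).

Lemma li_r_deg : hc 0 r = r. Proof. exact: dgen_deg. Qed.
Lemma line_relations : lie r (dd r) = lam *: dd r /\ dd r * dd r = 0.
Proof. exact: line_gen_rels. Qed.

Lemma line_lift (Om : dga K) (s : Om) : hc 0 s = s -> line_rels lam (fun _ : unit => s) ->
  exists f : L -> Om, dga_hom f /\ f r = s.
Proof.
move=> hs hr; have hd : dsat (line_rels lam) (fun _ : unit => s) by split.
exists (dga_lift (fun _ : unit => s)); split; first exact: dga_lift_hom.
exact: (dga_lift_gen (line_model lam) tt hd).
Qed.

Lemma line_hom_ext (Om : dga K) (f f' : L -> Om) : dga_hom f -> dga_hom f' ->
  f r = f' r -> f =1 f'.
Proof. by move=> hf hf' e; apply: pdga_hom_ext => // -[]. Qed.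

Lemma line_left_ind (Q : L -> Prop) : Q 1 -> (forall a b, Q a -> Q b -> Q (a + b)) ->
  (forall c a, Q a -> Q (c *: a)) -> (forall a, Q a -> Q (r * a)) ->
  (forall a, Q a -> Q (dd r * a)) -> forall a, Q a.
Proof.
move=> Q1 QD QZ Qr Qd.
apply: (@left_ind _ L bool (fun b => if b then r else dd r)) => //; last by case.
move=> Q' Qx Qs QD' QM; apply: pdga_alg_ind => // -[]; first exact: (Qx true).
exact: (Qx false).
Qed.

Lemma line_counit_hom : @dga_hom K L (triv K^o) (@line_counit K lam).
Proof.
apply: dga_lift_hom; split=> [_|]; first exact: linear0.
by rewrite /line_rels /= /lie !linear0 !mulr0 subrr.
Qed.

Lemma line_counit_r : line_counit r = 0.
Proof.
rewrite /line_counit dga_lift_gen //; split=> [_|]; first exact: linear0.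
by rewrite /line_rels /= /lie !linear0 !mulr0 subrr.
Qed.

Lemma line_coprod_hom : dga_hom (@line_coprod K lam : L -> stens L L).
Proof. by apply: dga_lift_hom; apply: line_coprod_dsat. Qed.

Lemma line_coprod_r : line_coprod r = r ⊗ 1 + 1 ⊗ r.
Proof. exact: (dga_lift_gen (line_model lam) tt (line_coprod_dsat lam)). Qed.

Lemma torus_counit_hom : @dga_hom K (Omega_torus K) (triv K^o) (@torus_counit K).
Proof.
apply: dga_lift_hom; split=> // ; rewrite /torus_rels /= /lie.
by split; rewrite ?mulr1 ?mul0r ?mulr0 ?subrr.
Qed.

Lemma torus_counit_gens : torus_counit (to_g K) = 1 /\ torus_counit (to_ginv K) = 1.
Proof.
have h : @dsat K _ (@torus_rels K) (triv K^o) (fun _ => 1).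
  split=> // ; rewrite /torus_rels /= /lie.
  by split; rewrite ?mulr1 ?mul0r ?mulr0 ?subrr.
by rewrite /torus_counit !dga_lift_gen.
Qed.

Lemma torus_coprod_hom :
  dga_hom (@torus_coprod K : Omega_torus K -> stens (Omega_torus K) (Omega_torus K)).
Proof. by apply: dga_lift_hom; apply: torus_coprod_dsat. Qed.

Lemma torus_coprod_gens : torus_coprod (to_g K) = to_g K ⊗ to_g K /\
  torus_coprod (to_ginv K) = to_ginv K ⊗ to_ginv K.
Proof.
split; [exact: (dga_lift_gen (torus_model K) true (torus_coprod_dsat K))|].
exact: (dga_lift_gen (torus_model K) false (torus_coprod_dsat K)).
Qed.
End Line.

(** * DGA maps out of the calculus and its structure as an exterior algebra *)

Section Calculus.
Variables (K : fieldType) (lam : K) (Om : dga K) (g ginv p : Om).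
Hypothesis pc : planck_calculus lam g ginv p.

Local Notation x := (form_gens g ginv p).
Local Notation dg := (dd g).
Local Notation dp := (dd p).

Let hg := pc_g pc.
Let hgi := pc_ginv pc.
Let hp := pc_p pc.

Lemma calc_rels : omega_rels lam x. Proof. by case: (pc_pres pc). Qed.

Lemma calc_deg j : hc (form_deg j) (x j) = x j.
Proof. by case: j; rewrite /= ?hg ?hgi ?hp // hc_dd. Qed.

Lemma calc_alg_lift (B : algType K) (y : omega_gen -> B) : omega_rels lam y ->
  exists f : Om -> B, alg_hom f /\ forall j, f (x j) = y j.
Proof. by move=> hy; have [f [hf fx _]] := (pc_pres pc).2 B y hy; exists f. Qed.

Lemma calc_alg_ext (B : algType K) (f f' : Om -> B) : alg_hom f -> alg_hom f' ->
  (forall j, f (x j) = f' (x j)) -> f =1 f'.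
Proof.
move=> /alg_homP[fD fZ fM f1 f0] /alg_homP[gD gZ gM g1 g0] e.
apply: (pc_ind pc) => //.
- by move=> c; rewrite fZ gZ f1 g1.
- by move=> a b ha hb; rewrite fD gD ha hb.
by move=> a b ha hb; rewrite fM gM ha hb.
Qed.

Lemma calc_left_ind (Q : Om -> Prop) : Q 1 -> (forall a b, Q a -> Q b -> Q (a + b)) ->
  (forall c a, Q a -> Q (c *: a)) -> (forall j a, Q a -> Q (x j * a)) ->
  forall a, Q a.
Proof. exact: left_ind (pc_ind pc) Q. Qed.

Lemma calc_inv : g * ginv = 1 /\ ginv * g = 1.
Proof. by have [[]] := calc_rels. Qed.

Lemma dd_ginv : dd ginv = - (ginv * dg * ginv).
Proof. by have [e1 e2] := calc_inv; apply: dd_inv. Qed.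

Lemma calc_hom_ext (Om' : dga K) (f f' : Om -> Om') : dga_hom f -> dga_hom f' ->
  f g = f' g -> f ginv = f' ginv -> f p = f' p -> f =1 f'.
Proof.
move=> [af _ fd] [af' _ fd'] eg ei ep; apply: calc_alg_ext => // -[] //=.
  by rewrite fd fd' eg.
by rewrite fd fd' ep.
Qed.

(** The algebra map given by the presentation respects degree and differential on generators, since
    dg and dp are sent to the differentials of the images of g and p; left induction propagates
    both. *)
Lemma calc_lift (Om' : dga K) (g' ginv' p' : Om') :
  hc 0 g' = g' -> hc 0 ginv' = ginv' -> hc 0 p' = p' ->
  omega_rels lam (form_gens g' ginv' p') ->
  exists f : Om -> Om', [/\ dga_hom f, f g = g', f ginv = ginv' & f p = p'].
Proof.
move=> hg' hgi' hp' hr; have [f [hf fx]] := calc_alg_lift hr.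
have [fD fZ fM f1 f0] := alg_homP hf.
have fdeg j : hc (form_deg j) (f (x j)) = f (x j).
  by rewrite fx; case: j; rewrite /= ?hg' ?hgi' ?hp' // hc_dd.
have fh n w : f (hc n w) = hc n (f w).
  move: n; elim/calc_left_ind: w => [|a b ha hb|c a ha|j a ha] n.
  - by rewrite f1 !(hcK _ (hc_one _)); case: ifP.
  - by rewrite linearD !fD ha hb linearD.
  - by rewrite linearZ !fZ ha linearZ.
  rewrite fM; have [lt|le] := ltnP n (form_deg j).
    by rewrite (hc_mull_small _ (calc_deg j)) // (hc_mull_small _ (fdeg j)).
  rewrite -(subnKC le) (hc_mull _ _ (calc_deg j)) (hc_mull _ _ (fdeg j)).
  by rewrite fM ha.
(* Only [ginv] has a differential that is neither zero nor a generator; it is expressed through dg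
   by [dd_inv] on both sides. *)
have fdx j : f (dd (x j)) = dd (f (x j)).
  have [e1 e2] := calc_inv; have [[e1' e2' _] _ _] := hr.
  rewrite fx; case: j => /=; rewrite ?dd_dd ?f0 //; [exact: (fx Odg)| |exact: (fx Odp)].
  rewrite dd_ginv (alg_homN _ hf) !fM (fx Oginv) (fx Odg) /=.
  by rewrite (dd_inv hg' hgi' e1' e2').
exists f; split; [|exact: (fx Og)|exact: (fx Oginv)|exact: (fx Op)].
split=> //; apply: calc_left_ind => [|a b ha hb|c a ha|j a ha].
- by rewrite f1 !dd_one.
- by rewrite linearD !fD ha hb linearD.
- by rewrite linearZ !fZ ha linearZ.
by rewrite (dd_mul _ (calc_deg j)) fD fZ !fM (dd_mul _ (fdeg j)) fdx ha.
Qed.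

Local Notation pl := (planck lam).

Lemma calc_planck_rels : planck_rels lam (planck_gens g ginv p).
Proof. by have [[]] := calc_rels. Qed.

Definition calc_incl : pl -> Om := plift (planck_gens g ginv p).
Local Notation i := calc_incl.

Lemma incl_hom : alg_hom i.
Proof. exact: (plift_hom (planck_model lam) calc_planck_rels). Qed.

Lemma incl_gens : [/\ i (pl_g lam) = g, i (pl_ginv lam) = ginv & i (pl_p lam) = p].
Proof. by split; rewrite /i plift_gen //; apply: calc_planck_rels. Qed.

Lemma incl_deg a : hc 0 (i a) = i a.
Proof.
have [iD iZ iM i1 i0] := alg_homP incl_hom; have [ig ii ip] := incl_gens.
elim/palg_ind: a => [j|c|a b ha hb|a b ha hb].
- by case: j; [rewrite [i _]ig|rewrite [i _]ii|rewrite [i _]ip].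
- by rewrite iZ i1 linearZ /= hc_one.
- by rewrite iD linearD /= ha hb.
by rewrite iM (hc_mul ha hb).
Qed.

(** Setting dg = dp = 0 respects the relations and gives a retraction of the calculus onto the
    Planck algebra. *)
Lemma incl_inj : injective i.
Proof.
have z : forall a : pl, 0 * a = a * 0 by move=> a; rewrite mul0r mulr0.
pose y j : pl := match j with
  | Og => pl_g lam | Oginv => pl_ginv lam | Op => pl_p lam | _ => 0 end.
have [h1 h2 h3] := planck_gen_rels lam.
have hy : omega_rels lam y.
  by split; split; rewrite /lie /= ?mul0r ?mulr0 ?subrr ?scaler0 ?oppr0.
have [f [hf fx]] := calc_alg_lift hy.
have [ig ii ip] := incl_gens.
suff fi : forall a, f (i a) = a by move=> a b e; rewrite -(fi a) e fi.
apply: (palg_hom_ext (alg_hom_comp incl_hom hf) (alg_hom_id pl)) => -[].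
- by rewrite [i _]ig (fx Og).
- by rewrite [i _]ii (fx Oginv).
by rewrite [i _]ip (fx Op).
Qed.

Lemma gen_incl j : form_deg j = 0%N -> exists a, x j = i a.
Proof.
have [ig ii ip] := incl_gens.
by case: j => // _; [exists (pl_g lam)|exists (pl_ginv lam)|exists (pl_p lam)].
Qed.

Lemma hc0_incl w : exists a, hc 0 w = i a.
Proof.
have [iD iZ iM i1 i0] := alg_homP incl_hom.
elim/calc_left_ind: w => [|w v [a ha] [b hb]|c w [a ha]|j w [a ha]].
- by exists 1; rewrite i1 hc_one.
- by exists (a + b); rewrite linearD /= ha hb iD.
- by exists (c *: a); rewrite linearZ /= ha iZ.
case e : (form_deg j) => [|n]; last first.
  by exists 0; rewrite i0 (hc_mull_small _ (calc_deg j)) // e.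
have [b hb] := gen_incl e.
exists (b * a); have := calc_deg j; rewrite e => hj.
by rewrite (hc_mull 0 _ hj) ha hb iM.
Qed.

Lemma hc1_span w : exists s : seq (pl * pl), hc 1 w = \sum_(ab <- s) i ab.1 * dd (i ab.2).
Proof.
have [iD iZ iM i1 i0] := alg_homP incl_hom.
have one (j : omega_gen) : form_deg j = 1%N -> exists a, x j = dd (i a).
  have [ig ii ip] := incl_gens.
  by case: j => // _; [exists (pl_g lam); rewrite ig|exists (pl_p lam); rewrite ip].
elim/calc_left_ind: w => [|w v [s hs] [t ht]|c w [s hs]|j w [s hs]].
- by exists [::]; rewrite (hcK _ (hc_one _)) big_nil.
- by exists (s ++ t); rewrite linearD /= hs ht big_cat.
- exists [seq (c *: ab.1, ab.2) | ab <- s].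
  rewrite linearZ /= hs big_map scaler_sumr; apply: eq_bigr => ab _ /=.
  by rewrite iZ scalerAl.
have hj := calc_deg j; case e : (form_deg j) => [|[|n]]; last by move: e; case: j {hj}.
  have [b hb] := gen_incl e; rewrite e in hj.
  exists [seq (b * ab.1, ab.2) | ab <- s].
  rewrite (hc_mull 1 _ hj) hs big_map mulr_sumr; apply: eq_bigr => ab _ /=.
  by rewrite iM hb mulrA.
rewrite e in hj; have [a ha] := one j e; have [b hb] := hc0_incl w.
(* Only the degree 0 part b of w contributes, and (da) b = d(ab) - a db puts the coefficient on the
   left. *)
exists [:: (1, a * b); (- a, b)].
rewrite (hc_mull 0 _ hj) hb ha !big_cons big_nil addr0 /= i1 mul1r iM.
rewrite (dd_mul _ (incl_deg a)) expr0 scale1r (alg_homN _ incl_hom) mulNr.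
by rewrite addrK.
Qed.

Lemma incl_exterior : exterior_algebra i.
Proof.
split; [exact: incl_hom|exact: incl_inj| | |].
- move=> w; split=> [<-|[a ->]]; last exact: incl_deg.
  exact: hc0_incl.
- by move=> w <-; apply: hc1_span.
move=> Q Qh QD QM; apply: (pc_ind pc) => // [j|c].
  by apply: Qh; have := calc_deg j; case: j => /= h; by [left|right].
by apply: Qh; left; rewrite linearZ /= hc_one.
Qed.
End Calculus.

(** * Hopf structure *)

Section CoactionRelations.
Variables (K : fieldType) (lam : K) (Om1 Om2 : dga K).
Variables (s : Om1) (g ginv p : Om2).
Hypothesis char2 : (2%:R : K) != 0.
Hypotheses (hs : hc 0 s = s) (hg : hc 0 g = g) (hp : hc 0 p = p).
Hypothesis rel_s : lie s (dd s) = lam *: dd s.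
Hypothesis rels : omega_rels lam (form_gens g ginv p).

(** One computation serves twice: with s the coordinate of the line this is the coaction on r, and
    with s = p it is the coproduct of p. *)
Let r : stens Om1 Om2 := 1 ⊗ p + s ⊗ g.

Let bt := @bilin_tpure K Om1 Om2.
Let btE := (bilinDl bt, bilinDr bt, bilinZl bt, bilinZr bt, bilin0l bt, bilin0r bt).

Lemma coaction_deg : hc 0 r = r.
Proof. by rewrite linearD /= (stens_hcE _ (hc_one _) hp) (stens_hcE _ hs hg). Qed.

Lemma coaction_dd : dd r = 1 ⊗ dd p + dd s ⊗ g + s ⊗ dd g :> stens Om1 Om2.
Proof.
rewrite linearD /= (stens_ddE _ (hc_one _)) (stens_ddE _ hs) dd_one.
by rewrite btE add0r !expr0 !scale1r addrA.
Qed.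

(** Two cross terms make this work: the one with ds is ds tensor ([p, g] + lam g^2) = lam ds tensor
    g, and the one with s is s tensor ([p, dg] + [g, dp]) = lam s tensor dg. The term with s^2
    vanishes because g and dg commute. *)
Lemma coaction_line_rel : lie r (dd r) = lam *: dd r.
Proof.
have [[_ _ a3] [b1 b2 b3 b4] _] := rels; rewrite /= in a3 b1 b2 b3 b4.
have h1 := hc_one Om1; have hds := hc_dd hs; have hdg := hc_dd hg; have hdp := hc_dd hp.
rewrite coaction_dd /lie !(mulrDl, mulrDr).
pose me := (stens_mulE _ _ hp h1, stens_mulE _ _ hp hs, stens_mulE _ _ hp hds,
  stens_mulE _ _ hg h1, stens_mulE _ _ hg hs, stens_mulE _ _ hg hds,
  stens_mulE _ _ hdg h1, stens_mulE _ _ hdg hs, stens_mulE _ _ hdg hds,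
  stens_mulE _ _ hdp h1, stens_mulE _ _ hdp hs, stens_mulE _ _ hdp hds).
rewrite !me !(mul0n, muln0, mul1n, expr0, scale1r, mul1r, mulr1).
have e1 : p * g = g * p + lam *: (g - g * g).
  by move: a3; rewrite mulrBl mul1r => <-; rewrite addrC subrK.
have e2 : dd g * g = g * dd g by apply/eqP; rewrite -subr_eq0; apply/eqP.
have e3 : p * dd p = dd p * p + lam *: dd p by rewrite -b2 addrC subrK.
have e4 : g * dd p = dd p * g + lam *: (g * dd g) by rewrite -b3 addrC subrK.
have e5 : p * dd g = dd g * p + lam *: (dd g - g * dd g).
  by move: b4; rewrite mulrBl mul1r => <-; rewrite addrC subrK.
have e6 : s * dd s = dd s * s + lam *: dd s by rewrite -rel_s addrC subrK.
rewrite e1 e2 e3 e4 e5 e6 -!scaleN1r !btE !scaleN1r.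
by linear_ring.
Qed.

Lemma coaction_dsat : line_rels lam (fun _ : unit => r).
Proof.
split; first exact: coaction_line_rel.
exact: line_square char2 coaction_deg coaction_line_rel.
Qed.
End CoactionRelations.

(** * Relations between the images of the generators under coproduct and antipode *)

Section CoproductRelations.
Variables (K : fieldType) (lam : K) (Om : dga K) (g ginv p : Om).
Hypothesis char2 : (2%:R : K) != 0.
Hypotheses (hg : hc 0 g = g) (hgi : hc 0 ginv = ginv) (hp : hc 0 p = p).
Hypothesis rels : omega_rels lam (form_gens g ginv p).

Let bt := @bilin_tpure K Om Om.
Let btE := (bilinDl bt, bilinDr bt, bilinZl bt, bilinZr bt, bilin0l bt, bilin0r bt).

(** The relations of g alone come from [torus_stens] and that of p alone from [coaction_line_rel].
    Thus only [p, g] and [p, dg] have to be computed. *)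
Lemma coproduct_rels : @omega_rels K lam (stens Om Om)
  (@form_gens K (stens Om Om) (g ⊗ g) (ginv ⊗ ginv) (1 ⊗ p + p ⊗ g)).
Proof.
have [[a1 a2 a3] [b1 b2 b3 b4] [c1 c2 c3]] := rels; rewrite /= in a1 a2 a3 b1 b2 b3 b4 c1 c2 c3.
have h1 := hc_one Om; have hdg := hc_dd hg.
have e1 : p * g = g * p + lam *: (g - g * g).
  by move: a3; rewrite mulrBl mul1r => <-; rewrite addrC subrK.
have e5 : p * dd g = dd g * p + lam *: (dd g - g * dd g).
  by move: b4; rewrite mulrBl mul1r => <-; rewrite addrC subrK.
have [_ [t1 t2 t3 t4]] := @torus_stens K Om (torus_gens g ginv)
  (fun j => match j with true => hg | false => hgi end) (And4 a1 a2 b1 c2).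
rewrite /= in t1 t2 t3 t4.
have hG : hc 0 (g ⊗ g : stens Om Om) = g ⊗ g by rewrite (stens_hcE _ hg hg).
pose me := (stens_mulE _ _ hp hg, stens_mulE _ _ hg h1, stens_mulE _ _ hg hp,
  stens_mulE _ _ hg hg, stens_mulE _ _ hp hdg, stens_mulE _ _ hg hdg,
  stens_mulE _ _ hdg h1, stens_mulE _ _ hdg hp).
have cg : dd g * g = g * dd g by apply/eqP; rewrite -subr_eq0; apply/eqP.
apply: omega_rels_of_pdg => //.
- exact: coaction_deg.
- split=> //=; rewrite /lie mulrBl mul1r !(mulrDl, mulrDr) !me.
  rewrite !(mul0n, muln0, mul1n, expr0, scale1r, mul1r, mulr1) e1.
  rewrite -!scaleN1r !btE !scaleN1r.
  by linear_ring.
- exact: coaction_line_rel hp hg hp b2 rels.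
rewrite (stens_ddE _ hg) expr0 scale1r /lie mulrBl mul1r !(mulrDl, mulrDr) !me.
rewrite !(mul0n, muln0, mul1n, expr0, scale1r, mul1r, mulr1) e1 e5 cg.
rewrite -!scaleN1r !btE !scaleN1r.
by linear_ring.
Qed.

(** The antipode reverses products, so commutators of the antipodes of generators change sign; this
    is the same list of relations with -lam for lam. *)
Lemma antipode_rels :
  omega_rels (- lam) (form_gens ginv g (- (p * ginv))).
Proof.
have [[a1 a2 a3] [b1 b2 b3 b4] [c1 c2 c3]] := rels; rewrite /= in a1 a2 a3 b1 b2 b3 b4 c1 c2 c3.
have hpi : hc 0 (p * ginv) = p * ginv := hc_mul hp hgi.
have dgi : dd ginv = - (ginv * dd g * ginv) := dd_inv hg hgi a1 a2.
have e0 : dd g * g = g * dd g by apply/eqP; rewrite -subr_eq0; apply/eqP.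
have rx : p * g = g * p + lam *: g + (- lam) *: (g * g).
  have h : p * g = g * p + lie p g by rewrite addrC subrK.
  by rewrite h a3 mulrBl mul1r scalerBr scaleNr addrA.
have sl (k : K) (a b : Om) : (k *: a) * b = k *: (a * b) by rewrite scalerAl.
have sr (k : K) (a b : Om) : a * (k *: b) = k *: (a * b) by rewrite scalerAr.
have conj (y : Om) : lie y ginv = - (ginv * lie y g * ginv).
  rewrite /lie mulrBr mulrBl opprB !mulrA a2 mul1r; congr (_ - _).
  by rewrite -!mulrA a1 mulr1.
have lieE (y z c : Om) : lie y z = c -> y * z = z * y + c by move=> <-; rewrite addrC subrK.
have q1 : dd g * ginv = ginv * dd g.
  by rewrite (lieE (dd g) ginv 0) ?addr0 // conj b1 mulr0 mul0r oppr0.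
have q2 : p * ginv = ginv * p + ((- lam) *: ginv + lam *: 1).
  have h : ginv * (g - g * g) * ginv = ginv - 1.
    by rewrite mulrBr mulrA a2 mul1r mulrBl mul1r a1.
  apply: lieE; rewrite conj a3 sr sl mulrBl mul1r h.
  by rewrite scalerBr opprB scaleNr addrC.
have q3 : dd p * ginv = ginv * dd p + lam *: (ginv * dd g).
  apply: lieE; rewrite conj; have -> : lie (dd p) g = - (lam *: (g * dd g)).
    by rewrite -b3 opprB.
  by rewrite mulrN mulNr opprK sr sl mulrA a2 mul1r q1.
have q4 : p * dd g = dd g * p + (lam *: dd g + (- lam) *: (g * dd g)).
  by apply: lieE; rewrite b4 mulrBl mul1r scalerBr scaleNr.
have q5 : p * dd p = dd p * p + lam *: dd p by apply: lieE.
have q6 : dd p * dd g = (-1) *: (dd g * dd p) by rewrite scaleN1r.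
(* [nf] is a rewriting system that moves p to the right past forms and functions, and dp to the
   right past dg and [ginv]. Products being nested to the left, each two-letter rule is also needed
   behind a prefix w. *)
have w1 (w a b c : Om) : a * b = c -> w * a * b = w * c by move=> <-; rewrite mulrA.
pose nf := (sl, sr, @mulrDl Om, @mulrDr Om, @mulrA Om, @mulr1 Om, @mul1r Om, @mulr0 Om, @mul0r Om,
  a1, a2, e0, rx, q1, q2, q3, q4, q5, q6, c1, c2,
  (fun w => w1 w _ _ _ a1, fun w => w1 w _ _ _ a2, fun w => w1 w _ _ _ e0,
   fun w => w1 w _ _ _ rx, fun w => w1 w _ _ _ q1, fun w => w1 w _ _ _ q2),
  (fun w => w1 w _ _ _ q3, fun w => w1 w _ _ _ q4, fun w => w1 w _ _ _ q5,
   fun w => w1 w _ _ _ q6, fun w => w1 w _ _ _ c1, fun w => w1 w _ _ _ c2)).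
have dq : dd (- (p * ginv)) = (-1) *: (dd p * ginv) + p * ginv * dd g * ginv.
  rewrite linearN /= (dd_mul _ hp) expr0 scale1r dgi mulrN opprD opprK scaleN1r.
  by rewrite !mulrA.
apply: omega_rels_of_pdg => //.
- by rewrite linearN /= hpi.
- split=> //=; rewrite /lie -!scaleN1r !nf.
  by linear_ring.
- by rewrite dgi /lie -!scaleN1r !nf scaleN1r addrN.
- have qE : - (p * ginv) = (-1) *: (ginv * p) + (lam *: ginv + (- lam) *: 1).
    by rewrite q2; linear_ring.
  have dqE : dd (- (p * ginv)) =
      (-1) *: (ginv * dd p) + (ginv * ginv * dd g * p + (- lam) *: (ginv * ginv * dd g)).
    by rewrite dq !nf; linear_ring.
  rewrite dqE qE /lie -!scaleN1r !nf.
  by linear_ring.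
rewrite dgi /lie -!scaleN1r !nf.
by linear_ring.
Qed.
End CoproductRelations.

Section HopfStructure.
Variables (K : fieldType) (lam : K) (Om : dga K) (g ginv p : Om).
Hypothesis char2 : (2%:R : K) != 0.
Hypothesis pc : planck_calculus lam g ginv p.

Local Notation x := (form_gens g ginv p).
Local Notation dg := (dd g).
Local Notation dp := (dd p).
Let hg := pc_g pc.
Let hgi := pc_ginv pc.
Let hp := pc_p pc.
Let h1 := hc_one Om.

Let bt := @bilin_tpure K Om Om.

Fact coprod_ex : exists f : Om -> stens Om Om, [/\ dga_hom f, f g = g ⊗ g,
  f ginv = ginv ⊗ ginv & f p = 1 ⊗ p + p ⊗ g].
Proof.
apply: (calc_lift pc).
- by rewrite (stens_hcE _ hg hg).
- by rewrite (stens_hcE _ hgi hgi).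
- exact: coaction_deg.
exact: coproduct_rels char2 hg hgi hp (calc_rels pc).
Qed.
Definition calc_coprod : Om -> tens Om Om := projT1 (cid coprod_ex).
Local Notation D := calc_coprod.

Lemma coprod_hom : dga_hom (D : Om -> stens Om Om).
Proof. by rewrite /D; case: cid => f []. Qed.
Lemma coprod_gens : [/\ D g = g ⊗ g, D ginv = ginv ⊗ ginv & D p = 1 ⊗ p + p ⊗ g].
Proof. by rewrite /D; case: cid => f []. Qed.
Lemma coprod_dg : D dg = dg ⊗ g + g ⊗ dg.
Proof.
have [_ _ ->] := coprod_hom; have [-> _ _] := coprod_gens.
by rewrite (stens_ddE _ hg) expr0 scale1r.
Qed.
Lemma coprod_dp : D dp = 1 ⊗ dp + dp ⊗ g + p ⊗ dg.
Proof.
have [_ _ ->] := coprod_hom; have [_ _ ->] := coprod_gens.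
exact: coaction_dd.
Qed.

Fact counit_ex : exists f : Om -> triv K^o, [/\ dga_hom f, f g = 1, f ginv = 1 & f p = 0].
Proof.
apply: (calc_lift pc) => //.
by split; split; rewrite /lie /= ?mulr1 ?mul1r ?subrr ?mul0r ?mulr0 ?subrr
  ?scaler0 ?subr0 ?oppr0.
Qed.
Definition calc_counit : Om -> K^o := projT1 (cid counit_ex).
Local Notation eps := calc_counit.
Lemma counit_hom : @dga_hom K Om (triv K^o) eps.
Proof. by rewrite /eps; case: cid => f []. Qed.
Lemma counit_gens : [/\ eps g = 1, eps ginv = 1 & eps p = 0].
Proof. by rewrite /eps; case: cid => f []. Qed.
Lemma counit_dd w : eps (dd w) = 0.
Proof. by case: counit_hom. Qed.

(* Right multiplication by the antipodes of the generators, with the Koszul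
   sign of moving a form past the argument; composing these operators composes
   the antipodes in the opposite order, so that [S w] is their value at 1. *)
Definition antipode_gens : omega_gen -> Om := form_gens ginv g (- (p * ginv)).

Fact antipode_op_lin j :
  linear (fun w => (if form_deg j == 0%N then w else par w) * antipode_gens j).
Proof.
by move=> c a b; case: ifP => _; rewrite ?par_lin mulrDl scalerAl.
Qed.
Definition antipode_op j : lend Om := Lend (antipode_op_lin j).

Fact antipode_op_rels : omega_rels lam antipode_op.
Proof.
have [[a1 a2 a3] [b1 b2 b3 b4] [c1 c2 c3]] :=
  antipode_rels char2 hg hgi hp (calc_rels pc).
rewrite /= in a1 a2 a3 b1 b2 b3 b4 c1 c2 c3.
have hpi : hc 0 (- (p * ginv)) = - (p * ginv) by rewrite linearN /= (hc_mul hp hgi).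
have pg : par ginv = ginv by rewrite (par_hom hgi) scale1r.
have pp : par (- (p * ginv)) = - (p * ginv) by rewrite (par_hom hpi) scale1r.
have pdg : par (dd ginv) = - dd ginv by rewrite (par_hom (hc_dd hgi)) scaleN1r.
have pdp : par (dd (- (p * ginv))) = - dd (- (p * ginv)).
  by rewrite (par_hom (hc_dd hpi)) scaleN1r.
(* Composing right multiplications reverses the factors once more, which turns -lam back into
   lam. *)
have swap (u v c : Om) : lie u v = (- lam) *: c -> v * u - u * v = lam *: c.
  by move=> e; rewrite -opprB [_ - _]e scaleNr opprK.
have cg : dd ginv * ginv = ginv * dd ginv.
  by apply/eqP; rewrite -subr_eq0; apply/eqP.
split; split; apply: lendP => w;
  rewrite ?(lendD, lendN, lendM, lendZ, lend1, lend0) /= ?par_mul ?pg ?pp ?pdg ?pdp ?par_par.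
- by rewrite -mulrA a2 mulr1.
- by rewrite -mulrA a1 mulr1.
- by rewrite -!mulrA -!mulrBr (swap _ _ _ a3) mulrBl mul1r -scalerAr.
- by rewrite -!mulrA cg subrr.
- by rewrite -!mulrA -!mulrBr (swap _ _ _ b2) -scalerAr.
- by rewrite -!mulrA -!mulrBr (swap _ _ _ b3) -scalerAr cg.
- by rewrite -!mulrA -!mulrBr (swap _ _ _ b4) -scalerAr cg mulrBl mul1r.
- by rewrite mulrN mulNr -mulrA c1 mulr0 oppr0.
- by rewrite mulrN mulNr -mulrA c2 mulr0 oppr0.
by rewrite !(mulrN, mulNr) -!mulrA c3 mulrN !opprK.
Qed.

Fact antipode_ex : exists f : Om -> lend Om, alg_hom f /\ forall j, f (x j) = antipode_op j.
Proof. exact: (calc_alg_lift pc antipode_op_rels). Qed.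
Definition calc_antipode (w : Om) : Om := projT1 (cid antipode_ex) w 1.
Local Notation S := calc_antipode.

Lemma antipode_lin : linear S.
Proof.
rewrite /S; case: cid => f /= [/alg_homP[fD fZ _ _ _] _] c a b.
by rewrite fD fZ lendD lendZ.
Qed.
Lemma antipode1 : S 1 = 1.
Proof. by rewrite /S; case: cid => f /= [/alg_homP[_ _ _ -> _] _]. Qed.
(** Super anti-multiplicativity on a left generator. Together with linearity and S 1 = 1 it is all
    that is used about [S]. *)
Lemma antipode_gen j w :
  S (x j * w) = (if form_deg j == 0%N then S w else par (S w)) * antipode_gens j.
Proof.
by rewrite /S; case: cid => f /= [/alg_homP[_ _ fM _ _] fx]; rewrite fM lendM fx.
Qed.

Let hpi : hc 0 (- (p * ginv)) = - (p * ginv).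
Proof. by rewrite linearN /= (hc_mul hp hgi). Qed.

Lemma par_gen j : par (x j) = (-1) ^+ form_deg j *: x j.
Proof. exact: par_hom (calc_deg pc j). Qed.

Lemma antipode_par w : S (par w) = par (S w).
Proof.
have lS := antipode_lin.
elim/(calc_left_ind pc): w => [|a b ha hb|c a ha|j a ha].
- by rewrite par_1 antipode1 par_1.
- by rewrite parD !(linD _ _ lS) ha hb parD.
- by rewrite parZ !(linZ _ _ lS) ha parZ.
rewrite par_mul par_gen -scalerAl (linZ _ _ lS) !antipode_gen ha par_mul.
have hs : par (antipode_gens j) = (-1) ^+ form_deg j *: antipode_gens j.
  apply: par_hom; case: j => /=; rewrite ?hgi ?hg ?hpi // hc_dd //.
by rewrite hs -scalerAr; case: ifP.
Qed.

Lemma counit_par w : eps (par w) = eps w.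
Proof.
rewrite (dga_hom_par w counit_hom).
have h0 : @hc K (triv K^o) 0 (eps w) = eps w by [].
by rewrite (par_hom h0) scale1r.
Qed.

Lemma counit_mul a b : eps (a * b) = eps a * eps b.
Proof. by have [[_ [_ eM]] _ _] := counit_hom. Qed.

Let lD := dga_hom_lin coprod_hom.
Let Dmul a b : D (a * b) = (D a : stens Om Om) * D b.
Proof. by have [[_ [_ DM]] _ _] := coprod_hom. Qed.
Let D1 : D 1 = (1 : Om) ⊗ (1 : Om).
Proof. by have [[_ [DM _]] _ _] := coprod_hom. Qed.

Let hdg := hc_dd hg.
Let hdp := hc_dd hp.

(** The sum telescopes from the inside: up to sign, S(x' a) x'' b = S(a) S(x') x'' b, and S(x') x''
    collapses to the counit of the generator x. Hence [step] holds for every tensor t, not only for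
    t = D w. *)
Lemma antipode_left w : \tsum_(a, b <- D w) (S a * b) = (eps w)%:A.
Proof.
have lS := antipode_lin.
have bF : bilin (fun a b : Om => S a * b).
  by apply: (bilin_comp (f := S) (g := id)) => //; apply: bilin_mul.
pose F (t : stens Om Om) : Om := \tsum_(a, b <- t) (S a * b).
have lF : linear F := tsum_lin bF.
have [Eg Ei Ep] := coprod_gens; have [eg ei ep] := counit_gens.
have [e1 e2] := calc_inv pc.
have step j (t : stens Om Om) : F ((D (x j) : stens Om Om) * t) = eps (x j) *: F t.
  elim/tens_indh: t => [|t u ht hu|m n a b ha hb].
  - by rewrite mulr0 !(lin0 lF) scaler0.
  - by rewrite mulrDr !(linD _ _ lF) ht hu scalerDr.
  case: j => /=.
  - rewrite Eg eg scale1r (stens_mulE _ _ hg ha) mul0n scale1r /F !tsum_pure //.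
    by rewrite (antipode_gen Og) /= -mulrA [ginv * _]mulrA e2 mul1r.
  - rewrite Ei ei scale1r (stens_mulE _ _ hgi ha) mul0n scale1r /F !tsum_pure //.
    by rewrite (antipode_gen Oginv) /= -mulrA [g * _]mulrA e1 mul1r.
  - rewrite Ep ep scale0r mulrDl (stens_mulE _ _ hp ha) (stens_mulE _ _ hg ha) !mul0n !scale1r.
    rewrite (linD _ _ lF) /F !tsum_pure // mul1r (antipode_gen Op) /=.
    by rewrite mulrN mulNr -!mulrA [ginv * _]mulrA e2 mul1r subrr.
  - rewrite coprod_dg counit_dd scale0r mulrDl (stens_mulE _ _ hg ha) (stens_mulE _ _ hdg ha).
    rewrite mul0n mul1n scale1r (linD _ _ lF) (linZ _ _ lF) /F !tsum_pure //.
    rewrite (antipode_gen Odg) (antipode_gen Og) /= -antipode_par (par_hom ha) (linZ _ _ lS).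
    rewrite (dd_ginv pc) -!scalerAl -scalerDr mulrN mulNr -!mulrA.
    by rewrite [ginv * (g * b)]mulrA e2 mul1r addNr scaler0.
  rewrite coprod_dp counit_dd scale0r !mulrDl (stens_mulE _ _ hg ha) (stens_mulE _ _ hdg ha).
  rewrite (stens_mulE _ _ hdp ha) mul0n !mul1n scale1r !(linD _ _ lF) !(linZ _ _ lF) /F !tsum_pure //.
  rewrite (antipode_gen Odp) (antipode_gen Op) /= -antipode_par (par_hom ha) (linZ _ _ lS).
  have key : dd (- (p * ginv)) * g = - dp + p * ginv * dg.
    rewrite linearN /= (dd_mul _ hp) expr0 scale1r (dd_ginv pc) mulrN opprB mulrBl.
    by rewrite -!mulrA e2 !mulr1 !mulrA addrC.
  rewrite mul1r -!scalerAl -!scalerDr -!mulrA [_ * (g * b)]mulrA key -!mulrDr.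
  by rewrite mulrDl mulNr addrA addrN add0r mulNr !mulrA addrN mulr0 scaler0.
rewrite -/(F (D w)).
elim/(calc_left_ind pc): w => [|a b ha hb|c a ha|j a ha].
- rewrite D1 /F tsum_pure // antipode1 mulr1.
  by have [[_ [-> _]] _ _] := counit_hom; rewrite scale1r.
- have [[le _] _ _] := counit_hom.
  by rewrite (linD _ _ lD) (linD _ _ lF) ha hb (linD _ _ le) scalerDl.
- have [[le _] _ _] := counit_hom.
  by rewrite (linZ _ _ lD) (linZ _ _ lF) ha (linZ _ _ le) scalerA.
by rewrite Dmul step ha counit_mul scalerA.
Qed.

(** Here the two legs of D x end up outside, as x' F(t) S(x''), and cannot meet before F(t) is known
    to be a scalar. So [Fg] to [Fd] treat the summands of D x for arbitrary t, and the cancellation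
    waits for the induction hypothesis. *)
Lemma antipode_right w : \tsum_(a, b <- D w) (a * S b) = (eps w)%:A.
Proof.
have lS := antipode_lin.
have bF : bilin (fun a b : Om => a * S b).
  by apply: (bilin_comp (f := id) (g := S)) => //; apply: bilin_mul.
pose F (t : stens Om Om) : Om := \tsum_(a, b <- t) (a * S b).
have lF : linear F := tsum_lin bF.
have [Eg Ei Ep] := coprod_gens; have [eg ei ep] := counit_gens.
have [e1 e2] := calc_inv pc.
have Fg (t : stens Om Om) : F ((g ⊗ g : stens Om Om) * t) = g * F t * ginv.
  elim/tens_indh: t => [|t u ht hu|m n a b ha hb].
  - by rewrite mulr0 !(lin0 lF) mulr0 mul0r.
  - by rewrite mulrDr !(linD _ _ lF) ht hu mulrDr mulrDl.
  rewrite (stens_mulE _ _ hg ha) mul0n scale1r /F !tsum_pure // (antipode_gen Og) /=.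
  by rewrite !mulrA.
have Fi (t : stens Om Om) : F ((ginv ⊗ ginv : stens Om Om) * t) = ginv * F t * g.
  elim/tens_indh: t => [|t u ht hu|m n a b ha hb].
  - by rewrite mulr0 !(lin0 lF) mulr0 mul0r.
  - by rewrite mulrDr !(linD _ _ lF) ht hu mulrDr mulrDl.
  rewrite (stens_mulE _ _ hgi ha) mul0n scale1r /F !tsum_pure // (antipode_gen Oginv) /=.
  by rewrite !mulrA.
have Fl (y : Om) (t : stens Om Om) : F ((y ⊗ g : stens Om Om) * t) = y * F t * ginv.
  elim/tens_indh: t => [|t u ht hu|m n a b ha hb].
  - by rewrite mulr0 !(lin0 lF) mulr0 mul0r.
  - by rewrite mulrDr !(linD _ _ lF) ht hu mulrDr mulrDl.
  rewrite (stens_mulE _ _ hg ha) mul0n scale1r /F !tsum_pure // (antipode_gen Og) /=.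
  by rewrite !mulrA.
have Fp (t : stens Om Om) : F ((1 ⊗ p : stens Om Om) * t) = F t * - (p * ginv).
  elim/tens_indh: t => [|t u ht hu|m n a b ha hb].
  - by rewrite mulr0 !(lin0 lF) mul0r.
  - by rewrite mulrDr !(linD _ _ lF) ht hu mulrDl.
  rewrite (stens_mulE _ _ hp ha) mul0n scale1r /F !tsum_pure // (antipode_gen Op) /=.
  by rewrite mul1r mulrA.
have Fd j y (t : stens Om Om) : form_deg j = 1%N ->
    F ((y ⊗ x j : stens Om Om) * t) = y * par (F t) * antipode_gens j.
  move=> ej; have hj := calc_deg pc j; rewrite ej in hj.
  elim/tens_indh: t => [|t u ht hu|m n a b ha hb].
  - by rewrite mulr0 !(lin0 lF) par0 mulr0 mul0r.
  - by rewrite mulrDr !(linD _ _ lF) ht hu parD mulrDr mulrDl.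
  rewrite (stens_mulE _ _ hj ha) mul1n (linZ _ _ lF) /F !tsum_pure // antipode_gen ej /=.
  by rewrite par_mul (par_hom ha) -!scalerAl -scalerAr -scalerAl !mulrA.
rewrite -/(F (D w)).
elim/(calc_left_ind pc): w => [|a b ha hb|c a ha|j a ha].
- rewrite D1 /F tsum_pure // antipode1 mulr1.
  by have [[_ [-> _]] _ _] := counit_hom; rewrite scale1r.
- have [[le _] _ _] := counit_hom.
  by rewrite (linD _ _ lD) (linD _ _ lF) ha hb (linD _ _ le) scalerDl.
- have [[le _] _ _] := counit_hom.
  by rewrite (linZ _ _ lD) (linZ _ _ lF) ha (linZ _ _ le) scalerA.
rewrite Dmul counit_mul; case: j => /=.
- by rewrite Eg Fg ha eg mul1r mulr_algr -scalerAl e1.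
- by rewrite Ei Fi ha ei mul1r mulr_algr -scalerAl e2.
- rewrite Ep mulrDl (linD _ _ lF) Fp Fl ha ep mul0r scale0r mulr_algr mulr_algl scalerN.
  by rewrite -scalerAl addNr.
- rewrite coprod_dg mulrDl (linD _ _ lF) Fl (Fd Odg) // ha counit_dd mul0r scale0r.
  rewrite parZ par_1 !mulr_algr -!scalerAl -scalerDr /= (dd_ginv pc) mulrN !mulrA e1 mul1r.
  by rewrite addrN scaler0.
rewrite coprod_dp !mulrDl !(linD _ _ lF) Fl (Fd Odp) // (Fd Odg) // ha counit_dd mul0r scale0r.
rewrite parZ par_1 !mulr_algr -!scalerAl -!scalerDr /= mul1r.
by rewrite linearN /= (dd_mul _ hp) expr0 scale1r opprD addrAC addrNK addNr scaler0.
Qed.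

Lemma coprod_coassoc w :
  \tsum_(a, b <- D w) \tsum_(a1, a2 <- D a) (a1 ⊗ (a2 ⊗ b)) =
  \tsum_(a, b <- D w) (a ⊗ D b).
Proof.
have hD := coprod_hom; have hi := dga_hom_id Om.
have hl := dga_hom_comp (dga_hom_comp hD (tmap_hom hD hi)) (tassoc_hom Om Om Om).
have hr := dga_hom_comp hD (tmap_hom hi hD).
have lm1 : linear (tmap (D : Om -> stens Om Om) (fun x : Om => x)).
  exact: tmap_lin lD _.
have lm2 : linear (tmap (fun x : Om => x) (D : Om -> stens Om Om)).
  exact: tmap_lin _ lD.
have lta := dga_hom_lin (tassoc_hom Om Om Om).
rewrite -(tassoc_tmap (D : Om -> stens Om Om) (D w)).
have [Eg Ei Ep] := coprod_gens.
apply: (calc_hom_ext pc hl hr).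
- by rewrite Eg !tmap_pure // Eg tassoc_pure.
- by rewrite Ei !tmap_pure // Ei tassoc_pure.
rewrite Ep (linD _ _ lm1) (linD _ _ lm2) !tmap_pure // Ep Eg D1.
rewrite (linD _ _ lta) !(bilinDl (@bilin_tpure _ _ _)) (linD _ _ lta) !tassoc_pure.
by rewrite !(bilinDr (@bilin_tpure _ _ _)) addrA.
Qed.

Lemma coprod_super_hopf : super_hopf D eps S.
Proof.
have [aD _ _] := coprod_hom; have [ae _ _] := counit_hom.
have [Eg Ei Ep] := coprod_gens; have [eg ei ep] := counit_gens.
have bs := @bilin_scale K Om.
have le : linear eps by case: ae.
have bl : bilin (fun a b : Om => eps a *: b).
  exact: (bilin_comp (f := eps) (g := id) bs).
have br : bilin (fun a b : Om => eps b *: a).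
  by split=> [w|v]; [apply: bl.2|apply: bl.1].
have e1 : eps 1 = 1 by case: ae => _ [].
split.
- by split=> // w; apply: (dga_hom_par w coprod_hom).
- by split=> // w; apply: counit_par.
- by split; [apply: antipode_lin|apply: antipode_par].
- exact: coprod_coassoc.
move=> w; split; [| |exact: antipode_left|exact: antipode_right].
- have h := dga_hom_comp coprod_hom (counitl_hom Om counit_hom).
  apply: (calc_hom_ext pc h (dga_hom_id Om)); rewrite ?Eg ?Ei ?Ep ?(tsumD _ _ bl) ?tsum_pure //.
  + by rewrite eg scale1r.
  + by rewrite ei scale1r.
  by rewrite e1 ep scale1r scale0r addr0.
have h := dga_hom_comp coprod_hom (counitr_hom Om counit_hom).
apply: (calc_hom_ext pc h (dga_hom_id Om)); rewrite ?Eg ?Ei ?Ep ?(tsumD _ _ br) ?tsum_pure //.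
- by rewrite eg scale1r.
- by rewrite ei scale1r.
by rewrite eg ep scale1r scale0r add0r.
Qed.

Local Notation i := (@calc_incl K lam Om g ginv p).

Lemma incl_tmap_hom (B : algType K) (Om' : dga K) (f : B -> Om') :
  alg_hom f -> (forall a, hc 0 (f a) = f a) ->
  alg_hom (tmap f i : stens (triv B) (triv (planck lam)) -> stens Om' Om).
Proof.
move=> hf df.
apply: (@tmap_alg_hom K (triv B) (triv (planck lam)) Om' Om) => //.
- exact: (incl_hom pc).
- case=> [|n] a ha; first exact: df.
  by rewrite -ha [hc _ a]/(0 : B) (lin0 hf.1) linear0.
case=> [|n] a ha; first exact: (incl_deg pc).
by rewrite -ha [hc _ a]/(0 : planck lam) (lin0 (incl_hom pc).1) linear0.
Qed.

Lemma coprod_strongly_bicovariant :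
  strongly_bicovariant (@planck_coprod _ lam) i D.
Proof.
have [aD Dh Dd] := coprod_hom; have [Eg Ei Ep] := coprod_gens.
have [ig ii ip] := incl_gens pc.
have li : linear i := (incl_hom pc).1.
have i1 : i 1 = 1 by have [_ _ _ -> _] := alg_homP (incl_hom pc).
split=> //; first by exists eps, S; apply: coprod_super_hopf.
have hp' : alg_hom
    (@planck_coprod K lam : planck lam -> stens (triv (planck lam)) (triv (planck lam))).
  exact: (plift_hom (planck_model lam) (planck_coprod_rels lam)).
have hr := alg_hom_comp hp' (incl_tmap_hom (incl_hom pc) (incl_deg pc)).
apply: (palg_hom_ext (alg_hom_comp (incl_hom pc) aD) hr) => j.
rewrite /planck_coprod plift_gen; last exact: (planck_coprod_rels lam).
case: j.
- by rewrite [i _]ig Eg tmap_pure // ig.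
- by rewrite [i _]ii Ei tmap_pure // ii.
by rewrite [i _]ip Ep (linD _ _ (tmap_lin li li)) !tmap_pure // ip ig i1.
Qed.

Local Notation L := (Omega_line lam).
Local Notation r := (li_r lam).

Fact coaction_ex : exists f : L -> stens L Om, dga_hom f /\ f r = 1 ⊗ p + r ⊗ g.
Proof.
apply: line_lift; first exact: coaction_deg (li_r_deg lam) hg hp.
exact: coaction_dsat char2 (li_r_deg lam) hg hp (line_relations lam).1 (calc_rels pc).
Qed.
Definition calc_coaction : L -> stens L Om := projT1 (cid coaction_ex).
Lemma coaction_hom : dga_hom calc_coaction.
Proof. by rewrite /calc_coaction; case: cid => f []. Qed.
Lemma coaction_r : calc_coaction r = 1 ⊗ p + r ⊗ g.
Proof. by rewrite /calc_coaction; case: cid => f []. Qed.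

Lemma poly_hom_ext (B : algType K) (f f' : {poly K} -> B) : alg_hom f -> alg_hom f' ->
  f 'X = f' 'X -> f =1 f'.
Proof.
move=> /alg_homP[fD fZ fM f1 f0] /alg_homP[gD gZ gM g1 g0] e.
apply: poly_ind => [|q c h]; first by rewrite f0 g0.
by rewrite fD gD fM gM h e -[c%:P]mulr1 mul_polyC fZ gZ f1 g1.
Qed.

Lemma horner_alg_hom (B : algType K) (b : B) : alg_hom (horner_alg b).
Proof.
split.
  by move=> c q s; rewrite rmorphD -mul_polyC rmorphM /= horner_algC mulr_algl.
by split=> [|q s]; rewrite ?rmorph1 ?rmorphM.
Qed.

Lemma coaction_differentiable :
  differentiable (@planck_coaction _ lam) (@line_incl _ lam) i.
Proof.
have [ig ii ip] := incl_gens pc.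
exists calc_coaction; first exact: coaction_hom.
have hl : alg_hom (@line_incl K lam) := horner_alg_hom r.
have lr : @line_incl K lam 'X = r by rewrite /line_incl horner_algX.
have dl a : hc 0 (@line_incl K lam a) = line_incl lam a.
  have [lD' lZ lM l1 l0] := alg_homP hl.
  elim/poly_ind: a => [|q c h]; first by rewrite l0 linear0.
  rewrite lD' lM lr linearD /= (hc_mul h (li_r_deg lam)).
  by rewrite -[c%:P]mulr1 mul_polyC lZ l1 linearZ /= hc_one.
have [aPhi _ _] := coaction_hom.
have hc' : alg_hom (@planck_coaction K lam : {poly K} -> stens (triv {poly K}) (triv (planck lam))).
  exact: horner_alg_hom.
have li : linear i := (incl_hom pc).1.
have i1 : i 1 = 1 by have [_ _ _ -> _] := alg_homP (incl_hom pc).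
apply: (poly_hom_ext (alg_hom_comp hl aPhi) (alg_hom_comp hc' (incl_tmap_hom hl dl))).
rewrite lr coaction_r /planck_coaction horner_algX.
rewrite (linD _ _ (tmap_lin hl.1 li)) !(tmap_pure _ _ hl.1 li) lr ip ig.
by have [_ _ _ -> _] := alg_homP hl.
Qed.
End HopfStructure.

(** * Universality *)

Section Universality.
Variables (K : fieldType) (lam : K).
Hypothesis char2 : (2%:R : K) != 0.
Local Notation L := (Omega_line lam).
Local Notation r := (li_r lam).
Local Notation pl := (planck lam).

Lemma line_eval (a : K) : exists f : L -> triv K^o, dga_hom f /\ f r = a.
Proof.
by apply: line_lift => //; split; rewrite /lie ?mulr0 ?mul0r ?subrr ?scaler0.
Qed.

Section Target.
Variables (Om' : dga K) (i' : pl -> Om').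
Hypothesis ext : exterior_algebra i'.
Hypothesis diff : differentiable (@planck_coaction _ lam) (@line_incl _ lam) i'.
Local Notation g := (i' (pl_g lam)).
Local Notation ginv := (i' (pl_ginv lam)).
Local Notation p := (i' (pl_p lam)).

Lemma ext_deg a : hc 0 (i' a) = i' a.
Proof. by case: ext => _ _ h _ _; apply/h; exists a. Qed.

(* Evaluating the line at r = a turns the coaction into a DGA map r |-> p + a g,
   so p + a g satisfies the relation of r for every scalar a. *)
Lemma pencil_rel a : lie (p + a *: g) (dd (p + a *: g)) = lam *: dd (p + a *: g).
Proof.
have [Phi hPhi ePhi] := diff; have [ev [hev evr]] := line_eval a.
pose h w := tsum (fun u v => ev u *: v) (Phi w).
have hh : dga_hom h := dga_hom_comp hPhi (counitl_hom Om' hev).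
have [hi _ _ _ _] := ext; have [_ _ _ i1 _] := alg_homP hi.
have hl : alg_hom (@line_incl K lam) := horner_alg_hom r.
have [_ _ _ l1 _] := alg_homP hl.
have ev1 : ev 1 = 1 by have [[_ [-> _]] _ _] := hev.
have bs : bilin (fun (u : L) (v : Om') => ev u *: v).
  exact: bilin_comp (bilin_scale Om') (dga_hom_lin hev) (fun _ _ _ => erefl).
have er : h r = p + a *: g.
  have <- : @line_incl K lam 'X = r by rewrite /line_incl horner_algX.
  rewrite /h ePhi /planck_coaction horner_algX.
  rewrite (linD _ _ (tmap_lin hl.1 hi.1)) !(tmap_pure _ _ hl.1 hi.1) (tsumD _ _ bs) !tsum_pure //.
  by rewrite [line_incl lam _]l1 ev1 scale1r /line_incl horner_algX evr.
have [ah _ hd] := hh; have [_ hZ _ _ _] := alg_homP ah.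
by rewrite -er -hd -(alg_hom_lie _ _ ah) (line_relations lam).1 hZ.
Qed.

Lemma target_planck_rels : planck_rels lam (planck_gens g ginv p).
Proof.
have [hi _ _ _ _] := ext; have [iD iZ iM i1 i0] := alg_homP hi.
have [h1 h2 h3] := planck_gen_rels lam.
split=> /=; first by rewrite -iM [X in i' X]h1.
  by rewrite -iM [X in i' X]h2.
by rewrite -(alg_hom_lie _ _ hi) [lie _ _]h3 iZ iM (alg_homB _ _ hi) i1.
Qed.

Lemma target_rels : omega_rels lam (form_gens g ginv p).
Proof.
have e0 := pencil_rel 0; have e1 := pencil_rel 1; have e2 := pencil_rel (-1).
rewrite scale0r addr0 in e0; rewrite scale1r in e1; rewrite scaleN1r in e2.
rewrite /lie !linearD /= !(mulrDl, mulrDr) in e1.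
rewrite /lie !linearD linearN /= !(mulrDl, mulrDr, mulrN, mulNr, opprK) in e2.
apply: omega_rels_of_sum => //; rewrite ?ext_deg //; first exact: target_planck_rels.
- rewrite /lie in e0 *; apply: (addself_inj char2); rewrite addr0.
  (* Second difference in a: twice the relation at 0 minus those at 1 and -1 isolates the quadratic
     coefficient, a multiple of [dg, g]. *)
  transitivity (lam *: dd p + lam *: dd p -
    ((lam *: dd p + lam *: dd g) + (lam *: dd p + lam *: - dd g)));
    last by linear_ring.
  by rewrite -e1 -e2 -e0; linear_ring.
rewrite /lie in e0 *; apply: (addself_inj char2).
(* First difference in a: the relation at 1 minus that at -1 is twice the linear coefficient. *)
transitivity ((lam *: dd p + lam *: dd g) - (lam *: dd p + lam *: - dd g)); last by linear_ring.
by rewrite -e1 -e2; linear_ring.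
Qed.

Section Map.
Variables (Om : dga K) (g0 ginv0 p0 : Om).
Hypothesis pc : planck_calculus lam g0 ginv0 p0.
Local Notation i := (@calc_incl K lam Om g0 ginv0 p0).

(** The map exists because the target satisfies all relations, and it is onto because the target is
    generated by functions and their differentials. Any D' is an algebra map that is prescribed in
    degree 0 and commutes with d, so it is compared with D on the form generators. *)
Lemma calc_universal : exists f : Om -> Om',
  [/\ dga_hom f, forall a, f (i a) = i' a, forall w', exists w, f w = w'
    & forall D' : Om' -> tens Om' Om',
        strongly_bicovariant (@planck_coprod _ lam) i' D' ->
        forall w, D' (f w) = tmap f f (calc_coprod char2 pc w)].
Proof.
have [f [hf fg fgi fp]] := calc_lift pc (ext_deg _) (ext_deg _) (ext_deg _) target_rels.
have [hi _ hi0 hi1 hgen] := ext; have [af fh fd] := hf.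
have [fD fZ fM f1 f0] := alg_homP af.
have [ig ii ip] := incl_gens pc.
have fi a : f (i a) = i' a.
  apply: (palg_hom_ext (alg_hom_comp (incl_hom pc) af) hi) => -[].
  - by rewrite [i _]ig.
  - by rewrite [i _]ii.
  by rewrite [i _]ip.
exists f; split=> //.
  apply: hgen => [w' [|]|v w [a <-] [b <-]|v w [a <-] [b <-]].
  - by case/hi0 => a ->; exists (i a).
  - case/hi1 => s ->; exists (\sum_(ab <- s) i ab.1 * dd (i ab.2)).
    by rewrite (lin_sum _ _ _ af.1); apply: eq_bigr => ab _; rewrite fM fd !fi.
  - by exists (a + b).
  by exists (a * b).
move=> D' [[eps [S [[hD' _] _ _ _ _]]] _ D'i D'd].
have [hD _ Dd] := coprod_hom char2 pc.
have [_ _ Di _] := coprod_strongly_bicovariant char2 pc.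
have [hff _ ffd] := tmap_hom hf hf.
have key a : D' (f (i a)) = tmap f f (calc_coprod char2 pc (i a)).
  rewrite fi D'i Di tmap_tmap; [|exact: af.1|exact: af.1].
  by apply: eq_tmap => b; rewrite fi.
have kg := key (pl_g lam); have ki := key (pl_ginv lam); have kp := key (pl_p lam).
rewrite ig in kg; rewrite ii in ki; rewrite ip in kp.
apply: (calc_alg_ext pc (alg_hom_comp af hD') (alg_hom_comp hD hff)) => -[] //=.
  by rewrite fd D'd kg Dd ffd.
by rewrite fd D'd kp Dd ffd.
Qed.
End Map.
End Target.
End Universality.

(** * The action on the torus *)

Section Euler.
Variable K : fieldType.
Local Notation T := (Omega_torus K).
Local Notation tg := (to_g K).
Local Notation tgi := (to_ginv K).
Let hg := to_g_deg K.
Let hgi := to_ginv_deg K.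

Lemma to_g_central (t : T) : tg * t = t * tg.
Proof.
have [e1 e2 e3 _] := to_relations K.
elim/torus_ind: t => // [| |c|a b ha hb|a b ha hb].
- by rewrite e1 e2.
- by apply/esym/eqP; rewrite -subr_eq0; apply/eqP.
- by rewrite mulr_algr mulr_algl.
- by rewrite mulrDl mulrDr ha hb.
by rewrite mulrA ha -mulrA hb mulrA.
Qed.

Lemma to_dg_supercentral (t : T) : dd tg * t = par t * dd tg.
Proof.
have [e1 e2 e3 e4] := to_relations K.
elim/torus_ind: t => // [| | |c|a b ha hb|a b ha hb].
- by rewrite (par_hom hg) scale1r to_g_central.
- rewrite (par_hom hgi) scale1r -[LHS]mul1r -e2 -mulrA [tg * (_ * _)]mulrA.
  by rewrite to_g_central -!mulrA e1 mulr1.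
- by rewrite (par_hom (hc_dd hg)) scaleN1r mulNr e4 oppr0.
- by rewrite parZ par_1 mulr_algr mulr_algl.
- by rewrite parD mulrDl mulrDr ha hb.
by rewrite par_mul mulrA ha -mulrA hb mulrA.
Qed.

(* Dual numbers inside the 2 x 2 matrices: the DGA map g |-> g (1 + e) has the
   derivation g d/dg (extended to forms) as its coefficient of e. *)
Let M := 'M[K]_2.
Let e : M := delta_mx 0 1.
Let ee : e * e = 0.
Proof. by rewrite /e -[_ * _]/(_ *m _) mul_delta_mx_0. Qed.

Let bt := @bilin_tpure K T (triv M).

Let h0 (m : triv M) : hc 0 m = m. Proof. by []. Qed.
Let me (x y : T) (m n : triv M) : (x ⊗ m : stens T (triv M)) * (y ⊗ n) = (x * y) ⊗ (m * n).
Proof.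
elim/hc_indh: y => [|y y' hy hy'|k y hy].
- by rewrite (bilin0l bt) !mulr0 (bilin0l bt).
- by rewrite (bilinDl bt) !mulrDr (bilinDl bt) hy hy'.
by rewrite (stens_mulE _ _ (h0 _) hy) scale1r.
Qed.

Fact euler_ex : exists f : T -> stens T (triv M),
  [/\ dga_hom f, f tg = tg ⊗ (1 + e) & f tgi = tgi ⊗ (1 - e)].
Proof.
have [e1 e2 e3 e4] := to_relations K.
have hdg := hc_dd hg.
apply: torus_lift; [by rewrite (stens_hcE _ hg (h0 _))|by rewrite (stens_hcE _ hgi (h0 _))|].
have d0 (m : triv M) : dd m = 0 by [].
have cg : dd tg * tg = tg * dd tg by rewrite to_g_central.
have m1 : (1 + e) * (1 - e) = 1 :> M.
  by rewrite mulrBr !mulrDl !mul1r mulr1 ee addr0 addrK.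
have m2 : (1 - e) * (1 + e) = 1 :> M.
  by rewrite mulrBl !mulrDr !mulr1 mul1r ee addr0 addrK.
split; rewrite /= ?(stens_ddE _ hg) ?d0 ?(bilin0r bt) ?scaler0 ?addr0 /lie.
- by rewrite (stens_mulE _ _ (h0 _) hgi) scale1r e1 [X in _ ⊗ X]m1.
- by rewrite (stens_mulE _ _ (h0 _) hg) scale1r e2 [X in _ ⊗ X]m2.
- by rewrite (stens_mulE _ _ (h0 _) hg) (stens_mulE _ _ (h0 _) hdg) !scale1r cg subrr.
by rewrite (stens_mulE _ _ (h0 _) hdg) e4 (bilin0l bt) scaler0.
Qed.
Let tau : T -> stens T (triv M) := projT1 (cid euler_ex).
Let tau_hom : dga_hom tau.
Proof. by rewrite /tau; case: cid => f []. Qed.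
Let tau_g : tau tg = tg ⊗ (1 + e).
Proof. by rewrite /tau; case: cid => f []. Qed.
Let tau_gi : tau tgi = tgi ⊗ (1 - e).
Proof. by rewrite /tau; case: cid => f []. Qed.

Definition euler (t : T) : T := tsum (fun u (m : M) => m 0 1 *: u) (tau t).

Let bl01 : @bilin K T (triv M) T (fun u (m : M) => m 0 1 *: u).
Proof.
have bs := @bilin_scale K T.
split=> [m|u] c a b; first exact: bs.2.
by rewrite !mxE; apply: bs.1.
Qed.

Let tauE_of t u : tau t = t ⊗ (1 : triv M) + u ⊗ (e : triv M) -> euler t = u.
Proof.
move=> h; rewrite /euler h (tsumD _ _ bl01) !tsum_pure //.
by rewrite !mxE /= scale0r add0r scale1r.
Qed.

Let tau_dg : tau (dd tg) = dd tg ⊗ (1 : triv M) + dd tg ⊗ (e : triv M).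
Proof.
have [_ _ ->] := tau_hom; rewrite tau_g (stens_ddE _ hg).
by rewrite [dd (1 + e : triv M)]/(0 : M) (bilin0r bt) scaler0 addr0 (bilinDr bt).
Qed.

Let tauE t : tau t = t ⊗ (1 : triv M) + euler t ⊗ (e : triv M).
Proof.
suff [u hu] : exists u, tau t = t ⊗ (1 : triv M) + u ⊗ (e : triv M).
  by rewrite (tauE_of hu).
have [af _ _] := tau_hom; have [fD fZ fM f1 f0] := alg_homP af.
elim/torus_ind: t => [| | |c|a b [u hu] [v hv]|a b [u hu] [v hv]].
- by exists tg; rewrite tau_g (bilinDr bt).
- by exists (- tgi); rewrite tau_gi (bilinDr bt) -!scaleN1r (bilinZr bt) (bilinZl bt).
- by exists (dd tg); apply: tau_dg.
- by exists 0; rewrite fZ f1 (bilin0l bt) addr0 (bilinZl bt).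
- by exists (u + v); rewrite fD hu hv !(bilinDl bt) addrACA.
exists (a * v + u * b); rewrite fM hu hv.
rewrite mulrDl !mulrDr !me [(e : triv M) * e]ee !mulr1 mul1r (bilin0r bt) addr0.
by rewrite (bilinDl bt) -addrA.
Qed.

Lemma euler_lin : linear euler.
Proof.
move=> c a b; rewrite /euler (dga_hom_lin tau_hom).
exact: tsum_lin bl01 _ _ _.
Qed.

Lemma euler_mul a b : euler (a * b) = euler a * b + a * euler b.
Proof.
have [af _ _] := tau_hom; have [fD fZ fM f1 f0] := alg_homP af.
apply: tauE_of; rewrite fM !tauE mulrDl !mulrDr !me [(e : triv M) * e]ee !mulr1 mul1r.
by rewrite (bilin0r bt) addr0 (bilinDl bt) -addrA [X in _ + X]addrC.
Qed.

Lemma euler_g : euler tg = tg.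
Proof. by apply: tauE_of; rewrite tau_g (bilinDr bt). Qed.
Lemma euler_dg : euler (dd tg) = dd tg.
Proof. exact: tauE_of tau_dg. Qed.
Lemma euler_one : euler 1 = 0.
Proof.
have := euler_mul 1 1; rewrite !mulr1 mul1r => h.
by apply: (@addrI _ (euler 1)); rewrite addr0.
Qed.
Lemma euler_deg n t : hc n t = t -> hc n (euler t) = euler t.
Proof.
move=> ht; apply/esym/tauE_of.
have [_ th _] := tau_hom; have := th n t; rewrite ht {2}tauE linearD /=.
have hm (x : T) (m : triv M) : hc n (x ⊗ m : stens T (triv M)) = hc n x ⊗ m.
  elim/hc_indh: x => [|y y' hy hy'|k y hy].
  - by rewrite (bilin0l bt) !linear0 (bilin0l bt).
  - by rewrite (bilinDl bt) !linearD (bilinDl bt) /= hy hy'.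
  rewrite (stens_hcE _ hy (h0 _)) addn0 (hcK _ hy).
  by case: ifP => _; rewrite ?(bilin0l bt).
by rewrite !hm ht.
Qed.
End Euler.

(** * The action of p and dp on torus forms, and the projections to torus and line *)

Section Action.
Variables (K : fieldType) (lam : K).
Local Notation T := (Omega_torus K).
Local Notation L := (Omega_line lam).
Local Notation tg := (to_g K).
Local Notation tgi := (to_ginv K).
Local Notation r := (li_r lam).
Local Notation E := (@euler K).
Let hg := to_g_deg K.
Let hgi := to_ginv_deg K.
Let hdg := hc_dd hg.

Definition act_p (t : T) : T := lam *: ((1 - tg) * E t).
(* On Omega_torus, g dt = dg E t, so this is also t |-> - lam g dt. *)
Definition act_dp (t : T) : T := - (lam *: (dd tg * E t)).

Fact act_p_lin : linear act_p.
Proof.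
by move=> c a b; rewrite /act_p euler_lin mulrDr -scalerAr scalerDr !scalerA [lam * c]mulrC.
Qed.
Fact act_dp_lin : linear act_dp.
Proof.
by move=> c a b; rewrite /act_dp euler_lin mulrDr -scalerAr; linear_ring.
Qed.
Fact lmul_lin (s : T) : linear (fun t : T => s * t).
Proof. by move=> c a b; rewrite mulrDr scalerAr. Qed.
Definition lmul (s : T) : lend T := Lend (lmul_lin s).

Definition rep_op (j : omega_gen) : lend T :=
  match j with
  | Og => lmul tg | Oginv => lmul tgi | Odg => lmul (dd tg)
  | Op => Lend act_p_lin | Odp => Lend act_dp_lin
  end.

Lemma act_p_mul a b : act_p (a * b) = act_p a * b + a * act_p b.
Proof.
have c1 : a * (1 - tg) = (1 - tg) * a.
  by rewrite mulrBr mulrBl mulr1 mul1r to_g_central.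
rewrite /act_p euler_mul mulrDr scalerDr -scalerAl -scalerAr; congr (_ *: _ + _ *: _).
  by rewrite mulrA.
by rewrite !mulrA c1.
Qed.

Lemma act_dp_mul a b : act_dp (a * b) = act_dp a * b + par a * act_dp b.
Proof.
rewrite /act_dp euler_mul mulrDr scalerDr opprD mulNr mulrN -scalerAl -scalerAr.
by congr (- (_ *: _) - _ *: _); rewrite mulrA // to_dg_supercentral mulrA.
Qed.

Lemma act_p_g : act_p tg = lam *: ((1 - tg) * tg).
Proof. by rewrite /act_p euler_g. Qed.
Lemma act_dp_g : act_dp tg = - (lam *: (tg * dd tg)).
Proof. by rewrite /act_dp euler_g to_g_central. Qed.
Lemma act_p_dg : act_p (dd tg) = lam *: ((1 - tg) * dd tg).
Proof. by rewrite /act_p euler_dg. Qed.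
Lemma act_dp_dg : act_dp (dd tg) = 0.
Proof.
by have [_ _ _ e4] := to_relations K; rewrite /act_dp euler_dg e4 scaler0 oppr0.
Qed.
Lemma act_p_one : act_p 1 = 0.
Proof. by rewrite /act_p euler_one mulr0 scaler0. Qed.
Lemma act_dp_one : act_dp 1 = 0.
Proof. by rewrite /act_dp euler_one mulr0 scaler0 oppr0. Qed.

Lemma rep_op_deg j n t : hc n t = t -> hc (form_deg j + n) (rep_op j t) = rep_op j t.
Proof.
have h1g : hc 0 (1 - tg) = 1 - tg by rewrite linearB /= hc_one hg.
move=> ht; have he := euler_deg ht; case: j => /=.
- exact: (hc_mul hg ht).
- exact: (hc_mul hgi ht).
- by rewrite /act_p linearZ /= (hc_mul h1g he).
- exact: (hc_mul hdg ht).
by rewrite /act_dp linearN linearZ /= (hc_mul hdg he).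
Qed.

Fact rep_op_rels : omega_rels lam rep_op.
Proof.
have [e1 e2 e3 e4] := to_relations K.
have cg (t : T) : t * tg = tg * t by rewrite to_g_central.
have dgt (s t : T) : s * dd tg * t = s * (dd tg * t) by rewrite mulrA.
split; split; apply: lendP => t;
  rewrite ?(lendD, lendN, lendM, lendZ, lend1, lend0) /=.
- by rewrite mulrA e1 mul1r.
- by rewrite mulrA e2 mul1r.
- rewrite act_p_mul act_p_g -scalerAl.
  by rewrite addrK mulrBl mul1r mulrBl mulrA.
- by rewrite !mulrA cg subrr.
- have edp : E (act_dp t) = - (lam *: (dd tg * E t + dd tg * E (E t))).
    rewrite /act_dp -!scaleNr (linZ _ _ (@euler_lin K)) euler_mul euler_dg //.
  have ep : E (act_p t) = lam *: ((1 - tg) * E (E t) - tg * E t).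
    rewrite /act_p (linZ _ _ (@euler_lin K)) euler_mul -scaleN1r.
    rewrite (linD _ _ (@euler_lin K)) euler_one (linZ _ _ (@euler_lin K)) euler_g.
    by rewrite add0r scaleN1r mulNr addrC.
  have -> : act_p (act_dp t) = lam *: ((1 - tg) * E (act_dp t)) by [].
  have -> : act_dp (act_p t) = - (lam *: (dd tg * E (act_p t))) by [].
  rewrite edp ep.
  rewrite -!scaleN1r !(mulrDl, mulrDr, mul1r, =^~ scalerAl, =^~ scalerAr) !mulrA to_g_central.
  rewrite /act_dp; linear_ring.
- rewrite /act_dp euler_mul euler_g mulrDr mulrN -scalerAr !mulrA to_g_central.
  by linear_ring.
- rewrite act_p_mul act_p_dg -scalerAl addrK mulrBl mul1r mulrBl mulrA //.
- rewrite /act_dp -!scaleNr (linZ _ _ (@euler_lin K)) euler_mul euler_dg.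
  by rewrite -scalerAr mulrDr !mulrA e4 !mul0r addr0 !scaler0.
- by rewrite mulrA e4 mul0r.
rewrite /act_dp euler_mul euler_dg mulrDr !mulrA e4 !mul0r addr0 scaler0 oppr0.
by rewrite mulrN -scalerAr mulrA e4 mul0r scaler0 !oppr0.
Qed.

Section Rep.
Variables (Om : dga K) (g ginv p : Om).
Hypothesis pc : planck_calculus lam g ginv p.
Local Notation x := (form_gens g ginv p).

Fact rep_ex : exists f : Om -> lend T, alg_hom f /\ forall j, f (x j) = rep_op j.
Proof. exact: (calc_alg_lift pc rep_op_rels). Qed.
Definition rep : Om -> lend T := projT1 (cid rep_ex).
Lemma rep_hom : alg_hom rep. Proof. by rewrite /rep; case: cid => f []. Qed.
Lemma rep_gen j : rep (x j) = rep_op j. Proof. by rewrite /rep; case: cid => f []. Qed.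

Fact torus_map_ex : exists f : T -> Om, [/\ dga_hom f, f tg = g & f tgi = ginv].
Proof.
apply: torus_lift; [exact: pc_g pc|exact: pc_ginv pc|].
by have [[a1 a2 a3] [b1 b2 b3 b4] [c1 c2 c3]] := calc_rels pc.
Qed.
Definition torus_map : T -> Om := projT1 (cid torus_map_ex).
Lemma torus_map_hom : dga_hom torus_map.
Proof. by rewrite /torus_map; case: cid => f []. Qed.
Lemma torus_map_gens : torus_map tg = g /\ torus_map tgi = ginv.
Proof. by rewrite /torus_map; case: cid => f []. Qed.

Fact line_map_ex : exists f : L -> Om, dga_hom f /\ f r = p.
Proof.
apply: line_lift; first exact: pc_p pc.
by have [[a1 a2 a3] [b1 b2 b3 b4] [c1 c2 c3]] := calc_rels pc.
Qed.
Definition line_map : L -> Om := projT1 (cid line_map_ex).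
Lemma line_map_hom : dga_hom line_map.
Proof. by rewrite /line_map; case: cid => f []. Qed.
Lemma line_map_r : line_map r = p.
Proof. by rewrite /line_map; case: cid => f []. Qed.

Fact line_proj_ex : exists f : Om -> L, [/\ dga_hom f, f g = 1, f ginv = 1 & f p = r].
Proof.
have [l1 l2] := line_relations lam.
apply: (calc_lift pc); rewrite ?hc_one ?li_r_deg //.
by split; split; rewrite /lie /= ?dd_one ?mulr1 ?mul1r ?subrr ?mul0r ?mulr0 ?subrr
  ?scaler0 ?subr0 ?oppr0.
Qed.
Definition line_proj : Om -> L := projT1 (cid line_proj_ex).
Lemma line_proj_hom : dga_hom line_proj.
Proof. by rewrite /line_proj; case: cid => f []. Qed.
Lemma line_proj_gens : [/\ line_proj g = 1, line_proj ginv = 1 & line_proj p = r].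
Proof. by rewrite /line_proj; case: cid => f []. Qed.

Local Notation jT := torus_map.
Local Notation jL := line_map.
Local Notation piL := line_proj.

(** Since p and dp annihilate 1, this kills the left ideal that they generate. It is a map of left
    modules over the calculus but not of algebras, unlike [piL]. *)
Definition torus_proj (w : Om) : T := rep w 1.
Local Notation piT := torus_proj.
(** Since t = rep (jT t) 1, this is the projection to the torus of the product h t in the calculus:
    the action is what left multiplication induces on the quotient. *)
Definition line_act (h : L) (t : T) : T := rep (jL h) t.

Lemma torus_map_dg : jT (dd tg) = dd g.
Proof. by have [_ _ ->] := torus_map_hom; rewrite (torus_map_gens).1. Qed.
Lemma line_map_dr : jL (dd r) = dd p.
Proof. by have [_ _ ->] := line_map_hom; rewrite line_map_r. Qed.

Lemma rep_torus (s t : T) : rep (jT s) t = s * t.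
Proof.
have [aT _ _] := torus_map_hom; have [tg1 tg2] := torus_map_gens.
have al : alg_hom lmul.
  split; first by move=> c a b; apply: lendP => u; rewrite lendD lendZ /= mulrDl scalerAl.
  split; first by apply: lendP => u; rewrite lend1 /= mul1r.
  by move=> a b; apply: lendP => u; rewrite lendM /= mulrA.
have -> // : rep (jT s) = lmul s.
apply: (torus_hom_alg_ext (alg_hom_comp aT rep_hom) al).
- by rewrite tg1 (rep_gen Og).
- by rewrite tg2 (rep_gen Oginv).
by rewrite torus_map_dg (rep_gen Odg).
Qed.

Lemma repM u v t : rep (u * v) t = rep u (rep v t).
Proof. by have [_ _ fM _ _] := alg_homP rep_hom; rewrite fM. Qed.
Lemma repD u v t : rep (u + v) t = rep u t + rep v t.
Proof. by have [fD _ _ _ _] := alg_homP rep_hom; rewrite fD. Qed.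
Lemma repZ c u t : rep (c *: u) t = c *: rep u t.
Proof. by have [_ fZ _ _ _] := alg_homP rep_hom; rewrite fZ. Qed.
Lemma rep1 t : rep 1 t = t.
Proof. by have [_ _ _ f1 _] := alg_homP rep_hom; rewrite f1. Qed.

Lemma rep_bilin : bilin (fun u t => rep u t).
Proof.
split=> [t|u] c a b; first by rewrite repD repZ.
exact: lend_lin.
Qed.

Lemma rep_deg m n w t : hc m w = w -> hc n t = t -> hc (m + n) (rep w t) = rep w t.
Proof.
move=> <-; move: m n t; elim/(calc_left_ind pc): w => [|a b ha hb|c a ha|j a ha] m n t ht.
- rewrite (hcK _ (hc_one _)); case: eqP => [->|_]; first by rewrite rep1.
  by rewrite (bilin0l rep_bilin) linear0.
- by rewrite linearD /= repD linearD /= ha ?hb.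
- by rewrite linearZ /= repZ linearZ /= ha.
have hj := calc_deg pc j; have [lt|le] := ltnP m (form_deg j).
  by rewrite (hc_mull_small _ hj) // (bilin0l rep_bilin) linear0.
rewrite -(subnKC le) (hc_mull _ _ hj) repM rep_gen -addnA.
by apply: rep_op_deg; apply: ha.
Qed.

Lemma torus_proj_lin : linear piT.
Proof. by move=> c a b; rewrite /piT repD repZ. Qed.
Lemma torus_proj_deg n w : hc n w = w -> hc n (piT w) = piT w.
Proof. by move=> hw; have := rep_deg hw (hc_one T); rewrite addn0. Qed.
Lemma torus_proj_mulT t w : piT (jT t * w) = t * piT w.
Proof. by rewrite /piT repM rep_torus. Qed.
Lemma torus_proj_gen j w : piT (x j * w) = rep_op j (piT w).
Proof. by rewrite /piT repM rep_gen. Qed.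
Lemma torus_proj1 : piT 1 = 1.
Proof. exact: rep1. Qed.

Lemma line_act_lin_l : bilin line_act.
Proof.
exact: (bilin_comp (f := jL) (g := id) rep_bilin (dga_hom_lin line_map_hom)).
Qed.
Lemma line_act_deg m n h a : hc m h = h -> hc n a = a ->
  hc (m + n) (line_act h a) = line_act h a.
Proof. by move=> hh ha; apply: rep_deg => //; apply: dga_hom_deg line_map_hom hh. Qed.
Lemma line_act_one a : line_act 1 a = a.
Proof. by have [[_ [j1 _]] _ _] := line_map_hom; rewrite /line_act j1 rep1. Qed.
Lemma line_act_mul h k a : line_act (h * k) a = line_act h (line_act k a).
Proof. by have [[_ [_ jM]] _ _] := line_map_hom; rewrite /line_act jM repM. Qed.
Lemma line_act_r a : line_act r a = act_p a.
Proof. by rewrite /line_act line_map_r (rep_gen Op). Qed.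
Lemma line_act_dr a : line_act (dd r) a = act_dp a.
Proof. by rewrite /line_act line_map_dr (rep_gen Odp). Qed.
Lemma line_act_unit h : line_act h 1 = (line_counit h)%:A.
Proof.
have [[el [e1 eM]] _ ed] := line_counit_hom lam.
have ba := line_act_lin_l.
elim/line_left_ind: h => [|a b ha hb|c a ha|a ha|a ha].
- by rewrite line_act_one [line_counit 1]e1 scale1r.
- by rewrite (bilinDl ba) ha hb (linD _ _ el) scalerDl.
- by rewrite (bilinZl ba) ha (linZ _ _ el) scalerA.
- rewrite line_act_mul ha (bilinZr ba) line_act_r act_p_one scaler0.
  by rewrite [line_counit _]eM line_counit_r mul0r scale0r.
rewrite line_act_mul ha (bilinZr ba) line_act_dr act_dp_one scaler0.
by rewrite [line_counit _]eM [line_counit (dd _)]ed mul0r scale0r.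
Qed.

Lemma torus_proj_mulL w h : piT (w * jL h) = line_counit h *: piT w.
Proof.
rewrite /piT repM [rep (jL h) 1]line_act_unit.
exact: (bilinZr rep_bilin).
Qed.

Local Notation Dl := (@line_coprod K lam).
Let LL := stens L L.
Let rl := li_r_deg lam.
Let drl := hc_dd rl.
Let h1 := hc_one L.

Lemma line_coprod_mulr h : Dl (r * h) = ((r ⊗ 1 : LL) + 1 ⊗ r) * Dl h.
Proof.
have [[_ [_ DM]] _ _] := line_coprod_hom lam.
by rewrite [line_coprod _]DM line_coprod_r.
Qed.
Lemma line_coprod_muldr h : Dl (dd r * h) = ((dd r ⊗ 1 : LL) + 1 ⊗ dd r) * Dl h.
Proof.
have [[_ [_ DM]] _ Dd] := line_coprod_hom lam.
rewrite [line_coprod _]DM [line_coprod _]Dd line_coprod_r linearD /=.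
rewrite (stens_ddE _ rl) (stens_ddE _ h1) dd_one (bilin0r (@bilin_tpure _ _ _)).
by rewrite (bilin0l (@bilin_tpure _ _ _)) scaler0 addr0 add0r scale1r.
Qed.

(** By induction on h this reduces to r and dr. Both are primitive, so the rule says that [act_p] is
    a derivation and [act_dp] a graded one. *)
Lemma line_act_product h a b : line_act h (a * b) =
  \tsum_(h1, h2 <- Dl h) kos (fun h2 a => line_act h1 a * line_act h2 b) h2 a.
Proof.
have ba := line_act_lin_l.
have bk k1 : bilin (fun (h2 : L) (a : T) => line_act k1 a * line_act h2 b).
  split=> [y|y] c u v.
    by rewrite (bilinDl ba) (bilinZl ba) mulrDr scalerAr.
  by rewrite (bilinDr ba) (bilinZr ba) mulrDl scalerAl.
have bF c : bilin (fun k1 k2 : L => kos (fun h2 a => line_act k1 a * line_act h2 b) k2 c).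
  split=> [y|y] c' u v; last exact: (bilin_kos (bk y)).1.
  by apply: kos_addl => b' d'; rewrite (bilinDl ba) (bilinZl ba) mulrDl scalerAl.
elim/hc_indh: a => [|u v hu hv|n a ha].
- rewrite mul0r (bilin0r ba) /tsum big1 // => z _.
  exact: (bilin0r (bilin_kos (bk _))).
- rewrite mulrDl (bilinDr ba) hu hv /tsum -big_split; apply: eq_bigr => z _ /=.
  by rewrite (bilinDr (bilin_kos (bk _))).
pose F t := \tsum_(h1, h2 <- t) kos (fun h2 a => line_act h1 a * line_act h2 b) h2 a.
have lF : linear F := tsum_lin (bF a).
have FP m e1 e2 : hc m e2 = e2 ->
    F (e1 ⊗ e2) = (-1) ^+ (m * n) *: (line_act e1 a * line_act e2 b).
  by move=> h2; rewrite /F tsum_pure // (kos_hom (bk e1) h2 ha).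
have Fr (t : LL) : F (((r ⊗ 1 : LL) + 1 ⊗ r) * t) = act_p (F t).
  elim/tens_indh: t => [|t u ht hu|i j e1 e2 he1 he2].
  - by rewrite mulr0 !(lin0 lF) (lin0 act_p_lin).
  - by rewrite mulrDr !(linD _ _ lF) ht hu (linD _ _ act_p_lin).
  rewrite mulrDl (stens_mulE _ _ h1 he1) (stens_mulE _ _ rl he1) !mul0n !scale1r !mul1r.
  rewrite (linD _ _ lF) !(FP j) //; last by rewrite -[j]/(0 + j)%N (hc_mul rl he2).
  rewrite (linZ _ _ act_p_lin) act_p_mul !line_act_mul !line_act_r.
  by rewrite scalerDr.
have Fd (t : LL) : F (((dd r ⊗ 1 : LL) + 1 ⊗ dd r) * t) = act_dp (F t).
  elim/tens_indh: t => [|t u ht hu|i j e1 e2 he1 he2].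
  - by rewrite mulr0 !(lin0 lF) (lin0 act_dp_lin).
  - by rewrite mulrDr !(linD _ _ lF) ht hu (linD _ _ act_dp_lin).
  rewrite mulrDl (stens_mulE _ _ h1 he1) (stens_mulE _ _ drl he1) mul0n mul1n scale1r !mul1r.
  rewrite (linD _ _ lF) (linZ _ _ lF) !(FP j _ _ he2) (FP j.+1 _ _ (hc_mul drl he2)).
  rewrite (linZ _ _ act_dp_lin) act_dp_mul !line_act_mul !line_act_dr.
  rewrite (par_hom (line_act_deg he1 ha)) scalerDr -[_ * act_dp _ in RHS]scalerAl !scalerA -!exprD.
  by have -> : (i + j.+1 * n = j * n + (i + n))%N by rewrite mulSn addnA addnC.
rewrite -/(F (Dl h)).
elim/line_left_ind: h => [|u v hu hv|c u hu|u hu|u hu].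
- have [[_ [D1 _]] _ _] := line_coprod_hom lam.
  by rewrite line_act_one [Dl 1]D1 (FP 0%N) // scale1r !line_act_one.
- by rewrite (bilinDl ba) hu hv (linD _ _ (dga_hom_lin (line_coprod_hom lam))) (linD _ _ lF).
- by rewrite (bilinZl ba) hu (linZ _ _ (dga_hom_lin (line_coprod_hom lam))) (linZ _ _ lF).
- by rewrite line_act_mul line_act_r hu line_coprod_mulr Fr.
by rewrite line_act_mul line_act_dr hu line_coprod_muldr Fd.
Qed.

Lemma line_act_planck : planck_action line_act.
Proof.
split; rewrite ?line_act_r ?line_act_dr.
- split; [|exact: line_act_one|exact: line_act_mul|exact: line_act_unit|exact: line_act_product].
  by split; [exact: line_act_lin_l|exact: line_act_deg].
- exact: act_p_g.
- exact: act_dp_g.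
- exact: act_p_dg.
exact: act_dp_dg.
Qed.
End Rep.
End Action.

(** * The bicrossproduct *)

Section KoszulCalculus.
Variable K : fieldType.

Lemma eq_kos (A B : dga K) (U : lmodType K) (F G : A -> B -> U) b c :
  (forall b c, F b c = G b c) -> kos F b c = kos G b c.
Proof.
by move=> e; apply: eq_bigr => i _; apply: eq_bigr => j _; rewrite e.
Qed.

Lemma lin_kos (A B : dga K) (U V : lmodType K) (f : U -> V) (F : A -> B -> U) b c :
  linear f -> f (kos F b c) = kos (fun b c => f (F b c)) b c.
Proof.
move=> lf; rewrite /kos (lin_sum _ _ _ lf); apply: eq_bigr => i _.
by rewrite (lin_sum _ _ _ lf); apply: eq_bigr => j _; rewrite (linZ _ _ lf).
Qed.

Lemma kos_map (A B A' B' : dga K) (U : lmodType K) (F : A' -> B' -> U)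
  (f : A -> A') (g : B -> B') b c : bilin F -> linear f -> linear g ->
  (forall n w, hc n w = w -> hc n (f w) = f w) ->
  (forall n w, hc n w = w -> hc n (g w) = g w) ->
  kos F (f b) (g c) = kos (fun b c => F (f b) (g c)) b c.
Proof.
move=> bF lf lg df dg; have bG := bilin_comp bF lf lg.
have bk := bilin_kos bF; have bk' := bilin_kos bG.
elim/hc_indh: b => [|u v hu hv|m b hb].
- by rewrite (lin0 lf) (bilin0l bk) (bilin0l bk').
- by rewrite (linD _ _ lf) (bilinDl bk) (bilinDl bk') hu hv.
elim/hc_indh: c => [|u v hu hv|n c hc'].
- by rewrite (lin0 lg) (bilin0r bk) (bilin0r bk').
- by rewrite (linD _ _ lg) (bilinDr bk) (bilinDr bk') hu hv.
by rewrite (kos_hom bF (df _ _ hb) (dg _ _ hc')) (kos_hom bG hb hc').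
Qed.

Lemma stens_mul_kos (A B : dga K) (a c : A) (b e : B) :
  (a ⊗ b : stens A B) * (c ⊗ e) = kos (fun b c => (a * c) ⊗ (b * e)) b c.
Proof.
have bF : @bilin K B A (stens A B) (fun b c => (a * c) ⊗ (b * e)) := bl_bc a e.
have bk := bilin_kos bF; have bt := @bilin_tpure K A B.
elim/hc_indh: b => [|u v hu hv|m b hb].
- by rewrite (bilin0l bk) (bilin0r bt) mul0r.
- by rewrite (bilinDl bk) (bilinDr bt) mulrDl hu hv.
elim/hc_indh: c => [|u v hu hv|n c hc'].
- by rewrite (bilin0r bk) (bilin0l bt) mulr0.
- by rewrite (bilinDr bk) (bilinDl bt) mulrDr hu hv.
by rewrite (kos_hom bF hb hc') (stens_mulE _ _ hb hc').
Qed.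

Lemma tmap_tassoc (A B C X : dga K) (W : lmodType K) (N : stens B C -> W)
  (f : X -> stens A B) (t : stens X C) : linear N ->
  tmap id N (tassoc (tmap f id t)) =
  tsum (fun x c => tsum (fun a b => a ⊗ N (b ⊗ c)) (f x)) t.
Proof.
move=> lN; have lm : linear (@tmap K A (stens B C) A W id N) by apply: tmap_lin.
rewrite tassoc_tmap (lin_tsum _ _ lm); apply: eq_tsum => x c.
by rewrite (lin_tsum _ _ lm); apply: eq_tsum => a b; rewrite tmap_pure.
Qed.

Lemma tmap_hc (A B A' B' : dga K) (f : A -> A') (g : B -> B') n (t : stens A B) :
  linear f -> linear g ->
  (forall n w, hc n w = w -> hc n (f w) = f w) ->
  (forall n w, hc n w = w -> hc n (g w) = g w) ->
  tmap f g (hc n t) = hc n (tmap f g t : stens A' B').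
Proof.
move=> lf lg df dg; have lt := tmap_lin lf lg.
elim/tens_indh: t => [|x y hx hy|i j a b ha hb].
- by rewrite !(linear0, lin0 lt).
- by rewrite linearD /= !(linD _ _ lt) hx hy linearD.
rewrite (stens_hcE _ ha hb) tmap_pure // (stens_hcE _ (df _ _ ha) (dg _ _ hb)).
by case: ifP => // _; rewrite ?tmap_pure // (lin0 lt).
Qed.

(** Conjugation by g^-1 carries a commutation rule with g to one with g^-1. *)
Lemma conj_step (A : pzRingType) (u a g ginv : A) : g * ginv = 1 -> ginv * g = 1 ->
  u * g = a + g * u -> u * ginv = - (ginv * a * ginv) + ginv * u.
Proof.
move=> e1 e2 h; have := congr1 (fun w => ginv * w * ginv) h.
rewrite mulrDr mulrDl !mulrA e2 mul1r -mulrA e1 mulr1 => ->.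
by rewrite addrA addNr add0r.
Qed.
End KoszulCalculus.

(** * The isomorphism with the super bicrossproduct *)

Section Bicrossproduct.
Variables (K : fieldType) (lam : K) (Om : dga K) (g ginv p : Om).
Hypothesis char2 : (2%:R : K) != 0.
Hypothesis pc : planck_calculus lam g ginv p.

Local Notation x := (form_gens g ginv p).
Local Notation dg := (dd g).
Local Notation dp := (dd p).
Local Notation T := (Omega_torus K).
Local Notation L := (Omega_line lam).
Local Notation tg := (to_g K).
Local Notation tgi := (to_ginv K).
Local Notation r := (li_r lam).
Local Notation jT := (torus_map pc).
Local Notation jL := (line_map pc).
Local Notation piT := (torus_proj pc).
Local Notation piL := (line_proj pc).
Local Notation act := (line_act pc).
Local Notation D := (calc_coprod char2 pc).
Local Notation Phi := (calc_coaction char2 pc).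
Local Notation eps := (calc_counit pc).
Local Notation epsL := (@line_counit K lam).
Local Notation epsT := (@torus_counit K).
Local Notation DL := (@line_coprod K lam).
Local Notation DT := (@torus_coprod K).

Let hg := pc_g pc.
Let hgi := pc_ginv pc.
Let hp := pc_p pc.
Let hdg := hc_dd hg.
Let hdp := hc_dd hp.
Let rl := li_r_deg lam.

Let hjT := torus_map_hom pc.
Let hjL := line_map_hom pc.
Let hpiL := line_proj_hom pc.
Let hPhi := coaction_hom char2 pc.
Let hD := coprod_hom char2 pc.
Let heL := line_counit_hom lam.
Let heT := torus_counit_hom K.
Let hid (A : dga K) := dga_hom_id A.
Let lid (V : lmodType K) : linear (id : V -> V). Proof. by []. Qed.

Let ljT := dga_hom_lin hjT.
Let ljL := dga_hom_lin hjL.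
Let lpiL := dga_hom_lin hpiL.
Let lpiT := torus_proj_lin pc.
Let lPhi := dga_hom_lin hPhi.
Let lD := dga_hom_lin hD.

Let jTM a b : jT (a * b) = jT a * jT b.
Proof. by have [[_ [_ h]] _ _] := hjT. Qed.
Let jLM a b : jL (a * b) = jL a * jL b.
Proof. by have [[_ [_ h]] _ _] := hjL. Qed.
Let piLM a b : piL (a * b) = piL a * piL b.
Proof. by have [[_ [_ h]] _ _] := hpiL. Qed.
Let jT1 : jT 1 = 1. Proof. by have [[_ [h _]] _ _] := hjT. Qed.
Let jL1 : jL 1 = 1. Proof. by have [[_ [h _]] _ _] := hjL. Qed.
Let piL1 : piL 1 = 1. Proof. by have [[_ [h _]] _ _] := hpiL. Qed.
Let eT1 : epsT 1 = 1. Proof. by have [[_ [h _]] _ _] := heT. Qed.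
Let eL1 : epsL 1 = 1. Proof. by have [[_ [h _]] _ _] := heL. Qed.
Let DM a b : D (a * b) = (D a : stens Om Om) * D b.
Proof. by have [[_ [_ h]] _ _] := hD. Qed.

Let btE := (fun V W => bilinDl (@bilin_tpure K V W), fun V W => bilinDr (@bilin_tpure K V W),
  fun V W => bilinZl (@bilin_tpure K V W), fun V W => bilinZr (@bilin_tpure K V W)).

(** The left legs of D p = 1 tensor p + p tensor g stay in the line, so on the line the coproduct is
    the coaction itself. Everything about [beta] is drawn from this. *)
Lemma coprod_line h : D (jL h) = tmap jL id (Phi h).
Proof.
apply: (line_hom_ext (dga_hom_comp hjL hD) (dga_hom_comp hPhi (tmap_hom hjL (hid Om)))).
have [_ _ Ep] := coprod_gens char2 pc.
rewrite line_map_r Ep coaction_r (linD _ _ (tmap_lin ljL (@lid _))) !tmap_pure //.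
by rewrite jL1 line_map_r.
Qed.

Lemma coprod_torus t : D (jT t) = tmap jT jT (DT t).
Proof.
have [Eg Ei _] := coprod_gens char2 pc; have [t1 t2] := torus_map_gens pc.
have [d1 d2] := torus_coprod_gens K.
apply: (torus_hom_ext (dga_hom_comp hjT hD) (dga_hom_comp (torus_coprod_hom K) (tmap_hom hjT hjT))).
- by rewrite t1 Eg d1 tmap_pure // t1.
by rewrite t2 Ei d2 tmap_pure // t2.
Qed.

Lemma line_coprodE h : DL h = tmap id piL (Phi h).
Proof.
have [e1 _ e3] := line_proj_gens pc.
apply: (line_hom_ext (line_coprod_hom lam) (dga_hom_comp hPhi (tmap_hom (hid L) hpiL))).
rewrite line_coprod_r coaction_r (linD _ _ (tmap_lin (@lid _) lpiL)) !tmap_pure //.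
by rewrite e1 e3 addrC.
Qed.

Lemma coaction_coassoc h :
  tassoc (tmap Phi id (Phi h)) = tmap id (D : Om -> stens Om Om) (Phi h).
Proof.
have lta := dga_hom_lin (tassoc_hom L Om Om).
have hl := dga_hom_comp (dga_hom_comp hPhi (tmap_hom hPhi (hid Om))) (tassoc_hom L Om Om).
have hr := dga_hom_comp hPhi (tmap_hom (hid L) hD).
have [Eg _ Ep] := coprod_gens char2 pc.
have P1 : Phi 1 = 1 by have [[_ [e _]] _ _] := hPhi.
apply: (line_hom_ext hl hr).
rewrite coaction_r (linD _ _ (tmap_lin lPhi (@lid _))) (linD _ _ (tmap_lin (@lid _) lD)).
rewrite !tmap_pure // coaction_r P1 Ep Eg !btE !(linD _ _ lta) !tassoc_pure.
by rewrite addrA.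
Qed.

Lemma coaction_counitl h : \tsum_(k, w <- Phi h) (epsL k *: w) = jL h.
Proof.
apply: (line_hom_ext (dga_hom_comp hPhi (counitl_hom Om heL)) hjL).
have bs : bilin (fun (k : L) (w : Om) => epsL k *: w).
  exact: (bilin_comp (f := epsL) (g := id) (bilin_scale Om) (dga_hom_lin heL)).
rewrite coaction_r (tsumD _ _ bs) !tsum_pure // eL1 line_counit_r line_map_r.
by rewrite scale1r scale0r addr0.
Qed.

Lemma coaction_counitr h : \tsum_(k, w <- Phi h) (eps w *: k) = h.
Proof.
apply: (line_hom_ext (dga_hom_comp hPhi (counitr_hom L (counit_hom pc))) (hid L)).
have [eg _ ep] := counit_gens pc.
have bs : bilin (fun (k : L) (w : Om) => eps w *: k).
  have b0 := bilin_comp (f := eps) (g := id) (bilin_scale L) (dga_hom_lin (counit_hom pc)) (@lid _).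
  by split=> [w|v]; [apply: b0.2|apply: b0.1].
rewrite coaction_r (tsumD _ _ bs) !tsum_pure // eg ep.
by rewrite scale1r scale0r add0r.
Qed.

Let bsT : bilin (fun a b : T => epsT a *: b).
Proof. exact: (bilin_comp (f := epsT) (g := id) (bilin_scale T) (dga_hom_lin heT)). Qed.
Let bsT' : bilin (fun a b : T => epsT b *: a).
Proof. by split=> [w|v]; [apply: bsT.2|apply: bsT.1]. Qed.

Lemma torus_counitl t : \tsum_(a, b <- DT t) (epsT a *: b) = t.
Proof.
have [d1 d2] := torus_coprod_gens K; have [e1 e2] := torus_counit_gens K.
apply: (torus_hom_ext (dga_hom_comp (torus_coprod_hom K) (counitl_hom T heT)) (hid T)).
- by rewrite d1 tsum_pure // e1 scale1r.
by rewrite d2 tsum_pure // e2 scale1r.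
Qed.
Lemma torus_counitr t : \tsum_(a, b <- DT t) (epsT b *: a) = t.
Proof.
have [d1 d2] := torus_coprod_gens K; have [e1 e2] := torus_counit_gens K.
apply: (torus_hom_ext (dga_hom_comp (torus_coprod_hom K) (counitr_hom T heT)) (hid T)).
- by rewrite d1 tsum_pure // e1 scale1r.
by rewrite d2 tsum_pure // e2 scale1r.
Qed.

Lemma line_projL h : piL (jL h) = h.
Proof.
apply: (line_hom_ext (dga_hom_comp hjL hpiL) (hid L)).
by rewrite line_map_r; case: (line_proj_gens pc).
Qed.

Lemma line_projT t : piL (jT t) = (epsT t)%:A.
Proof.
have [t1 t2] := torus_map_gens pc; have [e1 e2 _] := line_proj_gens pc.
have [c1 c2] := torus_counit_gens K.
apply: (torus_hom_ext (dga_hom_comp hjT hpiL) (scalar_dga_hom L heT)).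
- by rewrite t1 e1 c1 scale1r.
by rewrite t2 e2 c2 scale1r.
Qed.

Lemma torus_projT t : piT (jT t) = t.
Proof. by rewrite -[jT t]mulr1 torus_proj_mulT torus_proj1 mulr1. Qed.
Lemma torus_projL h : piT (jL h) = (epsL h)%:A.
Proof. by rewrite -[jL h]mul1r torus_proj_mulL torus_proj1. Qed.

Lemma torus_counit_proj w : epsT (piT w) = eps w.
Proof.
have [[leT [_ eTM]] _ eTd] := heT; have [[le [e1 eM]] _ ed] := counit_hom pc.
have [c1 c2] := torus_counit_gens K; have [eg ei ep] := counit_gens pc.
elim/(calc_left_ind pc): w => [|a b ha hb|c a ha|j a ha].
- by rewrite torus_proj1 [epsT 1]eT1 [eps 1]e1.
- by rewrite (linD _ _ lpiT) (linD _ _ leT) (linD _ _ le) ha hb.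
- by rewrite (linZ _ _ lpiT) (linZ _ _ leT) (linZ _ _ le) ha.
rewrite torus_proj_gen [eps _]eM -ha; case: j => /=.
- by rewrite [epsT _]eTM c1 eg.
- by rewrite [epsT _]eTM c2 ei.
- rewrite ep mul0r /act_p (linZ _ _ leT) [epsT _]eTM -scaleN1r (linD _ _ leT) (linZ _ _ leT).
  by rewrite eT1 c1 scaleN1r subrr mul0r scaler0.
- by rewrite [epsT _]eTM [epsT (dd _)]eTd [eps _]ed.
rewrite [eps _]ed mul0r /act_dp -scaleN1r !(linZ _ _ leT) [epsT _]eTM [epsT (dd _)]eTd.
by rewrite mul0r !scaler0.
Qed.

(** Straightening rule: moving p to the right of a torus form leaves its action as correction. On g
    and dg it is a relation of the calculus, [conj_step] gives it on the inverse of g, and the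
    derivation property extends it to products; likewise for dp below. *)
Lemma cross_p t : p * jT t = jT (act_p lam t) + jT t * p.
Proof.
have [[a1 a2 a3] [b1 b2 b3 b4] [c1 c2 c3]] := calc_rels pc.
rewrite /= in a1 a2 a3 b1 b2 b3 b4 c1 c2 c3.
have [t1 t2] := torus_map_gens pc; have [e1 e2 e3 e4] := to_relations K.
have hpg : p * g = jT (act_p lam tg) + g * p.
  rewrite act_p_g (linZ _ _ ljT) jTM t1 -scaleN1r (linD _ _ ljT) (linZ _ _ ljT) t1 jT1.
  by rewrite scaleN1r -a3 /lie subrK.
elim/torus_ind: t => [| | |c|a b ha hb|a b ha hb].
- by rewrite t1.
- have := conj_step a1 a2 hpg; rewrite t2 => ->; congr (_ + _).
  have := act_p_mul lam tgi tg; rewrite e2 act_p_one => /esym/eqP.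
  rewrite addr_eq0 => /eqP h.
  have -> : act_p lam tgi = - (tgi * act_p lam tg * tgi).
    by rewrite -[LHS]mulr1 -e1 mulrA h mulNr.
  by have [ajT _ _] := hjT; rewrite (alg_homN _ ajT) !jTM t2.
- rewrite act_p_dg (linZ _ _ ljT) jTM -scaleN1r (linD _ _ ljT) (linZ _ _ ljT) t1 jT1.
  by rewrite torus_map_dg scaleN1r -b4 /lie subrK.
- rewrite (linZ _ _ ljT) jT1 (linZ _ _ (act_p_lin lam)) act_p_one scaler0 (lin0 ljT) add0r.
  by rewrite mulr_algr mulr_algl.
- by rewrite (linD _ _ ljT) mulrDr ha hb (linD _ _ (act_p_lin lam)) (linD _ _ ljT) mulrDl addrACA.
rewrite jTM mulrA ha mulrDl -[jT a * p * _]mulrA hb mulrDr act_p_mul (linD _ _ ljT) !jTM.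
by rewrite !mulrA addrA.
Qed.

Lemma cross_dp t : dp * jT t = jT (act_dp lam t) + jT (par t) * dp.
Proof.
have [[a1 a2 a3] [b1 b2 b3 b4] [c1 c2 c3]] := calc_rels pc.
rewrite /= in a1 a2 a3 b1 b2 b3 b4 c1 c2 c3.
have [t1 t2] := torus_map_gens pc; have [e1 e2 e3 e4] := to_relations K.
have pg : par tg = tg by rewrite (par_hom (to_g_deg K)) scale1r.
have pgi : par tgi = tgi by rewrite (par_hom (to_ginv_deg K)) scale1r.
have hpg : dp * g = jT (act_dp lam tg) + g * dp.
  rewrite act_dp_g -scaleN1r !(linZ _ _ ljT) jTM t1 torus_map_dg -b3.
  by rewrite scaleN1r opprB subrK.
elim/torus_ind: t => [| | |c|a b ha hb|a b ha hb].
- by rewrite t1 pg t1.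
- have := conj_step a1 a2 hpg; rewrite pgi t2 => ->; congr (_ + _).
  have := act_dp_mul lam tgi tg; rewrite e2 act_dp_one pgi => /esym/eqP.
  rewrite addr_eq0 => /eqP h.
  have -> : act_dp lam tgi = - (tgi * act_dp lam tg * tgi).
    by rewrite -[LHS]mulr1 -e1 mulrA h mulNr.
  by have [ajT _ _] := hjT; rewrite (alg_homN _ ajT) !jTM t2.
- rewrite act_dp_dg (lin0 ljT) add0r (par_hom (hc_dd (to_g_deg K))) (linZ _ _ ljT) torus_map_dg.
  by rewrite c3 expr1 scaleN1r mulNr.
- rewrite parZ par_1 (linZ _ _ ljT) jT1 (linZ _ _ (act_dp_lin lam)) act_dp_one scaler0.
  by rewrite (lin0 ljT) add0r mulr_algr mulr_algl.
- rewrite (linD _ _ ljT) mulrDr ha hb (linD _ _ (act_dp_lin lam)) parD !(linD _ _ ljT) mulrDl.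
  by rewrite addrACA.
rewrite jTM mulrA ha mulrDl -[jT (par a) * dp * _]mulrA hb mulrDr act_dp_mul par_mul.
by rewrite (linD _ _ ljT) !jTM !mulrA addrA.
Qed.

Definition bicross_map (u : stens T L) : Om := stens_lift jT jL u.
Local Notation phi := bicross_map.
Definition bicross_inv (w : Om) : stens T L := tmap piT piL (D w).
Local Notation psi := bicross_inv.

Let bphi : bilin (fun (a : T) (b : L) => jT a * jL b).
Proof. exact: bilin_fg. Qed.
Lemma bicross_map_lin : linear phi.
Proof. exact: tsum_lin bphi. Qed.
Let lphi := bicross_map_lin.
Lemma bicross_map_pure t h : phi (t ⊗ h) = jT t * jL h.
Proof. exact: stens_lift_pure. Qed.

Let Fpsi (t : stens Om Om) : Om := phi (tmap piT piL t).
Let lF : linear Fpsi.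
Proof. by move=> c a b; rewrite /Fpsi (tmap_lin lpiT lpiL) lphi. Qed.
Let FE a b : Fpsi (a ⊗ b) = jT (piT a) * jL (piL b).
Proof. by rewrite /Fpsi tmap_pure // bicross_map_pure. Qed.

(** The composite commutes with left multiplication by each generator and fixes 1. For p and dp the
    terms produced by D x_j are precisely those of the straightening rules; the terms with dg in the
    right leg vanish because [piL dg] is 0. *)
Lemma bicross_invK w : phi (psi w) = w.
Proof.
have [Eg Ei Ep] := coprod_gens char2 pc; have [l1 l2 l3] := line_proj_gens pc.
have [t1 t2] := torus_map_gens pc.
have ldg : piL dg = 0 by have [_ _ ->] := hpiL; rewrite l1 dd_one.
have step j (t : stens Om Om) : Fpsi ((D (x j) : stens Om Om) * t) = x j * Fpsi t.
  elim/tens_indh: t => [|t u ht hu|m n a b ha hb].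
  - by rewrite mulr0 !(lin0 lF) mulr0.
  - by rewrite mulrDr !(linD _ _ lF) ht hu mulrDr.
  case: j => /=.
  - rewrite Eg (stens_mulE _ _ hg ha) mul0n scale1r !FE (torus_proj_gen pc Og) piLM l1 mul1r.
    by rewrite jTM t1 mulrA.
  - rewrite Ei (stens_mulE _ _ hgi ha) mul0n scale1r !FE (torus_proj_gen pc Oginv) piLM l2 mul1r.
    by rewrite jTM t2 mulrA.
  - rewrite Ep mulrDl (stens_mulE _ _ hp ha) (stens_mulE _ _ hg ha) !mul0n !scale1r mul1r.
    rewrite (linD _ _ lF) !FE (torus_proj_gen pc Op) !piLM l1 l3 mul1r jLM line_map_r.
    by rewrite [RHS]mulrA cross_p mulrDl -!mulrA addrC.
  - rewrite coprod_dg mulrDl (stens_mulE _ _ hdg ha) (stens_mulE _ _ hg ha) mul0n scale1r.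
    rewrite (linD _ _ lF) (linZ _ _ lF) !FE (torus_proj_gen pc Odg) !piLM l1 ldg mul1r mul0r.
    by rewrite (lin0 ljL) mulr0 scaler0 addr0 jTM torus_map_dg mulrA.
  rewrite coprod_dp !mulrDl (stens_mulE _ _ hdg ha) (stens_mulE _ _ hg ha) (stens_mulE _ _ hdp ha).
  rewrite mul0n mul1n scale1r mul1r !(linD _ _ lF) !(linZ _ _ lF) !FE (torus_proj_gen pc Odp).
  rewrite !piLM l1 ldg mul1r mul0r (lin0 ljL) mulr0 scaler0 addr0.
  have -> : piL dp = dd r by have [_ _ ->] := hpiL; rewrite l3.
  rewrite jLM line_map_dr !mulrA cross_dp mulrDl addrC; congr (_ + _).
  by rewrite (par_hom (torus_proj_deg pc ha)) (linZ _ _ ljT) -!scalerAl.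
rewrite /psi -/(Fpsi (D w)).
elim/(calc_left_ind pc): w => [|a b ha hb|c a ha|j a ha].
- have [[_ [-> _]] _ _] := hD.
  by rewrite [Fpsi 1]FE torus_proj1 piL1 jT1 jL1 mulr1.
- by rewrite (linD _ _ lD) (linD _ _ lF) ha hb.
- by rewrite (linZ _ _ lD) (linZ _ _ lF) ha.
by rewrite DM step ha.
Qed.

(** The common shape of [D (jT t * jL h)], with legs still separate. Its images under three pairs of
    projections are evaluated through [prodTL_ext], where signs are explicit on homogeneous legs. *)
Let prodTL (U : stens T T) (V : stens L Om) : stens Om Om :=
  (tmap jT jT U : stens Om Om) * (tmap jL id V : stens Om Om).
Let prodTL_hom i j k l (a b : T) (h : L) (w : Om) :
  hc i a = a -> hc j b = b -> hc k h = h -> hc l w = w ->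
  prodTL (a ⊗ b) (h ⊗ w) = (-1) ^+ (j * k) *: ((jT a * jL h) ⊗ (jT b * w)).
Proof.
move=> ha hb hh hw; rewrite /prodTL !tmap_pure //.
exact: stens_mulE (dga_hom_deg hjT hb) (dga_hom_deg hjL hh).
Qed.

Let prodTL_ext (W : lmodType K) (N : stens Om Om -> W) (M : stens T T -> stens L Om -> W) :
  linear N -> bilin M ->
  (forall i j k l (a b : T) (h : L) (w : Om),
     hc i a = a -> hc j b = b -> hc k h = h -> hc l w = w ->
     (-1) ^+ (j * k) *: N ((jT a * jL h) ⊗ (jT b * w)) = M (a ⊗ b) (h ⊗ w)) ->
  forall U V, N (prodTL U V) = M U V.
Proof.
move=> lN bM e U V.
have l1 := tmap_lin ljT ljT; have l2 := tmap_lin ljL (@lid Om).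
elim/tens_indh: U => [|t u ht hu|i j a b ha hb].
- by rewrite /prodTL (lin0 l1) mul0r (lin0 lN) (bilin0l bM).
- by rewrite /prodTL (linD _ _ l1) mulrDl (linD _ _ lN) (bilinDl bM) -ht -hu.
elim/tens_indh: V => [|t u ht hu|k l h w hh hw].
- by rewrite /prodTL (lin0 l2) mulr0 (lin0 lN) (bilin0r bM).
- by rewrite /prodTL (linD _ _ l2) mulrDr (linD _ _ lN) (bilinDr bM) -ht -hu.
by rewrite (prodTL_hom ha hb hh hw) (linZ _ _ lN) (e _ _ _ _ _ _ _ _ ha hb hh hw).
Qed.

Let bsL : bilin (fun (k : L) (w : Om) => epsL k *: w).
Proof. exact: (bilin_comp (f := epsL) (g := id) (bilin_scale Om) (dga_hom_lin heL)). Qed.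
Let cL (V : stens L Om) : Om := \tsum_(k, w <- V) (epsL k *: w).
Let lcL : linear cL. Proof. exact: tsum_lin bsL. Qed.

Let epsL_pos k (h : L) : hc k.+1 h = h -> epsL h = 0.
Proof. exact: counit_pos heL. Qed.

Let coprodTL t h : D (jT t * jL h) = prodTL (DT t) (Phi h).
Proof. by rewrite DM coprod_torus coprod_line. Qed.

(** On the terms t_1 h^(0) tensor t_2 h^(1), [piT] applies the counit to h^(0) and [piL] applies it
    to t_2, and the counit laws recover t tensor h. *)
Lemma bicross_mapK u : psi (phi u) = u.
Proof.
have lpsi : linear psi.
  by move=> c a b; rewrite /psi lD (tmap_lin lpiT lpiL).
have key U V : tmap piT piL (prodTL U V) =
    (\tsum_(a, b <- U) (epsT b *: a)) ⊗ piL (cL V).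
  apply: (prodTL_ext (M := fun U V => (\tsum_(a, b <- U) (epsT b *: a)) ⊗ piL (cL V))).
  - exact: tmap_lin.
  - apply: bilin_comp (@bilin_tpure _ _ _) (tsum_lin bsT') _.
    by move=> c a b; rewrite lcL lpiL.
  (* The counit of the leg in the line vanishes unless its degree is 0, and then the sign is 1. *)
  move=> i j [|k] l a b h w ha hb hh hw; rewrite tmap_pure // torus_proj_mulL torus_projT piLM.
    rewrite line_projT muln0 scale1r /cL !tsum_pure // mulr_algl.
    by rewrite (linZ _ _ lpiL) !btE scalerA mulrC -scalerA.
  by rewrite /cL !tsum_pure // (epsL_pos hh) !scale0r (lin0 lpiL)
    (bilin0l (@bilin_tpure _ _ _)) (bilin0r (@bilin_tpure _ _ _)) scaler0.
elim/tens_ind: u => [|u v hu hv|t h].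
- by rewrite (lin0 lphi) (lin0 lpsi).
- by rewrite (linD _ _ lphi) (linD _ _ lpsi) hu hv.
rewrite bicross_map_pure /psi coprodTL key torus_counitr /cL coaction_counitl.
by rewrite line_projL.
Qed.

Definition bicross_beta (h : L) : tens L T := tmap id piT (Phi h).
Local Notation beta := bicross_beta.

Lemma bicross_beta_lin : linear beta.
Proof. by move=> c a b; rewrite /beta lPhi (tmap_lin (@lid L) lpiT). Qed.

(** Insert [phi (psi w) = w] in the right leg of [Phi h] and regroup by coassociativity: the new
    middle leg is projected to the torus, giving [beta], and the last one to the line, giving [DL].
    This puts the coaction in bicrossproduct form. *)
Lemma coaction_beta h :
  Phi h = \tsum_(h1, h2 <- DL h) \tsum_(k, a <- beta h1) (k ⊗ (jT a * jL h2)).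
Proof.
have bin h2 : bilin (fun (k : L) (a : T) => k ⊗ (jT a * jL h2)).
  apply: (bilin_comp (f := id) (g := fun a => jT a * jL h2)) (@bilin_tpure _ _ _) _ _ => //.
  by move=> c a b; rewrite ljT mulrDl scalerAl.
have bout : bilin (fun h1 h2 => \tsum_(k, a <- beta h1) (k ⊗ (jT a * jL h2))).
  split=> [h2|h1] c a b.
    by rewrite bicross_beta_lin (tsum_lin (bin h2)).
  rewrite /tsum scaler_sumr -big_split; apply: eq_bigr => z _ /=.
  by rewrite ljL mulrDr -scalerAr !btE.
rewrite line_coprodE tsum_tmap //.
transitivity (tmap id Fpsi (tmap id (D : Om -> stens Om Om) (Phi h))).
  rewrite tmap_tmap // -[LHS]tmap_id; apply: eq_tmap => // w.
  by rewrite -[RHS]/(phi (psi w)) bicross_invK.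
rewrite -coaction_coassoc tmap_tassoc //; apply: eq_tsum => k w.
rewrite /beta tsum_tmap //; apply: eq_tsum => k' v.
by rewrite FE.
Qed.

(** [piT] respects coproducts although it is not multiplicative: on w = t h both sides equal the
    counit of h times [DT t]. *)
Lemma torus_proj_coprod w : tmap piT piT (D w) = DT (piT w).
Proof.
have ldt := dga_hom_lin (torus_coprod_hom K).
have ll : linear (fun w => tmap piT piT (D w)).
  by move=> c a b; rewrite lD (tmap_lin lpiT lpiT).
have lr : linear (fun w => DT (piT w)) by move=> c a b; rewrite lpiT ldt.
rewrite -(bicross_invK w); elim/tens_ind: (psi w) => [|u v hu hv|t h].
- by rewrite (lin0 lphi) (lin0 ll) (lin0 lr).
- by rewrite (linD _ _ lphi) (linD _ _ ll) (linD _ _ lr) hu hv.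
have bM b' : linear (fun b : T => b * b' : T).
  by move=> c a b; rewrite mulrDl scalerAl.
pose M (U : stens T T) (V : stens L Om) : tens T T := tmap id (fun b => b * piT (cL V)) U.
have key U V : tmap piT piT (prodTL U V) = M U V.
  apply: prodTL_ext; first exact: tmap_lin.
    split=> [V'|U'] c a b; first by rewrite /M (tmap_lin (@lid T) (bM _)).
    rewrite /M /tmap /tsum scaler_sumr -big_split; apply: eq_bigr => z _ /=.
    by rewrite lcL lpiT mulrDr -scalerAr !btE.
  move=> i j [|k] l a b h' w' ha hb hh hw; rewrite /M !tmap_pure //;
    rewrite torus_proj_mulL torus_projT torus_proj_mulT.
    by rewrite muln0 scale1r /cL tsum_pure // (linZ _ _ lpiT) -scalerAr !btE.
  by rewrite /cL tsum_pure // (epsL_pos hh) !scale0r (lin0 lpiT) mulr0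
    (bilin0l (@bilin_tpure _ _ _)) (bilin0r (@bilin_tpure _ _ _)) scaler0.
rewrite bicross_map_pure coprodTL key /M /cL coaction_counitl torus_projL.
rewrite torus_proj_mulL torus_projT (linZ _ _ ldt).
have lm := tmap_lin (@lid T) (bM (epsL h)%:A).
elim/tens_ind: (DT t) => [|U V hU hV|a b].
- by rewrite (lin0 lm) scaler0.
- by rewrite (linD _ _ lm) hU hV scalerDr.
by rewrite tmap_pure // mulr_algr !btE.
Qed.

(** Projecting in the opposite order applies the counit to t_1 and leaves t_2 multiplying [beta h].
    This product is what produces the factor a b in the compatibility of [beta] with [DL]. *)
Lemma torus_line_coprod t h :
  tmap piL piT (D (jT t * jL h)) = ((1 : L) ⊗ t : stens L T) * beta h.
Proof.
pose M (U : stens T T) (V : stens L Om) : stens L T :=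
  ((1 : L) ⊗ (\tsum_(a, b <- U) (epsT a *: b)) : stens L T) * tmap id piT V.
have lt := tmap_lin (@lid L) lpiT.
have key U V : tmap piL piT (prodTL U V) = M U V.
  apply: (@prodTL_ext (stens L T) (tmap piL piT) M); first exact: tmap_lin.
    split=> [V'|U'] c a b; rewrite /M.
      by rewrite (tsum_lin bsT) !btE mulrDl scalerAl.
    by rewrite lt mulrDr scalerAr.
  move=> i j k l a b h' w' ha hb hh hw; rewrite /M !tmap_pure // tsum_pure //.
  rewrite btE -scalerAl (stens_mulE _ _ hb hh) mul1r.
  rewrite piLM line_projT line_projL torus_proj_mulT mulr_algl btE.
  by rewrite !scalerA mulrC.
by rewrite coprodTL key /M torus_counitl.
Qed.

Lemma bicross_beta_coalgebra : super_comodule_coalgebra DT epsT DL epsL beta.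
Proof.
have dT := torus_proj_deg pc.
split.
- split; first exact: bicross_beta_lin.
  move=> n h; have [_ Ph _] := hPhi; rewrite /beta Ph; apply: tmap_hc => //.
- move=> h; have e1 : bilin (fun (k : L) (a : T) =>
      \tsum_(k0, k1 <- beta k) (k0 ⊗ (k1 ⊗ a))).
    have b0 a : bilin (fun (k0 : L) (k1 : T) => k0 ⊗ (k1 ⊗ a)).
      by split=> [u|u] c b b'; rewrite !btE.
    split=> [a|k] c u v; first by rewrite bicross_beta_lin (tsum_lin (b0 _ a)).
    by rewrite /tsum scaler_sumr -big_split; apply: eq_bigr => z _ /=; rewrite !btE.
  have e2 : bilin (fun (k : L) (a : T) => k ⊗ DT a).
    apply: (bilin_comp (f := id)) (@bilin_tpure _ _ _) _ _ => //.
    exact: dga_hom_lin (torus_coprod_hom K).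
  rewrite {1}/beta tsum_tmap // [in RHS]/beta tsum_tmap //.
  (* Coassociativity of the coaction with both right legs projected to the torus, where [piT] is a
     coalgebra map. *)
  transitivity (tmap id (tmap piT piT) (tmap id (D : Om -> stens Om Om) (Phi h))).
    rewrite -coaction_coassoc tmap_tassoc; last exact: tmap_lin.
    apply: eq_tsum => k w; rewrite /beta tsum_tmap; last first.
      by split=> [u|u] c b b'; rewrite !btE.
    by apply: eq_tsum => k' v; rewrite tmap_pure.
  rewrite tmap_tmap //; last exact: tmap_lin.
  by apply: eq_tsum => k w; rewrite torus_proj_coprod.
- move=> h; rewrite /beta tsum_tmap; last first.
    have b0 := bilin_comp (f := epsT) (g := id) (bilin_scale L) (dga_hom_lin heT) (@lid _).
    by split=> [w|v]; [apply: b0.2|apply: b0.1].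
  rewrite -[RHS]coaction_counitr; apply: eq_tsum => k w.
  by rewrite torus_counit_proj.
- move=> h; pose theta (w : Om) : stens L T := tmap piL piT (D w).
  have lth : linear theta by move=> c a b; rewrite /theta lD (tmap_lin lpiL lpiT).
  have lDL := dga_hom_lin (line_coprod_hom lam).
  have b0 a : bilin (fun k1 k2 : L => k1 ⊗ (k2 ⊗ a) : tens L (tens L T)).
    by split=> [u|u] c b b'; rewrite !btE.
  have e1 : bilin (fun (k : L) (a : T) => \tsum_(k1, k2 <- DL k) (k1 ⊗ (k2 ⊗ a))).
    split=> [a|k] c u v; first by rewrite lDL (tsum_lin (b0 a)).
    by rewrite /tsum scaler_sumr -big_split; apply: eq_bigr => z _ /=; rewrite !btE.
  rewrite {1}/beta tsum_tmap //.
  (* The same with the right legs projected to the line and the torus: the first projection turns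
     [Phi] into [DL], and the other side is expanded by [coaction_beta] and [torus_line_coprod]. *)
  transitivity (tmap id (tmap piL piT) (tmap id (D : Om -> stens Om Om) (Phi h))).
    rewrite -coaction_coassoc tmap_tassoc; last exact: tmap_lin.
    apply: eq_tsum => k w; rewrite line_coprodE tsum_tmap //.
    by apply: eq_tsum => k' v; rewrite tmap_pure.
  rewrite tmap_tmap //; last exact: tmap_lin.
  have lt := tmap_lin (@lid L) lth.
  transitivity (tmap id theta (Phi h)); first exact: eq_tmap.
  rewrite coaction_beta (lin_tsum _ _ lt); apply: eq_tsum => h1 h2.
  rewrite (lin_tsum _ _ lt); apply: eq_tsum => k a.
  rewrite tmap_pure // /theta torus_line_coprod.
  have lk : linear (fun y : stens L T => k ⊗ (((1 : L) ⊗ a : stens L T) * y)).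
    by move=> c u v; rewrite mulrDr -scalerAr !btE.
  rewrite [beta h2 in LHS]tensE (lin_tsum _ _ lk); apply: eq_tsum => l b.
  rewrite stens_mul_kos (lin_kos (f := fun y : stens L T => k ⊗ y)); last first.
    by move=> c u v; rewrite !btE.
  by apply: eq_kos => a' l'; rewrite mul1r.
move=> h; rewrite /beta tsum_tmap; last first.
  exact: (bilin_comp (f := epsL) (g := id) (bilin_scale T) (dga_hom_lin heL)).
rewrite -torus_projL -coaction_counitl (lin_tsum _ _ lpiT).
by apply: eq_tsum => k w; rewrite (linZ _ _ lpiT).
Qed.

Lemma bicross_beta_planck : planck_beta beta.
Proof.
have t0 := torus_proj1 pc.
have P1 j : piT (x j) = rep_op lam j 1 by rewrite -[x j]mulr1 torus_proj_gen t0.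
have Pp : piT p = 0 by rewrite (P1 Op) /= act_p_one.
have Pdp : piT dp = 0 by rewrite (P1 Odp) /= act_dp_one.
have Pg : piT g = tg by rewrite (P1 Og) /= mulr1.
have Pdg : piT dg = dd tg by rewrite (P1 Odg) /= mulr1.
have lt := tmap_lin (@lid L) lpiT.
have [_ _ Pd] := hPhi.
split; first exact: bicross_beta_coalgebra.
- rewrite /beta coaction_r (linD _ _ lt) !tmap_pure // Pp Pg.
  by rewrite (bilin0r (@bilin_tpure _ _ _)) add0r.
rewrite /beta Pd coaction_r coaction_dd // !(linD _ _ lt) !tmap_pure // Pdp Pg Pdg.
by rewrite (bilin0r (@bilin_tpure _ _ _)) add0r.
Qed.

(** [cross_p] and [cross_dp] iterated over the words of the line: the general rule for moving a line
    form past a torus form, hence the multiplication of the bicrossproduct. *)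
Lemma line_torus_product e t : jL e * jT t =
  \tsum_(e1, e2 <- DL e) kos (fun e2 t => jT (act e1 t) * jL e2) e2 t.
Proof.
have ba := line_act_lin_l pc.
have bk k1 : bilin (fun (k2 : L) (a : T) => jT (act k1 a) * jL k2).
  split=> [y|y] c u v.
    by rewrite ljL mulrDr scalerAr.
  by rewrite (bilinDr ba) (bilinZr ba) ljT mulrDl scalerAl.
have bF c : bilin (fun k1 k2 : L => kos (fun k2 a => jT (act k1 a) * jL k2) k2 c).
  split=> [y|y] c' u v; last exact: (bilin_kos (bk y)).1.
  by apply: kos_addl => b' d'; rewrite (bilinDl ba) (bilinZl ba) ljT mulrDl scalerAl.
elim/hc_indh: t => [|u v hu hv|n a ha].
- rewrite (lin0 ljT) mulr0 /tsum big1 // => z _.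
  exact: (bilin0r (bilin_kos (bk _))).
- rewrite (linD _ _ ljT) mulrDr hu hv /tsum -big_split; apply: eq_bigr => z _ /=.
  by rewrite (bilinDr (bilin_kos (bk _))).
pose F t := \tsum_(h1, h2 <- t) kos (fun h2 a => jT (act h1 a) * jL h2) h2 a.
have lF' : linear F := tsum_lin (bF a).
have FP m e1 e2 : hc m e2 = e2 ->
    F (e1 ⊗ e2) = (-1) ^+ (m * n) *: (jT (act e1 a) * jL e2).
  by move=> h2; rewrite /F tsum_pure // (kos_hom (bk e1) h2 ha).
have h1 := hc_one L; have drl := hc_dd rl.
have Fr (t : stens L L) : F (((r ⊗ 1 : stens L L) + 1 ⊗ r) * t) = p * F t.
  elim/tens_indh: t => [|t u ht hu|i j e1 e2 he1 he2].
  - by rewrite mulr0 !(lin0 lF') mulr0.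
  - by rewrite mulrDr !(linD _ _ lF') ht hu mulrDr.
  rewrite mulrDl (stens_mulE _ _ h1 he1) (stens_mulE _ _ rl he1) !mul0n !scale1r !mul1r.
  rewrite (linD _ _ lF') !(FP j _ _ he2) (FP j _ _ (hc_mul rl he2)).
  rewrite line_act_mul line_act_r jLM line_map_r -scalerAr [p * (_ * _)]mulrA cross_p mulrDl.
  by rewrite scalerDr !mulrA.
have Fd (t : stens L L) : F (((dd r ⊗ 1 : stens L L) + 1 ⊗ dd r) * t) = dp * F t.
  elim/tens_indh: t => [|t u ht hu|i j e1 e2 he1 he2].
  - by rewrite mulr0 !(lin0 lF') mulr0.
  - by rewrite mulrDr !(linD _ _ lF') ht hu mulrDr.
  rewrite mulrDl (stens_mulE _ _ h1 he1) (stens_mulE _ _ drl he1) mul0n mul1n scale1r !mul1r.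
  rewrite (linD _ _ lF') (linZ _ _ lF') !(FP j _ _ he2) (FP j.+1 _ _ (hc_mul drl he2)).
  rewrite line_act_mul line_act_dr jLM line_map_dr -scalerAr [dp * (_ * _)]mulrA cross_dp.
  rewrite (par_hom (line_act_deg pc he1 ha)) [jT ((-1) ^+ (i + n) *: _)](linZ _ _ ljT) mulrDl.
  rewrite -!scalerAl scalerDr !scalerA -!exprD -mulrA.
  by have -> : (i + j.+1 * n = j * n + (i + n))%N by rewrite mulSn addnA addnC.
rewrite -/(F (DL e)).
elim/line_left_ind: e => [|u v hu hv|c u hu|u hu|u hu].
- have [[_ [D1 _]] _ _] := line_coprod_hom lam.
  by rewrite jL1 mul1r [DL 1]D1 (FP 0%N) // scale1r line_act_one jL1 mulr1.
- by rewrite (linD _ _ ljL) mulrDl hu hv (linD _ _ (dga_hom_lin (line_coprod_hom lam))) (linD _ _ lF').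
- by rewrite (linZ _ _ ljL) -scalerAl hu (linZ _ _ (dga_hom_lin (line_coprod_hom lam))) (linZ _ _ lF').
- by rewrite jLM line_map_r -mulrA hu line_coprod_mulr Fr.
by rewrite jLM line_map_dr -mulrA hu line_coprod_muldr Fd.
Qed.

Lemma bicross_map_mul u v : phi (bicross_mul DL act u v) = phi u * phi v.
Proof.
have lmr (w : Om) : linear (fun y : Om => y * w) by move=> c a b; rewrite mulrDl scalerAl.
have lml (w : Om) : linear (fun y : Om => w * y) by move=> c a b; rewrite mulrDr scalerAr.
have lphi' : linear (phi : tens T L -> Om) := lphi.
rewrite /bicross_mul (lin_tsum _ _ lphi') {2}/phi /stens_lift [RHS](lin_tsum _ _ (lmr _)).
apply: eq_tsum => w e; rewrite (lin_tsum _ _ lphi') [in RHS]/phi;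
  rewrite [in RHS]/stens_lift [RHS](lin_tsum _ _ (lml _)).
apply: eq_tsum => t y; rewrite (lin_tsum _ _ lphi').
rewrite -mulrA [jL e * _]mulrA line_torus_product.
have ls : linear (fun z : Om => jT w * (z * jL y)).
  by move=> c a b; rewrite mulrDl mulrDr -scalerAl -scalerAr.
rewrite [RHS](lin_tsum _ _ ls); apply: eq_tsum => e1 e2.
rewrite (lin_kos _ _ _ lphi') (lin_kos _ _ _ ls); apply: eq_kos => b c.
by rewrite bicross_map_pure jTM jLM !mulrA.
Qed.

(** D (t h) is [DT t] times the expansion of [Phi h] by [coaction_beta]. The sign in the
    bicrossproduct coproduct is the one from moving t_2 past h_1^(0) in the super tensor product. *)
Lemma bicross_map_coprod u :
  D (phi u) = tmap phi phi (bicross_coprod DT DL beta u).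
Proof.
have lpp := tmap_lin lphi lphi.
have lmr (w : stens Om Om) : linear (fun y : stens Om Om => y * w).
  by move=> c a b; rewrite mulrDl scalerAl.
have lml (w : stens Om Om) : linear (fun y : stens Om Om => w * y).
  by move=> c a b; rewrite mulrDr scalerAr.
have ltj := tmap_lin ljL (@lid Om).
rewrite /bicross_coprod (lin_tsum _ _ lpp) [phi u]/phi /stens_lift (lin_tsum _ _ lD).
apply: eq_tsum => w e; rewrite DM coprod_torus coprod_line coaction_beta.
rewrite (lin_tsum _ _ lpp) [tmap jT jT _]/tmap [LHS](lin_tsum _ _ (lmr _)).
apply: eq_tsum => w1 w2; rewrite (lin_tsum _ _ lpp) (lin_tsum _ _ ltj) [LHS](lin_tsum _ _ (lml _)).
apply: eq_tsum => e1 e2; rewrite (lin_tsum _ _ lpp) (lin_tsum _ _ ltj) [LHS](lin_tsum _ _ (lml _)).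
apply: eq_tsum => k a; rewrite tmap_pure // stens_mul_kos.
rewrite (lin_kos _ _ _ lpp) (kos_map (f := jT) (g := jL)) //.
- by apply: eq_kos => b c; rewrite tmap_pure // !bicross_map_pure jTM mulrA.
- exact: bl_bc.
- by move=> n b hb; apply: dga_hom_deg hjT hb.
by move=> n b hb; apply: dga_hom_deg hjL hb.
Qed.

Lemma bicross_map_iso : bicross_iso DT DL act beta D phi.
Proof.
split.
- by split; [exact: bicross_map_lin|exists psi; [exact: bicross_mapK|exact: bicross_invK]].
- by split; [rewrite bicross_map_pure jT1 jL1 mulr1|exact: bicross_map_mul].
- exact: bicross_map_coprod.
- by move=> n u; apply: stens_lift_hc.
by move=> u; apply: stens_lift_dd.
Qed.
End Bicrossproduct.

Local Open Scope complex_scope.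

Theorem proposition5p4 (R : realType) (lam : R[i])
    (lam_neq0 : lam != 0) (lam_imag : complex.Re lam = 0) :
  exists (Om : dga R[i]) (i : planck lam -> Om) (D : Om -> tens Om Om),
    let g := i (pl_g lam) in
    let ginv := i (pl_ginv lam) in
    let p := i (pl_p lam) in
    [/\ [/\ exterior_algebra i,
            strongly_bicovariant (@planck_coprod _ lam) i D
          & differentiable (@planck_coaction _ lam) (@line_incl _ lam) i],
        forall (Om' : dga R[i]) (i' : planck lam -> Om'),
          exterior_algebra i' ->
          differentiable (@planck_coaction _ lam) (@line_incl _ lam) i' ->
          exists f : Om -> Om',
            [/\ dga_hom f, forall a, f (i a) = i' a,
                forall w', exists w, f w = w'
              & forall D' : Om' -> tens Om' Om',
                  strongly_bicovariant (@planck_coprod _ lam) i' D' ->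
                  forall w, D' (f w) = tmap f f (D w)],
        presented (omega_rels lam)
          (fun j : omega_gen =>
             match j with
             | Og => g | Oginv => ginv | Op => p | Odg => dd g | Odp => dd p
             end),
        exists (act : Omega_line lam -> Omega_torus R[i] -> Omega_torus R[i])
               (beta : Omega_line lam -> tens (Omega_line lam) (Omega_torus R[i]))
               (phi : tens (Omega_torus R[i]) (Omega_line lam) -> Om),
          [/\ planck_action act, planck_beta beta,
              bicross_iso (@torus_coprod R[i]) (@line_coprod _ lam) act beta D phi
            & [/\ phi (to_g R[i] ⊗ 1) = g, phi (to_ginv R[i] ⊗ 1) = ginv
                & phi (1 ⊗ li_r lam) = p]]
      & [/\ D g = g ⊗ g,
            D (dd g) = dd g ⊗ g + g ⊗ dd g,
            D p = 1 ⊗ p + p ⊗ g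
          & D (dd p) = 1 ⊗ dd p + dd p ⊗ g + p ⊗ dd g]].
Proof.
have char2 : (2%:R : R[i]) != 0 by rewrite Num.Theory.pnatr_eq0.
have [Om [g [ginv [p pc]]]] := planck_forms_calculus lam.
exists Om, (@calc_incl _ lam Om g ginv p), (calc_coprod char2 pc).
have [-> -> ->] := incl_gens pc.
have [Dg _ Dp] := coprod_gens char2 pc.
split.
- split; first exact: incl_exterior.
    exact: coprod_strongly_bicovariant.
  exact: coaction_differentiable.
- by move=> Om' i' ext diff; apply: calc_universal.
- exact: pc_pres pc.
- exists (line_act pc), (bicross_beta char2 pc), (bicross_map pc); split.
  + exact: line_act_planck.
  + exact: bicross_beta_planck.
  + exact: bicross_map_iso.
  have [t1 t2] := torus_map_gens pc.
  have [[_ [jT1 _]] _ _] := torus_map_hom pc; have [[_ [jL1 _]] _ _] := line_map_hom pc.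
  by rewrite !bicross_map_pure jL1 jT1 t1 t2 line_map_r !mulr1 mul1r.
split=> //; [exact: coprod_dg|exact: coprod_dp].
Qed.
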